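(* Let $A\in\mathbb{R}^{n,n}$ be a Hurwitz matrix ($sI_n-A$ nonsingular for $\mathrm{Re}(s)\ge0$), $B_1\in\mathbb{R}^{n,k}$, $B_2\in\mathbb{R}^{n,q}$, $Q=Q'\in\mathbb{R}^{n+k+q,n+k+q}$, $\sigma(x,v,w)=[x;v;w]'Q[x;v;w]$, $B=[B_1,B_2]$, and for $s\in j\mathbb{R}$ let $\Pi(s)=[(sI_n-A)^{-1}B;\,I_{k+q}]'Q[(sI_n-A)^{-1}B;\,I_{k+q}]=\begin{bmatrix}\Pi_{11}(s)&\Pi_{12}(s)\\ \Pi_{21}(s)&\Pi_{22}(s)\end{bmatrix}$ with $\Pi_{11}(s)\in\mathbb{C}^{k,k}$, $\Pi_{22}(s)\in\mathbb{C}^{q,q}$. Assume there exist $\epsilon>0$ and $s_0\in j\mathbb{R}$ such that $$\begin{bmatrix}\Pi_{11}(s)&\epsilon\Pi_{12}(s)\\ \epsilon\Pi_{21}(s)&-\Pi_{22}(s)\end{bmatrix}\ge0\ \ \forall s\in j\mathbb{R},\qquad \Pi_{11}(s_0)>0,\ \Pi_{22}(s_0)<0.$$ For $a\in\mathbb{R}^n$ define $g:L^2_k\times L^2_q\to\mathbb{R}$ by $g(v,w)=\int_0^\infty\sigma(x(t),v(t),w(t))\,dt$, where $\dot x(t)=Ax(t)+B_1v(t)+B_2w(t)$, $x(0)=a$. Then for every $a\in\mathbb{R}^n$: (a) $g_v(w)=\inf_{v\in L^2_k}g(v,w)$ and $g_w(v)=\sup_{w\in L^2_q}g(v,w)$ are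 (finite and) continuous in the standard norm topologies of $L^2_q$ and $L^2_k$ respectively; (b) $\inf_{v\in L^2_k}\sup_{w\in L^2_q}g(v,w)=\sup_{w\in L^2_q}\inf_{v\in L^2_k}g(v,w)$.
   Context: $j\mathbb{R}=\{s\in\mathbb{C}:\mathrm{Re}(s)=0\}$. $L^2_m$ is the real Hilbert space of square integrable $u:[0,\infty)\to\mathbb{R}^m$ with norm $(\int_0^\infty|u(t)|^2dt)^{1/2}$. $M'$ denotes conjugate transpose; $[x;v;w]$ the stacked vector; $\ge0,>0,<0$ for Hermitian matrices denote semidefinite/definite orderings. *)

(* Defs.v *)
From HB Require Import structures.
From mathcomp Require Import all_boot all_order all_algebra.
From mathcomp Require Import all_classical all_reals all_analysis.
From mathcomp Require Import complex.
Set Implicit Arguments. Unset Strict Implicit. Unset Printing Implicit Defensive.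
Import Order.TTheory GRing.Theory Num.Theory.
Local Open Scope classical_set_scope.
Local Open Scope ring_scope.

Section Defs.
Variable R : realType.
Local Notation C := (R[i]).

Definition cmx (m n : nat) (M : 'M[R]_(m, n)) : 'M[C]_(m, n) :=
  map_mx (fun r => (r%:C)%C) M.

Definition ctr (m n : nat) (M : 'M[C]_(m, n)) : 'M[C]_(n, m) :=
  (map_mx Num.conj M)^T.

Definition hermitian (m : nat) (M : 'M[C]_m) : Prop := ctr M = M.

Definition psd (m : nat) (M : 'M[C]_m) : Prop :=
  hermitian M /\ forall z : 'cV[C]_m, 0 <= (ctr z *m M *m z) 0 0.
Definition posdef (m : nat) (M : 'M[C]_m) : Prop :=
  hermitian M /\ forall z : 'cV[C]_m, z != 0 -> 0 < (ctr z *m M *m z) 0 0.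
Definition negdef (m : nat) (M : 'M[C]_m) : Prop :=
  hermitian M /\ forall z : 'cV[C]_m, z != 0 -> (ctr z *m M *m z) 0 0 < 0.

Definition hurwitz (n : nat) (A : 'M[R]_n) : Prop :=
  forall s : C, 0 <= complex.Re s -> (s%:M - cmx A) \in unitmx.

Definition Pi (n k q : nat) (A : 'M[R]_n) (B1 : 'M[R]_(n, k)) (B2 : 'M[R]_(n, q))
  (Q : 'M[R]_(n + (k + q))) (s : C) : 'M[C]_(k + q) :=
  let M : 'M[C]_(n + (k + q), k + q) :=
    col_mx (invmx (s%:M - cmx A) *m cmx (row_mx B1 B2)) 1%:M in
  ctr M *m cmx Q *m M.

Definition Rplus : set R := `[0%R, +oo[%classic.

Definition sqnorm (m : nat) (u : 'cV[R]_m) : R := \sum_(i < m) (u i 0) ^+ 2.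

Definition L2 (m : nat) : set (R -> 'cV[R]_m) :=
  [set u : R -> 'cV[R]_m | (forall i : 'I_m, measurable_fun Rplus (fun t => u t i 0)) /\
           (\int[lebesgue_measure]_(t in Rplus) (sqnorm (u t))%:E < +oo)%E].

Definition L2norm (m : nat) (u : R -> 'cV[R]_m) : R :=
  Num.sqrt (fine (\int[lebesgue_measure]_(t in Rplus) (sqnorm (u t))%:E)%E).

Definition is_solution (n k q : nat) (A : 'M[R]_n) (B1 : 'M[R]_(n, k))
  (B2 : 'M[R]_(n, q)) (a : 'cV[R]_n) (v : R -> 'cV[R]_k) (w : R -> 'cV[R]_q)
  (x : R -> 'cV[R]_n) : Prop :=
  forall t : R, 0 <= t ->
    (forall i : 'I_n, lebesgue_measure.-integrable `[0%R, t]%classic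
        (fun tau => ((A *m x tau + B1 *m v tau + B2 *m w tau) i 0)%:E)) /\
    x t = a + \col_(i < n)
      (\int[lebesgue_measure]_(tau in `[0%R, t]%classic)
          (A *m x tau + B1 *m v tau + B2 *m w tau) i 0)%R.

(* the state trajectory (a chosen solution; solutions exist and are unique
   for L^2 inputs) *)
Definition traj (n k q : nat) (A : 'M[R]_n) (B1 : 'M[R]_(n, k))
  (B2 : 'M[R]_(n, q)) (a : 'cV[R]_n) (v : R -> 'cV[R]_k) (w : R -> 'cV[R]_q)
  : R -> 'cV[R]_n :=
  xget (fun _ => 0) (is_solution A B1 B2 a v w).

Definition sigma (n k q : nat) (Q : 'M[R]_(n + (k + q)))
  (x : 'cV[R]_n) (v : 'cV[R]_k) (w : 'cV[R]_q) : R :=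
  let z := col_mx x (col_mx v w) in (z^T *m Q *m z) 0 0.

Definition gfun (n k q : nat) (A : 'M[R]_n) (B1 : 'M[R]_(n, k))
  (B2 : 'M[R]_(n, q)) (Q : 'M[R]_(n + (k + q))) (a : 'cV[R]_n)
  (v : R -> 'cV[R]_k) (w : R -> 'cV[R]_q) : \bar R :=
  (\int[lebesgue_measure]_(t in Rplus)
     (sigma Q (traj A B1 B2 a v w t) (v t) (w t))%:E)%E.

End Defs.
Arguments L2 {R} m.
Arguments Rplus {R}.

(* Main.v *)
(** On square integrable signals let [S] invert [1 + d/dt] with zero initial
value; [U = 1 - 2 S] is an isometry. The pay-off is a quadratic functional of
the inputs whose quadratic part is invariant under [U] and acts like [Pi] at
the frequency [s = (1 + z) / (1 - z)] on signals [u] with [U u] close to [z u].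
Factoring [U^(2^p) + 1] over the unit circle yields, from any [u] and by the
parallelogram law, such approximate eigenvectors [y] with [q y <= 2^p q u] and
a residual bounded independently of [p]; dividing by [2^p] turns every
frequency inequality into an inequality for [q]. The hypothesis thus makes the
game convex in [v], concave in [w], with a cross term bounded by the two
seminorms.

The linear terms due to the initial state are controlled as follows. Since
[Pi11 s0 > 0], the determinant of [Pi11] is a nonzero rational function, so
that [Pi11] dominates [c * prod |z - z_l|^2] for finitely many points [z_l] of
the circle, and hence [q v] dominates the norm of [prod (U - z_l) v]; and the
coupling of [v] with an initial state is the coupling of [prod (U - z_l) v]
with another one. A quadratic game with such bounds has continuous upper and
lower values, and approximate saddle points. *)
Require Import Defs.
From HB Require Import structures.
From mathcomp Require Import all_boot all_order all_algebra.
From mathcomp Require Import all_classical all_reals all_analysis.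
From mathcomp Require Import measurable_realfun complex ring lra.
Set Implicit Arguments. Unset Strict Implicit. Unset Printing Implicit Defensive.
Import Order.TTheory GRing.Theory Num.Theory.
Import numFieldNormedType.Exports.
Local Open Scope classical_set_scope.
Local Open Scope ring_scope.

(** * Calculus on the half-line *)

(** No Fourier transform is used to pass from frequencies to signals. On the half-line [U] has no
    eigenvector of positive norm to test a form with; therefore only approximate ones are produced,
    and every frequency statement ([tracks], [has_symbol]) carries an error measured by [U u - z u].
    The obstacle is the lack of coercivity. The hypothesis is strict at a single frequency, so
    [Pi11] and [- Pi22] may degenerate at other frequencies and at infinity, which is the point
    [z = 1]. The quadratic parts are then mere seminorms, optimal inputs need not exist, and weak
    compactness is out of reach. Hence the linear terms must be bounded by these seminorms rather
    than by the norm, and near-optimal inputs replace optimal ones. Invariance under [U] holds for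
    the response from rest, not for the one started at [a]; this is why the initial state is
    confined to linear terms. The number [eps] enters through the bound
    [b v w ^ 2 <= eps ^ -2 * q1 v v * q2 w w] on the cross term, which keeps a near-optimal answer
    of one player stable when the other player moves slightly. *)

Section integral_parts.
Variable R : realType.
Notation mu := (@lebesgue_measure R).

Definition integ (D : set R) (f : R -> R) := mu.-integrable D (EFin \o f).

Let wedge (f g : R -> R) (z : R * R) : \bar R :=
  (f z.1 * (g z.2 * (z.2 <= z.1)%R%:R))%:E.

Lemma wedge_integrable (f g : R -> R) : integ setT f -> integ setT g ->
  (mu \x mu)%E.-integrable setT (wedge f g).
Proof.
move=> If Ig.
have mf : measurable_fun setT f by apply/measurable_EFinP; case/integrableP: If.
have mg : measurable_fun setT g by apply/measurable_EFinP; case/integrableP: Ig.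
set h := wedge f g.
have mh : measurable_fun setT h.
  apply/measurable_EFinP; apply: measurable_funM.
    exact: measurableT_comp.
  apply: measurable_funM; first exact: measurableT_comp.
  rewrite (_ : (fun z : R * R => _) = (fun z => if z.2 <= z.1 then 1 else 0)).
    by apply: measurable_fun_ifT => //; exact: measurable_fun_ler.
  by apply/funext => z; case: (_ <= _).
have bd (x y : R) : (`|h (x, y)| <= `|(f x)%:E| * `|(g y)%:E|)%E.
  rewrite /h /wedge !abse_EFin -EFinM lee_fin /= !normrM ler_wpM2l//.
  by case: (y <= x); rewrite ?normr1 ?normr0 ?mulr1 ?mulr0.
apply/integrable12ltyP => //.
  have [M fM] : exists M : R, (\int[mu]_y `|(g y)%:E| = M%:E)%E.
    exists (fine (\int[mu]_y `|(g y)%:E|)%E); rewrite fineK//.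
    apply: integrable_fin_num => //; exact: integrable_abse.
  apply: (@le_lt_trans _ _ (\int[mu]_x (`|(f x)%:E| * M%:E))%E).
    apply: ge0_le_integral => //.
    - by move=> x _; apply: integral_ge0.
    - apply: (@measurable_fun_fubini_tonelli_F _ _ _ _ R mu (abse \o h)) => //=.
      exact: measurableT_comp.
    - apply: emeasurable_funM => //; apply: measurableT_comp => //.
      exact/measurable_EFinP.
    - move=> x _; rewrite -fM -ge0_integralZl//; last 1 first.
      + by apply: measurableT_comp => //; exact/measurable_EFinP.
      apply: ge0_le_integral => //.
      + apply: measurableT_comp => //; apply: measurableT_comp => //.
      + apply: emeasurable_funM => //; apply: measurableT_comp => //.
        exact/measurable_EFinP.
  rewrite ge0_integralZr//; last 2 first.
  - by apply: measurableT_comp => //; exact/measurable_EFinP.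
  - rewrite -fM; exact: integral_ge0.
  by apply: lte_mul_pinfty => //; [exact: integral_ge0|
    apply: integrable_fin_num => //; exact: integrable_abse|exact: ltry].
Qed.

Lemma wedge_inner (f g : R -> R) x : integ setT f -> integ setT g ->
  (\int[mu]_y wedge f g (x, y))%E = (f x * \int[mu]_(y in `]-oo, x]) g y)%:E.
Proof.
move=> If Ig.
  rewrite /wedge /=; under eq_integral do rewrite EFinM.
  have gx : mu.-integrable `]-oo, x] (EFin \o g) by apply: integrableS Ig.
  rewrite EFinM /Rintegral fineK; last exact: integrable_fin_num.
  have e y : (g y * (y <= x)%R%:R)%:E = ((EFin \o g) \_ `]-oo, x]) y.
    rewrite patchE; case: ifPn => /=.
      by rewrite inE /= in_itv /= => ->; rewrite mulr1.
    by rewrite notin_setE /= in_itv /= => /negP/negbTE ->; rewrite mulr0.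
  under eq_integral do rewrite e.
  rewrite integralZl//; first by rewrite [in RHS]integral_mkcond.
  by apply: (integrable_mkcond _ _).1.
Qed.

Lemma integ_mul_primitive (f g : R -> R) : integ setT f -> integ setT g ->
  integ setT (fun x => f x * \int[mu]_(y in `]-oo, x]) g y).
Proof.
move=> If Ig; have := integrable_fubini_F (wedge_integrable If Ig).
by apply: eq_integrable => // x _ /=; rewrite /fubini_F wedge_inner.
Qed.

(** The plane is cut along the diagonal: Fubini on [y <= x] turns the first integral into one over
    the rays [[y, +oo[], whose complements up to a point are the rays of the second integral. This
    is integration by parts for primitives of merely integrable functions. *)
Lemma integ_fubini (f g : R -> R) : integ setT f -> integ setT g ->
  \int[mu]_x (f x * \int[mu]_(y in `]-oo, x]) g y) +
  \int[mu]_x (g x * \int[mu]_(y in `]-oo, x]) f y) =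
  (\int[mu]_x f x) * (\int[mu]_x g x).
Proof.
move=> If Ig; have Ih := wedge_integrable If Ig.
have E2 y : (\int[mu]_x wedge f g (x, y))%E =
    (g y * (\int[mu]_x f x - \int[mu]_(x in `]-oo, y]) f x))%:E.
  have fy : integ `]-oo, y] f by apply: integrableS If.
  have fy' : integ `[y, +oo[ f by apply: integrableS If.
  have fy2 : integ `]y, +oo[ f by apply: integrableS If.
  have -> : \int[mu]_x f x - \int[mu]_(x in `]-oo, y]) f x =
            \int[mu]_(x in `[y, +oo[) f x.
    rewrite -Rintegral_itv_obnd_cbnd//.
    have := @Rintegral_itvB _ f -oo%O +oo%O y.
    by rewrite set_itvE; apply.
  rewrite EFinM /Rintegral fineK; last exact: integrable_fin_num.
  rewrite /wedge /=; under eq_integral do rewrite mulrCA EFinM.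
  have e x : (f x * (y <= x)%R%:R)%:E = ((EFin \o f) \_ `[y, +oo[) x.
    rewrite patchE; case: ifPn => /=.
      by rewrite inE /= in_itv /= andbT => ->; rewrite mulr1.
    by rewrite notin_setE /= in_itv /= andbT => /negP/negbTE ->; rewrite mulr0.
  under eq_integral do rewrite e.
  rewrite integralZl//; first by rewrite [in RHS]integral_mkcond.
  by apply: (integrable_mkcond _ _).1.
have := Fubini Ih.
under eq_integral do rewrite wedge_inner//.
under [X in _ = X]eq_integral do rewrite E2.
move=> /(congr1 fine); rewrite -/(Rintegral mu setT _) -/(Rintegral mu setT _) => ->.
have Gf : integ setT (fun y => g y * \int[mu]_x f x).
  exact: (integrableZr measurableT (\int[mu]_x f x) Ig).
have Gx := integ_mul_primitive Ig If.
rewrite (_ : \int[mu]_x (g x * (_ - _)) =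
    \int[mu]_y (g y * \int[mu]_x f x - g y * \int[mu]_(x in `]-oo, y]) f x)).
  by rewrite RintegralB// RintegralZr//; ring.
by apply: eq_Rintegral => y _; ring.
Qed.

End integral_parts.

(** * Primitives of locally integrable functions and their product rule *)

Section primitives.
Variable R : realType.
Notation mu := (@lebesgue_measure R).
Notation measurable := (@measurable _ (measurableTypeR R)).
Implicit Types (f g x y : R -> R) (t : R).

Definition pint f t : R := \int[mu]_(s in `[0, t]) f s.

Definition locint f := forall t, integ `[0, t] f.

(** Absolute continuity with derivative [f], in integrated form because inputs are only measurable
    and trajectories need not be differentiable at every time. The clause on [locint] keeps the
    integral from taking a default value. *)
Definition prim x f := locint f /\ forall t, 0 <= t -> x t = x 0 + pint f t.

Lemma integD D f g : measurable D -> integ D f -> integ D g ->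
  integ D (fun t => f t + g t).
Proof.
move=> mD If Ig; apply: eq_integrable (integrableD mD If Ig) => // t _ /=.
Qed.

Lemma integZ D f k : measurable D -> integ D f -> integ D (fun t => k * f t).
Proof.
move=> mD If; apply: eq_integrable (integrableZl mD k If) => // t _ /=.
Qed.

Lemma integ_eq D f g : measurable D -> (forall t, D t -> f t = g t) ->
  integ D f -> integ D g.
Proof.
by move=> mD fg; apply: eq_integrable => // t /set_mem tD /=; rewrite fg.
Qed.

Lemma integN D f : measurable D -> integ D f -> integ D (fun t => - f t).
Proof.
by move=> mD /(integZ (-1) mD); apply: integ_eq => // t _; rewrite mulN1r.
Qed.

Lemma integB D f g : measurable D -> integ D f -> integ D g ->
  integ D (fun t => f t - g t).
Proof. by move=> mD If Ig; apply: integD => //; exact: integN. Qed.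

Lemma integ_abs D f : measurable D -> integ D f -> integ D (fun t => `|f t|).
Proof. by move=> mD If; exact: integrable_norm. Qed.

Lemma integ_sub (D E : set R) f : measurable D -> measurable E -> E `<=` D ->
  integ D f -> integ E f.
Proof. by move=> mD mE ED; exact: integrableS. Qed.

Lemma integ_patch D f : measurable D -> integ D f <-> integ setT (f \_ D).
Proof.
move=> mD; rewrite /integ; split.
  by move=> /(integrable_mkcond _ mD).1; rewrite -restrict_EFin.
by move=> H; apply: (integrable_mkcond _ mD).2; rewrite restrict_EFin.
Qed.

Lemma integ_meas D f : integ D f -> measurable_fun D f.
Proof. by case/integrableP => /measurable_EFinP. Qed.

Lemma integ0 (D : set R) : integ D (fun=> 0).
Proof. exact: integrable0. Qed.

Lemma locint_cst (c : R) : locint (fun=> c).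
Proof.
move=> t; apply: measurable_bounded_integrable => //.
  rewrite /= lebesgue_measure_itv /=; case: ifP => // _.
  by rewrite EFinN -EFinD ltry.
by exists `|c|; split => // r cr ? _; exact: ltW.
Qed.

Lemma pintD f g t : locint f -> locint g ->
  pint (fun s => f s + g s) t = pint f t + pint g t.
Proof. by move=> If Ig; rewrite /pint RintegralD//; [exact: If|exact: Ig]. Qed.

Lemma pintZ f k t : locint f -> pint (fun s => k * f s) t = k * pint f t.
Proof. by move=> If; rewrite /pint RintegralZl//; exact: If. Qed.

Lemma eq_pint f g t : (forall s, 0 <= s <= t -> f s = g s) -> pint f t = pint g t.
Proof.
by move=> fg; apply: eq_Rintegral => s; rewrite inE /= in_itv /=; exact: fg.
Qed.

Lemma pint0 f t : t <= 0 -> pint f t = 0.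
Proof.
rewrite le_eqVlt => /orP[/eqP->|t0]; first by rewrite /pint set_itv1 Rintegral_set1.
rewrite /pint set_itv_ge ?Rintegral_set0//.
by rewrite bnd_simp -ltNge.
Qed.

Lemma patch_in D f t : D t -> (f \_ D) t = f t.
Proof. by move=> Dt; rewrite patchE mem_set. Qed.

Lemma pint_patch f T s : 0 <= s <= T ->
  \int[mu]_(y in `]-oo, s]) (f \_ `[0, T]) y = pint f s.
Proof.
move=> /andP[s0 sT]; rewrite -Rintegral_mkcondr; congr (Rintegral _ _ _).
apply/seteqP; split => y /=; rewrite !in_itv /=.
  by move=> [ys /andP[-> _]].
by move=> /andP[y0 ys]; split => //; rewrite y0 (le_trans ys).
Qed.

Lemma locint_mul_pint f g : locint f -> locint g ->
  locint (fun s => f s * pint g s).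
Proof.
move=> If Ig t; apply/(integ_patch _ _).2 => //.
have If' : integ setT (f \_ `[0, t]) by apply/(integ_patch _ _).1.
have Ig' : integ setT (g \_ `[0, t]) by apply/(integ_patch _ _).1.
apply: integ_eq (integ_mul_primitive If' Ig') => // s _.
rewrite !patchE; case: ifPn => [|_]; last by rewrite mul0r.
by rewrite inE /= in_itv /= => st; rewrite pint_patch.
Qed.

Lemma pint_mul_pint f g t :
  \int[mu]_s ((f \_ `[0, t]) s * \int[mu]_(r in `]-oo, s]) (g \_ `[0, t]) r) =
  pint (fun s => f s * pint g s) t.
Proof.
rewrite [RHS]Rintegral_mkcond; apply: eq_Rintegral => s _; rewrite !patchE.
case: ifPn => [|_]; last exact: mul0r.
by rewrite inE /= in_itv /= => st; rewrite pint_patch.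
Qed.

Lemma pint_parts f g t : locint f -> locint g ->
  pint (fun s => f s * pint g s) t + pint (fun s => g s * pint f s) t =
  pint f t * pint g t.
Proof.
move=> If Ig.
have If' : integ setT (f \_ `[0, t]) by apply/(integ_patch _ _).1.
have Ig' : integ setT (g \_ `[0, t]) by apply/(integ_patch _ _).1.
by have := integ_fubini If' Ig'; rewrite -!Rintegral_mkcond !pint_mul_pint.
Qed.

Lemma locintD f g : locint f -> locint g -> locint (fun t => f t + g t).
Proof. by move=> If Ig t; exact: integD. Qed.

Lemma locintZ f k : locint f -> locint (fun t => k * f t).
Proof. by move=> If t; exact: integZ. Qed.

Lemma locint_eq f g : (forall t, 0 <= t -> f t = g t) -> locint f -> locint g.
Proof.
move=> fg If t; apply: integ_eq (If t) => // s /=.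
by rewrite in_itv /= => /andP[s0 _]; exact: fg.
Qed.

Lemma locint_pint f : locint f -> locint (pint f).
Proof.
move=> If; have := locint_mul_pint (locint_cst 1) If.
by apply: locint_eq => t _; rewrite mul1r.
Qed.

Lemma prim_locint x f : prim x f -> locint x.
Proof.
case=> If xE; apply: (@locint_eq (fun t => x 0 + pint f t)).
  by move=> t t0; rewrite -xE.
exact: locintD (locint_cst _) (locint_pint If).
Qed.

Lemma primD x f y g : prim x f -> prim y g ->
  prim (fun t => x t + y t) (fun t => f t + g t).
Proof.
move=> [If xE] [Ig yE]; split; first exact: locintD.
by move=> t t0; rewrite xE// yE// pintD//; ring.
Qed.

Lemma primZ x f k : prim x f -> prim (fun t => k * x t) (fun t => k * f t).
Proof.
move=> [If xE]; split; first exact: locintZ.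
by move=> t t0; rewrite xE// pintZ//; ring.
Qed.

Lemma prim_cst (c : R) : prim (fun=> c) (fun=> 0).
Proof.
split; first exact: locint_cst.
by move=> t _; rewrite /pint Rintegral_cst ?mul0r ?addr0.
Qed.

Lemma prim_eq x f y g : (forall t, 0 <= t -> x t = y t) ->
  (forall t, 0 <= t -> f t = g t) -> prim x f -> prim y g.
Proof.
move=> xy fg [If xE]; split; first exact: locint_eq fg If.
move=> t t0; rewrite -xy// -xy// xE//; congr (_ + _).
by apply: eq_pint => s /andP[s0 _]; exact: fg.
Qed.

Lemma prim_sum (I : Type) (r : seq I) (x f : I -> R -> R) :
  (forall i, prim (x i) (f i)) ->
  prim (fun t => \sum_(i <- r) x i t) (fun t => \sum_(i <- r) f i t).
Proof.
move=> H; elim: r => [|i r IH].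
  by apply: prim_eq (prim_cst 0) => t _; rewrite big_nil.
by apply: prim_eq (primD (H i) IH) => t _; rewrite big_cons.
Qed.

Lemma locint_mul_prim x f y g : prim x f -> locint g -> locint (fun t => g t * x t).
Proof.
move=> [If xE] Ig; apply: (@locint_eq (fun t => x 0 * g t + g t * pint f t)).
  by move=> t t0; rewrite [x t]xE//; ring.
exact: locintD (locintZ _ Ig) (locint_mul_pint Ig If).
Qed.

Lemma primM x f y g : prim x f -> prim y g ->
  prim (fun t => x t * y t) (fun t => f t * y t + x t * g t).
Proof.
move=> [If xE] [Ig yE]; have H1 := locint_mul_pint If Ig.
have H2 := locint_mul_pint Ig If.
have e t : 0 <= t -> (y 0 * f t + f t * pint g t) + (x 0 * g t + g t * pint f t) =
    f t * y t + x t * g t.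
  by move=> t0; rewrite [x t]xE// [y t]yE//; ring.
have L : locint (fun t => f t * y t + x t * g t).
  by apply: locint_eq e _; do 2!apply: locintD => //; exact: locintZ.
split=> // t t0; rewrite xE// yE//.
rewrite -(@eq_pint _ _ t (fun s (s0 : 0 <= s <= t) => e s (proj1 (andP s0)))).
rewrite pintD; [|exact: locintD (locintZ _ If) H1|exact: locintD (locintZ _ Ig) H2].
rewrite !pintD ?pintZ//; [|exact: locintZ|exact: locintZ].
by have := pint_parts t If Ig; lra.
Qed.

Lemma prim_C1 x f : (forall t : R, is_derive t (1 : R) x (f t)) -> continuous f ->
  prim x f.
Proof.
move=> dx cf.
have cw t : {within `[0, t], continuous f} by exact: continuous_subspaceT.
split.
  by move=> t; apply: continuous_compact_integrable => //; exact: segment_compact.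
move=> t; rewrite le_eqVlt => /orP[/eqP<-|t0]; first by rewrite pint0// addr0.
have dx' s : derivable x s 1 by case: (dx s).
have cx : continuous x.
  by move=> s; apply: differentiable_continuous; apply/derivable1_diffP.
rewrite /pint /Rintegral (@continuous_FTC2 _ f x 0 t)//=; first by ring.
- by split; [|exact/cvg_at_right_filter/cx|exact/cvg_at_left_filter/cx].
- by move=> s _; rewrite derive1E; case: (dx s).
Qed.

End primitives.

(** * Integrals over the half-line as limits *)

Section half_line.
Variable R : realType.
Notation mu := (@lebesgue_measure R).
Notation measurable := (@measurable _ (measurableTypeR R)).
Implicit Types (f g h : R -> R) (t : R).

Definition iint f : R := \int[mu]_(s in Rplus) f s.

Lemma measurable_Rplus : measurable (Rplus : set R).
Proof. exact: measurable_itv. Qed.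
Local Hint Resolve measurable_Rplus : core.

Lemma itv_sub_Rplus t : `[0, t]%classic `<=` (Rplus : set R).
Proof. by move=> s /=; rewrite /Rplus /= !in_itv /= andbT => /andP[]. Qed.

Lemma RplusP t : Rplus t <-> 0 <= t.
Proof. by rewrite /Rplus /= in_itv /= andbT. Qed.

Lemma integ_locint f : integ Rplus f -> locint f.
Proof. by move=> If t; apply: integ_sub If => //; exact: itv_sub_Rplus. Qed.

Lemma locint_meas f : locint f -> measurable_fun Rplus f.
Proof.
move=> If; have -> : (Rplus : set R) = \bigcup_n `[0, n%:R]%classic.
  apply/seteqP; split => [t /RplusP t0|t [n _]]; last exact: itv_sub_Rplus.
  exists (Num.trunc t).+1 => //=; rewrite in_itv /= t0 /=.
  by apply/ltW/truncnS_gt.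
by apply/measurable_fun_bigcup => // n; exact: integ_meas (If _).
Qed.

Lemma locint_patch f t : locint f -> 0 <= t ->
  \int[mu]_(s in `[0, t]) (f \_ Rplus) s = pint f t.
Proof.
move=> If t0; apply: eq_pint => s /andP[s0 _].
by rewrite patch_in//; exact/RplusP.
Qed.

Lemma integ_fineK D f : measurable D -> integ D f ->
  (\int[mu]_(s in D) (f s)%:E = (\int[mu]_(s in D) f s)%:E)%E.
Proof. by move=> mD If; rewrite /Rintegral fineK//; exact: integrable_fin_num. Qed.

Lemma patch_meas f : measurable_fun Rplus f -> measurable_fun setT (f \_ Rplus).
Proof. by move=> mf; apply/(measurable_restrictT _ _).1. Qed.

Lemma patch_ge0 f : (forall t, 0 <= t -> 0 <= f t) -> forall t, 0 <= (f \_ Rplus) t.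
Proof.
move=> f0 t; rewrite patchE; case: ifPn => // /set_mem /RplusP; exact: f0.
Qed.

Lemma integral_Rplus_patch f :
  (\int[mu]_(s in Rplus) (f s)%:E = \int[mu]_(s in Rplus) ((f \_ Rplus) s)%:E)%E.
Proof. by apply: eq_integral => s /set_mem sR; rewrite patch_in. Qed.

Lemma pint_fineK f t : locint f -> 0 <= t ->
  (\int[mu]_(s in `[0%R, t]) ((f \_ Rplus) s)%:E = (pint f t)%:E)%E.
Proof.
move=> If t0; rewrite integ_fineK ?locint_patch//.
apply: integ_eq (If t) => // s /=; rewrite in_itv /= => /andP[s0 _].
by rewrite patch_in//; exact/RplusP.
Qed.

Lemma integ_Rplus_bounded f C : locint f -> (forall t, 0 <= t -> 0 <= f t) ->
  (forall t, 0 <= t -> pint f t <= C) -> integ Rplus f.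
Proof.
move=> If f0 fC; have mf := locint_meas If.
apply/integrableP; split; first exact/measurable_EFinP.
apply: (@le_lt_trans _ _ C%:E); last exact: ltry.
rewrite (_ : (\int[mu]_(x in Rplus) _)%E = (\int[mu]_(s in Rplus) (f s)%:E)%E); last first.
  apply: eq_integral => s /set_mem/RplusP s0 /=.
  by rewrite ger0_norm ?f0.
rewrite integral_Rplus_patch ge0_integral_ereal_sup; last 2 first.
- exact: patch_ge0.
- exact: patch_meas.
apply: ge_ereal_sup => _ [n _ <-].
by rewrite pint_fineK// lee_fin; exact: fC.
Qed.

Lemma pint_le_iint f t : integ Rplus f -> (forall t, 0 <= t -> 0 <= f t) ->
  0 <= t -> pint f t <= iint f.
Proof.
move=> If f0 t0; have Lf := integ_locint If.
rewrite -lee_fin -(integ_fineK _ (Lf t))//.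
rewrite /iint -integ_fineK//; apply: ge0_subset_integral => //.
- by case/integrableP: If.
- by move=> s /RplusP; rewrite lee_fin; exact: f0.
- exact: itv_sub_Rplus.
Qed.

Lemma le_pint f s t : locint f -> (forall t, 0 <= t -> 0 <= f t) ->
  0 <= s <= t -> pint f s <= pint f t.
Proof.
move=> Lf f0 /andP[s0 st].
rewrite -lee_fin -(integ_fineK _ (Lf s))// -(integ_fineK _ (Lf t))//.
apply: ge0_subset_integral => //.
- by case/integrableP: (Lf t).
- by move=> r /=; rewrite in_itv lee_fin /= => /andP[? _]; exact: f0.
- move=> r /=; rewrite !in_itv /= => /andP[-> rs] /=; exact: le_trans st.
Qed.

Let approx f := forall e, 0 < e -> exists n : nat,
  forall t, n%:R <= t -> `|pint f t - iint f| <= e.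

Let approx_ge0 f : integ Rplus f -> (forall t, 0 <= t -> 0 <= f t) -> approx f.
Proof.
move=> If f0 e e0; have Lf := integ_locint If.
have := @ge0_cvgn_integral R mu _ (patch_ge0 f0) (patch_meas (integ_meas If)).
rewrite -integral_Rplus_patch integ_fineK// -/(iint f).
rewrite (_ : (fun n : nat => _) = (fun n => (pint f n%:R)%:E)); last first.
  by apply/funext => n; rewrite pint_fineK.
move=> /fine_cvgP[_] /cvgrPdist_le /(_ e e0)[n _ /(_ n (leqnn n)) /= H].
exists n => t nt; rewrite distrC ger0_norm; last first.
  by rewrite subr_ge0 pint_le_iint// (le_trans _ nt).
have := le_pint Lf f0 (_ : 0 <= n%:R <= t); rewrite ler0n nt => /(_ isT).
by have := ler_norm (iint f - pint f n%:R); lra.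
Qed.

(** Monotone convergence handles nonnegative functions, and [f] is the difference of [|f|] and
    [|f| - f], both nonnegative and integrable. *)
Lemma pint_approx f : integ Rplus f -> forall e, 0 < e -> exists n : nat,
  forall t, n%:R <= t -> `|pint f t - iint f| <= e.
Proof.
move=> If e e0; have e2 : 0 < e / 2 by lra.
have Ia : integ Rplus (fun t => `|f t|) by exact: integ_abs.
have Ib : integ Rplus (fun t => `|f t| - f t) by exact: integB.
have [n Hn] := approx_ge0 Ia (fun t _ => normr_ge0 _) e2.
have b0 t : 0 <= t -> 0 <= `|f t| - f t by move=> _; rewrite subr_ge0 ler_norm.
have [m Hm] := approx_ge0 Ib b0 e2.
exists (maxn n m) => t; rewrite natr_max ge_max => /andP[nt mt].
have E1 : iint (fun t => `|f t| - f t) = iint (fun t => `|f t|) - iint f.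
  by rewrite /iint RintegralB.
have E2 : pint (fun t => `|f t| - f t) t = pint (fun t => `|f t|) t - pint f t.
  by rewrite /pint RintegralB//; apply: integ_locint.
have := Hn _ nt; have := Hm _ mt; rewrite E1 E2 !ler_norml; lra.
Qed.

(* The limit of [h] at infinity exists because its derivative is integrable,
   and it must vanish because [h] itself is integrable. *)
Lemma prim_iint h k : prim h k -> integ Rplus h -> integ Rplus k -> iint k = - h 0.
Proof.
move=> [_ hE] Ih Ik; pose L := h 0 + iint k.
suff L0 : L = 0 by move: L0; rewrite /L; lra.
apply/eqP/contraT; rewrite -normr_gt0 => L0.
have [n Hn] := @pint_approx k Ik (`|L| / 2) ltac:(lra).
have hL t : n%:R <= t -> `|L| / 2 <= `|h t|.
  move=> nt; have := Hn _ nt; rewrite hE ?(le_trans _ nt)//.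
  have -> : pint k t - iint k = h 0 + pint k t - L by rewrite /L; ring.
  by have := lerB_dist L (L - (h 0 + pint k t)); rewrite subKr distrC; lra.
have Ia : integ Rplus (fun t => `|h t|) by exact: integ_abs.
have La := integ_locint Ia.
set C := iint (fun t => `|h t|).
(* On [[0, n + m]] the function [|h|] dominates the step function equal to 0 before [n] and to
   [|L| / 2] afterwards. The integral of the latter grows with [m], against the finite integral of
   [|h|]. *)
have B m : (m%:R) * (`|L| / 2) <= C.
  have nm : 0 <= (n%:R : R) <= (n + m)%:R by rewrite ler0n ler_nat leq_addr.
  apply: le_trans (pint_le_iint Ia _ (_ : 0 <= (n + m)%:R)) => //.
  have Lh : locint (fun t : R => if t < n%:R then 0 else `|L| / 2).
    move=> t; apply: measurable_bounded_integrable => //.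
    - rewrite /= lebesgue_measure_itv /=; case: ifP => // _.
      by rewrite EFinN -EFinD ltry.
    - by apply: measurable_funTS; apply: measurable_fun_ifT => //; exact: measurable_fun_ltr.
    - exists `|L|; split => // r Lr t' _ /=; case: ifP => _; rewrite ?normr0.
        by apply/ltW/(le_lt_trans _ Lr).
      by rewrite ger0_norm; lra.
  have -> : m%:R * (`|L| / 2) = pint (fun t : R => if t < n%:R then 0 else `|L| / 2) (n + m)%:R.
    rewrite -[RHS](subrK (pint (fun t : R => if t < n%:R then 0 else `|L| / 2) n%:R)).
    rewrite {1}/pint (@Rintegral_itvB _ _ (BLeft 0) (BRight _) n%:R) ?bnd_simp ?ler_nat ?leq_addr//;
      last exact: Lh.
    rewrite (@eq_Rintegral _ _ _ _ _ (fun=> `|L| / 2)); last first.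
      by move=> r; rewrite inE /= in_itv /= => /andP[nr _]; rewrite ltNge ltW.
    rewrite Rintegral_cst// /= lebesgue_measure_itv /= lte_fin ltr_nat.
    have -> : pint (fun t : R => if t < n%:R then 0 else `|L| / 2) n%:R = 0.
      rewrite /pint -Rintegral_itv_bndo_bndc; last first.
        apply: integ_sub (Lh n%:R) => // r /=; rewrite !in_itv /= => /andP[-> /ltW]; exact.
      rewrite (@eq_Rintegral _ _ _ _ _ (fun=> 0)) ?Rintegral_cst ?mul0r//.
      by move=> r; rewrite inE /= in_itv /= => /andP[_ ->].
    rewrite addr0 mulrC; congr (_ * _); case: ltnP => /=; rewrite ?natrD; first by lra.
    by rewrite -[X in (_ <= X)%N]addn0 leq_add2l leqn0 => /eqP->.
  apply: le_Rintegral => //; [exact: Lh|exact: La|].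
  by move=> r _; case: ltP => // /hL.
have := B (Num.trunc (C / (`|L| / 2))).+1.
by rewrite -ler_pdivlMr ?divr_gt0// leNgt truncnS_gt.
Qed.

End half_line.
#[global] Hint Resolve measurable_Rplus : core.

(** * Linear differential equations *)

Lemma cvg_lincomb (R : realType) (I : Type) (r : seq I) (c : I -> R)
    (u : I -> nat -> R) (l : I -> R) : (forall i, u i @ \oo --> l i) ->
  (fun m => \sum_(i <- r) c i * u i m) @ \oo --> \sum_(i <- r) c i * l i.
Proof.
move=> ul; elim: r => [|i r IH].
  rewrite big_nil (_ : (fun m : nat => _) = (fun=> 0)); first exact: cvg_cst.
  by apply/funext => m; rewrite big_nil.
rewrite big_cons (_ : (fun m => _) =
    (fun m => c i * u i m + \sum_(j <- r) c j * u j m)).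
  by apply: cvgD => //; apply: cvgM; [exact: cvg_cst|exact: ul].
by apply/funext => m; rewrite big_cons.
Qed.

Section matrix_exponential.
Variables (R : realType) (n : nat) (A : 'M[R]_n).
Implicit Types (B : 'M[R]_n) (t : R).

Definition mx_l1 B : R := \sum_i \sum_j `|B i j|.

Lemma mx_l1_ge0 B : 0 <= mx_l1 B.
Proof. by do 2!apply: sumr_ge0 => ? _. Qed.

Lemma mx_l1_entry B i j : `|B i j| <= mx_l1 B.
Proof.
rewrite /mx_l1 (bigD1 i)//= (bigD1 j)//= -addrA lerDl.
by apply: addr_ge0; do ?apply: sumr_ge0 => ? _ //; apply: sumr_ge0.
Qed.

Lemma mx_l1M B D : mx_l1 (B *m D) <= mx_l1 B * mx_l1 D.
Proof.
rewrite /mx_l1 mulr_suml; apply: ler_sum => i _.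
apply: (@le_trans _ _ (\sum_j \sum_k `|B i k| * `|D k j|)).
  apply: ler_sum => j _; rewrite mxE; apply: le_trans (ler_norm_sum _ _ _) _.
  by apply: ler_sum => k _; rewrite normrM.
rewrite exchange_big /= mulr_suml; apply: ler_sum => k _.
rewrite -mulr_sumr ler_wpM2l// [leRHS](bigD1 k)//= lerDl.
by apply: sumr_ge0 => ? _; apply: sumr_ge0.
Qed.

(** This is [A ^ k *m B]. The recursion acts on [B] so that differentiating the exponential series,
    which shifts its coefficients, amounts to replacing [B] by [A *m B]. *)
Fixpoint mx_pow B k : 'M[R]_n := if k is k'.+1 then mx_pow (A *m B) k' else B.

Lemma mx_pow_bound B k : mx_l1 (mx_pow B k) <= mx_l1 B * mx_l1 A ^+ k.
Proof.
elim: k B => [|k IH] B /=; first by rewrite mulr1.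
apply: le_trans (IH _) _; rewrite exprS mulrA [mx_l1 B * _]mulrC.
by rewrite ler_wpM2r ?exprn_ge0 ?mx_l1_ge0// mx_l1M.
Qed.

Lemma mx_powMl D k B : D *m A = A *m D -> mx_pow (D *m B) k = D *m mx_pow B k.
Proof. by move=> DA; elim: k B => //= k IH B; rewrite mulmxA -DA -mulmxA IH. Qed.

Definition exp_coef B i j (k : nat) : R := (k`!%:R)^-1 * mx_pow B k i j.

Lemma exp_coef_cvg B i j t : cvgn (pseries (exp_coef B i j) t).
Proof.
apply: normed_cvg => /=.
apply: (@series_le_cvg _ _ (mx_l1 B \*: exp_coeff (mx_l1 A * `|t|))) => [k|k|k|].
- exact: normr_ge0.
- by rewrite /= mulr_ge0 ?mx_l1_ge0// exp_coeff_ge0// mulr_ge0// mx_l1_ge0.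
- rewrite /= /exp_coef !normrM normfV normr_nat normrX exp_coeffE /= /GRing.scale /=.
  rewrite exprMn -!mulrA [mx_l1 B * _]mulrCA ler_wpM2l ?invr_ge0//.
  rewrite mulrA ler_wpM2r ?exprn_ge0//.
  by apply: le_trans (mx_l1_entry _ _ _) _; exact: mx_pow_bound.
- by apply: is_cvg_seriesZ; exact: is_cvg_series_exp_coeff.
Qed.

Lemma exp_coef_diffs B i j :
  pseries_diffs (exp_coef B i j) = exp_coef (A *m B) i j.
Proof.
apply/funext => k; rewrite /pseries_diffs /exp_coef factS natrM invfM.
by rewrite !mulrA divff ?mul1r ?pnatr_eq0.
Qed.

Definition mx_exp B t i j : R := limn (pseries (exp_coef B i j) t).

Lemma mx_exp_derive B i j t :
  is_derive t (1 : R) (fun s => mx_exp B s i j) (mx_exp (A *m B) t i j).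
Proof.
rewrite /mx_exp -exp_coef_diffs; apply: (@pseries_snd_diffs _ _ (`|t| + 1)).
- exact: exp_coef_cvg.
- by rewrite exp_coef_diffs; exact: exp_coef_cvg.
- by rewrite !exp_coef_diffs; exact: exp_coef_cvg.
- by rewrite ltr_normr ltrDl ltr01.
Qed.

Lemma mx_exp0 B i j : mx_exp B 0 i j = B i j.
Proof.
apply: lim_near_cst => //; near=> m; rewrite -[m]prednK; last by near: m; exists 1%N.
rewrite /pseries /series /= big_nat_recl//= big1 ?addr0; last first.
  by move=> k _; rewrite expr0n mulr0.
by rewrite /exp_coef /= invr1 mul1r mulr1.
Unshelve. all: by end_near. Qed.

Lemma mx_expMl B t i j : mx_exp (A *m B) t i j = \sum_l A i l * mx_exp B t l j.
Proof.
rewrite /mx_exp; apply: cvg_lim => //.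
rewrite (_ : pseries (exp_coef (A *m B) i j) t =
  (fun m => \sum_l A i l * pseries (exp_coef B l j) t m)).
  by apply: cvg_lincomb => l; exact: exp_coef_cvg.
apply/funext => m; rewrite /pseries /series /=.
under [RHS]eq_bigr do rewrite mulr_sumr.
rewrite exchange_big /=; apply: eq_bigr => k _.
rewrite /exp_coef mx_powMl// mxE mulr_sumr mulr_suml; apply: eq_bigr => l _.
by ring.
Qed.

Lemma fundamental_matrix : exists X : R -> 'M[R]_n, X 0 = 1%:M /\
  forall i j, prim (fun t => X t i j) (fun t => (A *m X t) i j).
Proof.
exists (fun t => \matrix_(i, j) mx_exp 1%:M t i j); split.
  by apply/matrixP => i j; rewrite mxE mx_exp0.
move=> i j.
have E t : (A *m \matrix_(i, j) mx_exp 1%:M t i j) i j = mx_exp (A *m 1%:M) t i j.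
  by rewrite mx_expMl mxE; apply: eq_bigr => l _; rewrite mxE.
apply: (@prim_eq _ (fun t => mx_exp 1%:M t i j) (fun t => mx_exp (A *m 1%:M) t i j)).
- by move=> t _; rewrite mxE.
- by move=> t _; rewrite E.
apply: prim_C1 => [t|t]; first exact: mx_exp_derive.
apply: differentiable_continuous; apply/derivable1_diffP.
by case: (mx_exp_derive (A *m 1%:M) i j t).
Qed.

End matrix_exponential.

(** * Variation of constants and the Lyapunov energy estimate *)

Section linear_ode.
Variable R : realType.
Implicit Types (t : R).

Definition vprim m (x f : R -> 'cV[R]_m) :=
  forall i, prim (fun t => x t i 0) (fun t => f t i 0).

Lemma prim_const (x : R -> R) t : prim x (fun=> 0) -> 0 <= t -> x t = x 0.
Proof. by move=> [_ xE] /xE ->; rewrite /pint Rintegral_cst ?mul0r ?addr0. Qed.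

Lemma prim_lin (I : finType) (c : I -> R) (x f : I -> R -> R) :
  (forall i, prim (x i) (f i)) ->
  prim (fun t => \sum_i c i * x i t) (fun t => \sum_i c i * f i t).
Proof. by move=> H; apply: prim_sum => i; exact: primZ. Qed.

Lemma locint_sum (I : Type) (r : seq I) (f : I -> R -> R) :
  (forall i, locint (f i)) -> locint (fun t => \sum_(i <- r) f i t).
Proof.
move=> H; elim: r => [|i r IH].
  by apply: locint_eq (locint_cst 0) => t _; rewrite big_nil.
by apply: locint_eq (locintD (H i) IH) => t _; rewrite big_cons.
Qed.

Section solution.
Variables (n : nat) (A : 'M[R]_n).

(** [Y] solves the adjoint equation: it is the transpose of the fundamental matrix of [- A^T]. Then
    [Y X] has derivative zero and stays equal to 1, which provides the inverse of [X] needed for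
    both existence and uniqueness. *)
Lemma fundamental_pair : exists X Y : R -> 'M[R]_n,
  [/\ X 0 = 1%:M /\ Y 0 = 1%:M,
      forall i j, prim (fun t => X t i j) (fun t => (A *m X t) i j),
      forall i j, prim (fun t => Y t i j) (fun t => - (Y t *m A) i j) &
      forall t, 0 <= t -> X t *m Y t = 1%:M].
Proof.
have [X [X0 dX]] := fundamental_matrix A.
have [Z [Z0 dZ]] := fundamental_matrix (- A^T).
pose Y t := (Z t)^T.
have dY i j : prim (fun t => Y t i j) (fun t => - (Y t *m A) i j).
  apply: prim_eq (dZ j i) => t _; first by rewrite /Y mxE.
  by rewrite mulNmx mxE /Y -[in RHS](trmxK A) -trmx_mul [in RHS]mxE.
exists X, Y; split=> //; first by rewrite /Y Z0 trmx1.
move=> t t0; apply: mulmx1C; apply/matrixP => i j.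
have d : prim (fun t => \sum_k Y t i k * X t k j) (fun=> 0).
  apply: prim_eq (prim_sum _ (fun k => primM (dY i k) (dX k j))) => // s _.
  under eq_bigr do rewrite mulNr; rewrite big_split /= sumrN.
  apply/eqP; rewrite addrC subr_eq0; apply/eqP.
  by have /matrixP/(_ i j) := mulmxA (Y s) A (X s); rewrite !mxE.
have := prim_const d t0; rewrite X0 /Y Z0 !mxE => ->.
by under eq_bigr do rewrite trmx1; have /matrixP/(_ i j) := mulmx1 (1%:M : 'M[R]_n); rewrite !mxE.
Qed.

(** Variation of constants: [x = X y] with [y' = Y F], where [Y F] is locally integrable because the
    entries of [Y] are primitives. *)
Lemma ode_exists (b : 'cV[R]_n) (F : R -> 'cV[R]_n) :
  (forall i, locint (fun t => F t i 0)) ->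
  exists2 x : R -> 'cV[R]_n, x 0 = b & vprim x (fun t => A *m x t + F t).
Proof.
move=> LF; have [X [Y [[X0 Y0] dX dY XY]]] := fundamental_pair.
have LYF i : locint (fun t => (Y t *m F t) i 0).
  apply: (@locint_eq _ (fun t => \sum_k F t k 0 * Y t i k)).
    by move=> t _; rewrite mxE; apply: eq_bigr => k _; rewrite mulrC.
  by apply: locint_sum => k; apply: locint_mul_prim (dY i k) (LF k).
pose y t : 'cV[R]_n := b + \col_i pint (fun s => (Y s *m F s) i 0) t.
have dy i : prim (fun t => y t i 0) (fun t => (Y t *m F t) i 0).
  split=> // t t0; rewrite !mxE [pint _ 0]pint0// addr0; congr (_ + _).
exists (fun t => X t *m y t).
  rewrite X0 mul1mx; apply/colP => i; rewrite !mxE pint0 ?addr0//.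
move=> i; apply: prim_eq (prim_sum (index_enum 'I_n) (fun k => primM (dX i k) (dy k))) => t t0.
  by rewrite mxE.
rewrite big_split /= mxE; congr (_ + _).
  by rewrite mulmxA [RHS]mxE.
by rewrite -[in RHS](mul1mx (F t)) -(XY t t0) -mulmxA [RHS]mxE.
Qed.

Lemma vprimB m (x f y g : R -> 'cV[R]_m) : vprim x f -> vprim y g ->
  vprim (fun t => x t - y t) (fun t => f t - g t).
Proof.
move=> dx dy i; apply: prim_eq (primD (dx i) (primZ (-1) (dy i))) => t _;
  by rewrite !mxE mulN1r.
Qed.

Lemma ode_unique (x y F : R -> 'cV[R]_n) : x 0 = y 0 ->
  vprim x (fun t => A *m x t + F t) -> vprim y (fun t => A *m y t + F t) ->
  forall t, 0 <= t -> x t = y t.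
Proof.
move=> xy dx dy t t0; apply/eqP; rewrite -subr_eq0; apply/eqP.
pose d t := x t - y t; rewrite -/(d t).
have dd i : prim (fun t => d t i 0) (fun t => (A *m d t) i 0).
  apply: prim_eq (vprimB dx dy i) => s _ //.
  by rewrite opprD addrACA subrr addr0 -mulmxBr.
have [X [Y [_ _ dY XY]]] := fundamental_pair.
suff Yd0 : Y t *m d t = 0 by rewrite -[d t]mul1mx -(XY t t0) -mulmxA Yd0 mulmx0.
apply/colP => i.
have e : prim (fun t => \sum_k Y t i k * d t k 0) (fun=> 0).
  apply: prim_eq (prim_sum _ (fun k => primM (dY i k) (dd k))) => // s _.
  under eq_bigr do rewrite mulNr; rewrite big_split /= sumrN.
  apply/eqP; rewrite addrC subr_eq0; apply/eqP.
  by have /matrixP/(_ i 0) := mulmxA (Y s) A (d s); rewrite !mxE.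
have := prim_const e t0; rewrite !mxE => ->.
by rewrite big1// => k _; rewrite /d xy subrr mxE mulr0.
Qed.

Variable P : 'M[R]_n.
Hypothesis P_sym : P^T = P.
Hypothesis P_ge0 : forall x : 'cV[R]_n, 0 <= (x^T *m P *m x) 0 0.
Hypothesis P_lyap : forall x : 'cV[R]_n,
  2 * (x^T *m P *m (A *m x)) 0 0 <= - sqnorm x.

Lemma sqnorm_entry m (x : 'cV[R]_m) i : x i 0 ^+ 2 <= sqnorm x.
Proof. by rewrite /sqnorm (bigD1 i)//= lerDl sumr_ge0// => j _; exact: sqr_ge0. Qed.

Lemma sqnorm_ge0 m (x : 'cV[R]_m) : 0 <= sqnorm x.
Proof. by apply: sumr_ge0 => i _; exact: sqr_ge0. Qed.

Lemma form_entries (x y : 'cV[R]_n) :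
  (x^T *m P *m y) 0 0 = \sum_i \sum_j P i j * (x i 0 * y j 0).
Proof.
rewrite exchange_big mxE; apply: eq_bigr => j _.
rewrite mxE mulr_suml; apply: eq_bigr => i _; rewrite !mxE; ring.
Qed.

Lemma form_bound (x y : 'cV[R]_n) (e : R) : 0 < e ->
  2 * (x^T *m P *m y) 0 0 <= mx_l1 P * (e * sqnorm x + e^-1 * sqnorm y).
Proof.
move=> e0; rewrite form_entries mulr_sumr /mx_l1 mulr_suml; apply: ler_sum => i _.
rewrite mulr_sumr mulr_suml; apply: ler_sum => j _.
apply: (@le_trans _ _ (`|P i j| * (e * x i 0 ^+ 2 + e^-1 * y j 0 ^+ 2))); last first.
  by rewrite ler_wpM2l//; apply: lerD; rewrite ler_wpM2l ?sqnorm_entry ?invr_ge0 ?ltW.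
apply: le_trans (ler_norm _) _; rewrite !normrM (ger0_norm (_ : 0 <= 2))//.
rewrite mulrCA ler_wpM2l//.
rewrite -(real_normK (num_real (x i 0))) -(real_normK (num_real (y j 0))).
move: `|x i 0| `|y j 0| => a b.
have : 0 <= e * (a - e^-1 * b) ^+ 2 by rewrite mulr_ge0 ?sqr_ge0// ltW.
have -> : e * (a - e^-1 * b) ^+ 2 = e * a ^+ 2 + e^-1 * b ^+ 2 - 2 * (a * b).
  by field; rewrite gt_eqF.
by rewrite subr_ge0.
Qed.

(** The derivative of [V = x^T P x] is at most [- |x|^2 + 2 x^T P F]. Half of the dissipation
    absorbs the cross term, and [V T >= 0] discards the final value. *)
Lemma ode_energy : exists C : R, forall (x F : R -> 'cV[R]_n),
  (forall i, locint (fun t => F t i 0)) -> locint (fun t => sqnorm (F t)) ->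
  vprim x (fun t => A *m x t + F t) ->
  locint (fun t => sqnorm (x t)) /\ forall T, 0 <= T ->
    pint (fun t => sqnorm (x t)) T <=
      2 * ((x 0)^T *m P *m x 0) 0 0 + C * pint (fun t => sqnorm (F t)) T.
Proof.
pose p := mx_l1 P; have p0 : 0 <= p by exact: mx_l1_ge0.
(* The weight that makes [mx_l1 P * e <= 1 / 2], also when [P] vanishes. *)
pose e := (2 * (p + 1))^-1.
have e0 : 0 < e by rewrite invr_gt0; lra.
have pe : p * e <= 2^-1.
  by rewrite /e invfM mulrCA ler_piMr ?invr_ge0// ler_pdivrMr; lra.
exists (2 * p * e^-1) => x F LF LF2 dx.
have Lx : locint (fun t => sqnorm (x t)).
  by apply: locint_sum => i; exact: prim_locint (primM (dx i) (dx i)).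
split=> // T T0.
pose f t := A *m x t + F t.
pose V t := (x t)^T *m P *m x t.
have dV : prim (fun t => V t 0 0) (fun t => 2 * ((x t)^T *m P *m f t) 0 0).
  apply: prim_eq (prim_sum (index_enum 'I_n) (fun i => prim_lin (fun j => P i j)
    (fun j => primM (dx i) (dx j)))) => t _; first by rewrite -form_entries.
  have E : ((f t)^T *m P *m x t) 0 0 = ((x t)^T *m P *m f t) 0 0.
    have -> : (x t)^T *m P *m f t = ((f t)^T *m P *m x t)^T.
      by rewrite !trmx_mul trmxK P_sym mulmxA.
    by rewrite [RHS]mxE.
  rewrite mulr2n mulrDl !mul1r -[X in _ = X + _]E !form_entries -big_split /=.
  apply: eq_bigr => i _; rewrite -big_split /=; apply: eq_bigr => j _.
  by rewrite mulrDr.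
have : pint (fun t => 2 * ((x t)^T *m P *m f t) 0 0) T <=
       pint (fun t => - 2^-1 * sqnorm (x t) + p * e^-1 * sqnorm (F t)) T.
  apply: le_Rintegral => //; first by case: dV => L _; exact: L.
    exact: (locintD (locintZ _ Lx) (locintZ _ LF2)).
  move=> t _; rewrite /f mulmxDr [in leLHS]mxE mulrDr.
  have := P_lyap (x t); have := form_bound (x t) (F t) e0; rewrite -/p.
  have : p * e * sqnorm (x t) <= 2^-1 * sqnorm (x t).
    by rewrite ler_wpM2r// sqnorm_ge0.
  lra.
rewrite (pintD _ (locintZ _ Lx) (locintZ _ LF2)) (pintZ _ _ Lx) (pintZ _ _ LF2).
case: dV => _ /(_ T T0) VE; have := P_ge0 (x T); rewrite -/(V T) VE -/(V 0).
lra.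
Qed.

End solution.
End linear_ode.

(** * Square integrable signals *)

Section square_integrable.
Variable R : realType.
Notation measurable := (@measurable _ (measurableTypeR R)).

Lemma integ_dom (D : set R) (f g : R -> R) : measurable D -> measurable_fun D f ->
  integ D g -> (forall t, D t -> `|f t| <= g t) -> integ D f.
Proof.
move=> mD mf Ig fg; apply: le_integrable Ig => //; first exact/measurable_EFinP.
move=> t Dt /=; rewrite lee_fin; apply: le_trans (fg t Dt) _; exact: ler_norm.
Qed.

(** Signals are normalized to vanish before time 0, so that agreement on the half-line is equality.
    They are not identified modulo null sets: the inner product is only semidefinite, and equality
    of trajectories is recovered by [lag_null]. *)
Definition is_l2 (f : R -> R) := [/\ forall t, t < 0 -> f t = 0,
  measurable_fun Rplus f & integ Rplus (fun t => f t ^+ 2)].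

Record l2fun := L2Fun { l2val :> R -> R; l2valP : is_l2 l2val }.

HB.instance Definition _ := gen_eqMixin l2fun.
HB.instance Definition _ := gen_choiceMixin l2fun.

Implicit Types (f g h : l2fun).

Lemma l2_neg f t : t < 0 -> f t = 0. Proof. by case: (l2valP f) => + _ _; apply. Qed.
Lemma l2_meas f : measurable_fun Rplus f. Proof. by case: (l2valP f). Qed.
Lemma l2_integ f : integ Rplus (fun t => f t ^+ 2). Proof. by case: (l2valP f). Qed.

Lemma l2_eq f g : (forall t, 0 <= t -> f t = g t) -> f = g.
Proof.
move=> fg; have {fg}: l2val f = l2val g.
  by apply/funext => t; case: (ltP t 0) => [t0|]; [rewrite !l2_neg|exact: fg].
case: f g => [f pf] [g pg] /= fg; move: pf pg; rewrite fg => pf pg.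
by congr L2Fun; exact: Prop_irrelevance.
Qed.

Lemma l2_prod f g : integ Rplus (fun t => f t * g t).
Proof.
apply: (@integ_dom _ _ (fun t => f t ^+ 2 + g t ^+ 2)) => //.
- by apply: measurable_funM; exact: l2_meas.
- by apply: integD => //; exact: l2_integ.
move=> t _; rewrite normrM -(real_normK (num_real (f t))) -(real_normK (num_real (g t))).
by have := normr_ge0 (f t); have := normr_ge0 (g t); nra.
Qed.

Lemma l2_locint f : locint f.
Proof.
move=> T; apply: (@integ_dom _ _ (fun t => 1 + f t ^+ 2)) => //.
- exact: measurable_funS (@measurable_Rplus R) (@itv_sub_Rplus R T) (l2_meas f).
- by apply: integD => //; [exact: locint_cst|exact: integ_locint (l2_integ f) _].
move=> t _; rewrite -(real_normK (num_real (f t))).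
by have := normr_ge0 (f t); nra.
Qed.

Lemma is_l2_lin (a b : R) f g : is_l2 (fun t => a * f t + b * g t).
Proof.
split=> [t t0||]; first by rewrite !l2_neg// !mulr0 addr0.
  by apply: measurable_funD; apply: measurable_funM => //; exact: l2_meas.
apply: (@integ_eq _ _ (fun t => (a ^+ 2 * f t ^+ 2 + (2 * a * b) * (f t * g t))
  + b ^+ 2 * g t ^+ 2)) => //; first by move=> t _; ring.
apply: integD => //; last by apply: integZ => //; exact: l2_integ.
apply: integD => //; first by apply: integZ => //; exact: l2_integ.
by apply: integZ => //; exact: l2_prod.
Qed.

Lemma is_l2_0 : is_l2 (fun=> 0).
Proof.
split=> //; apply: integ_eq (integ0 _) => // t _; by rewrite expr0n.
Qed.

Definition l2_0 := L2Fun is_l2_0.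
Definition l2_lin a b f g := L2Fun (is_l2_lin a b f g).
Definition l2_add f g := l2_lin 1 1 f g.
Definition l2_opp f := l2_lin (-1) 0 f f.
Definition l2_scale a f := l2_lin a 0 f f.

Lemma l2_addA : associative l2_add.
Proof. by move=> f g h; apply: l2_eq => t _ /=; ring. Qed.
Lemma l2_addC : commutative l2_add.
Proof. by move=> f g; apply: l2_eq => t _ /=; ring. Qed.
Lemma l2_add0 : left_id l2_0 l2_add.
Proof. by move=> f; apply: l2_eq => t _ /=; ring. Qed.
Lemma l2_addN : left_inverse l2_0 l2_opp l2_add.
Proof. by move=> f; apply: l2_eq => t _ /=; ring. Qed.

HB.instance Definition _ :=
  GRing.isZmodule.Build l2fun l2_addA l2_addC l2_add0 l2_addN.

Lemma l2_scaleA a b f : l2_scale a (l2_scale b f) = l2_scale (a * b) f.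
Proof. by apply: l2_eq => t _ /=; ring. Qed.
Lemma l2_scale1 : left_id 1 l2_scale.
Proof. by move=> f; apply: l2_eq => t _ /=; ring. Qed.
Lemma l2_scaleDr : right_distributive l2_scale +%R.
Proof. by move=> a f g; apply: l2_eq => t _ /=; ring. Qed.
Lemma l2_scaleDl f a b : l2_scale (a + b) f = l2_scale a f + l2_scale b f.
Proof. by apply: l2_eq => t _ /=; ring. Qed.

HB.instance Definition _ := GRing.Zmodule_isLmodule.Build R l2fun
  l2_scaleA l2_scale1 l2_scaleDr l2_scaleDl.

Lemma l2D f g t : (f + g) t = f t + g t. Proof. by rewrite /= !mul1r. Qed.
Lemma l2Z a f t : (a *: f) t = a * f t. Proof. by rewrite /= mul0r addr0. Qed.
Lemma l20 t : (0 : l2fun) t = 0. Proof. by []. Qed.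

Lemma l2_sum (I : Type) (r : seq I) (F : I -> l2fun) t :
  (\sum_(i <- r) F i) t = \sum_(i <- r) F i t.
Proof. by elim: r => [|i r IH]; rewrite ?big_nil ?big_cons// l2D IH. Qed.

Definition ip f g : R := iint (fun t => f t * g t).

Lemma ipC f g : ip f g = ip g f.
Proof. by apply: eq_Rintegral => t _; rewrite mulrC. Qed.

Lemma ipDl f g h : ip (f + g) h = ip f h + ip g h.
Proof.
rewrite /ip /iint -RintegralD//; try exact: l2_prod.
by apply: eq_Rintegral => t _; rewrite l2D mulrDl.
Qed.

Lemma ipZl a f g : ip (a *: f) g = a * ip f g.
Proof.
rewrite /ip /iint -RintegralZl//; last exact: l2_prod.
by apply: eq_Rintegral => t _; rewrite l2Z mulrA.
Qed.

Lemma ip_ge0 f : 0 <= ip f f.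
Proof. by apply: Rintegral_ge0 => t _; rewrite -expr2 sqr_ge0. Qed.

Lemma prim_exp (c : R) : prim (fun t => expR (c * t)) (fun t => c * expR (c * t)).
Proof.
apply: prim_C1 => [t|].
  rewrite mulrC; apply: is_derive_eq.
  by rewrite /GRing.scale /= mulr1.
move=> t; apply: differentiable_continuous; apply/derivable1_diffP.
exact: ex_derive.
Qed.

Definition lag_fun f t : R :=
  if t < 0 then 0 else expR (- 1 * t) * pint (fun s => expR (1 * s) * f s) t.

Lemma lag_fun_at0 f : lag_fun f 0 = 0.
Proof. by rewrite /lag_fun ltxx pint0// mulr0. Qed.

Lemma prim_lag_fun f : prim (lag_fun f) (fun t => f t - lag_fun f t).
Proof.
have L : locint (fun s => expR (1 * s) * f s).
  apply: (@locint_eq _ (fun t => f t * expR (1 * t))).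
    by move=> t _; rewrite mulrC.
  exact: locint_mul_prim (prim_exp 1) (l2_locint f).
have dI : prim (pint (fun s => expR (1 * s) * f s)) (fun s => expR (1 * s) * f s).
  by split=> // t t0; rewrite [pint _ 0]pint0// add0r.
apply: prim_eq (primM (prim_exp (-1)) dI) => t t0.
  by rewrite /lag_fun ltNge t0.
rewrite /lag_fun ltNge t0 /= mulrA -expRD mulN1r mul1r addNr expR0; ring.
Qed.

(** With [y = lag_fun f], the derivative of [y ^ 2] is [2 f y - 2 y ^ 2 = f ^ 2 - y ^ 2 - (f - y) ^
    2]. The estimate serves twice: its integral term gives square integrability, its pointwise term
    gives [lag_null]. *)
Lemma lag_fun_energy f T : 0 <= T ->
  lag_fun f T ^+ 2 + pint (fun t => lag_fun f t ^+ 2) T <= iint (fun t => f t ^+ 2).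
Proof.
move=> T0; have dL := prim_lag_fun f.
have L2 : locint (fun t => lag_fun f t ^+ 2).
  by apply: locint_eq (prim_locint (primM dL dL)) => t _; rewrite expr2.
have Lf : locint (fun t => f t ^+ 2) := integ_locint (l2_integ f).
apply: le_trans (pint_le_iint (l2_integ f) _ T0); last first.
  by move=> t _; exact: sqr_ge0.
have [Lk /(_ T T0)] := primM dL dL.
rewrite lag_fun_at0 mulr0 add0r => E.
have : lag_fun f T * lag_fun f T <= pint (fun t => f t ^+ 2 + -1 * lag_fun f t ^+ 2) T.
  rewrite E; apply: le_Rintegral => //; first exact: Lk.
    exact: (locintD Lf (locintZ _ L2)).
  by move=> t _; have := sqr_ge0 (f t - 2 * lag_fun f t);
     have := sqr_ge0 (lag_fun f t - f t); nra.
by rewrite (pintD _ Lf (locintZ _ L2)) pintZ// expr2; lra.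
Qed.

Lemma lag_fun_l2 f : is_l2 (lag_fun f).
Proof.
have dL := prim_lag_fun f; have Ll := prim_locint dL.
split=> [t t0||]; [by rewrite /lag_fun t0|exact: locint_meas|].
have L2 : locint (fun t => lag_fun f t ^+ 2).
  by apply: locint_eq (prim_locint (primM dL dL)) => t _; rewrite expr2.
apply: (@integ_Rplus_bounded _ _ (iint (fun t => f t ^+ 2))) => //.
  by move=> t _; exact: sqr_ge0.
by move=> T T0; have := lag_fun_energy f T0; have := sqr_ge0 (lag_fun f T); lra.
Qed.

Definition lag f := L2Fun (lag_fun_l2 f).

Lemma prim_lag f : prim (lag f) (fun t => f t - lag f t).
Proof. exact: prim_lag_fun. Qed.

Lemma lag_at0 f : lag f 0 = 0.
Proof. exact: lag_fun_at0. Qed.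

(** The energy estimate bounds the value at every single time, so the lag of a null signal is zero
    everywhere and not just almost everywhere. *)
Lemma lag_null f : ip f f = 0 -> lag f = 0.
Proof.
move=> f0; apply: l2_eq => t t0; rewrite l20; apply/eqP; rewrite -sqrf_eq0 eq_le sqr_ge0 andbT.
have := lag_fun_energy f t0.
have -> : iint (fun t => f t ^+ 2) = ip f f by apply: eq_Rintegral => s _; rewrite expr2.
rewrite f0 => H; have : 0 <= pint (fun t => lag_fun f t ^+ 2) t.
  by apply: Rintegral_ge0 => s _; exact: sqr_ge0.
by move: H; rewrite /lag /=; lra.
Qed.

Definition lag0_fun (t : R) : R := if t < 0 then 0 else expR (- 1 * t).

Lemma lag0_fun_at0 : lag0_fun 0 = 1.
Proof. by rewrite /lag0_fun ltxx mulr0 expR0. Qed.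

Lemma prim_lag0_fun : prim lag0_fun (fun t => - lag0_fun t).
Proof.
by apply: prim_eq (prim_exp (-1)) => t t0; rewrite /lag0_fun ltNge t0 //=; ring.
Qed.

Lemma lag0_fun_l2 : is_l2 lag0_fun.
Proof.
have dL := prim_lag0_fun; have Ll := prim_locint dL.
split=> [t t0||]; [by rewrite /lag0_fun t0|exact: locint_meas|].
have L2 : locint (fun t => lag0_fun t ^+ 2).
  by apply: locint_eq (prim_locint (primM dL dL)) => t _; rewrite expr2.
apply: (integ_Rplus_bounded (C := 1) L2) => [t _|T T0]; first exact: sqr_ge0.
have [Lk /(_ T T0) E0] := primM dL dL; move: E0.
rewrite (@eq_pint _ _ (fun t => -2 * lag0_fun t ^+ 2)); last by move=> t _; ring.
rewrite pintZ// lag0_fun_at0.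
by have := sqr_ge0 (lag0_fun T); rewrite expr2; lra.
Qed.

Definition lag0 := L2Fun lag0_fun_l2.

Lemma prim_lag0 : prim lag0 (fun t => - lag0 t).
Proof. exact: prim_lag0_fun. Qed.

Lemma lag0_at0 : lag0 0 = 1.
Proof. exact: lag0_fun_at0. Qed.

Lemma iint_parts f g (f' g' : l2fun) : prim f f' -> prim g g' ->
  ip f' g + ip f g' = - (f 0 * g 0).
Proof.
move=> df dg; rewrite /ip /iint -RintegralD//; try exact: l2_prod.
rewrite -/(iint (fun t => f' t * g t + f t * g' t)).
apply: (prim_iint (primM df dg)); first exact: l2_prod.
by apply: integD => //; exact: l2_prod.
Qed.

Lemma ipBl f g h : ip (f - g) h = ip f h - ip g h.
Proof. by rewrite ipDl -(scaleN1r g) ipZl mulN1r. Qed.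

Lemma ipBr f g h : ip f (g - h) = ip f g - ip f h.
Proof. by rewrite ipC ipBl !(ipC _ f). Qed.

Lemma l2N f t : (- f) t = - f t.
Proof. by rewrite -(scaleN1r f) l2Z mulN1r. Qed.

Lemma prim_lag' f : prim (lag f) (f - lag f).
Proof. by apply: prim_eq (prim_lag f) => t _ //; rewrite l2D l2N. Qed.

Lemma prim_lag0' : prim lag0 (- lag0).
Proof. by apply: prim_eq prim_lag0 => t _ //; rewrite l2N. Qed.

(** Integration by parts for [lag f] and [lag g], which vanish at time 0. The identity says exactly
    that [1 - 2 lag] preserves the inner product. *)
Lemma lag_ip f g : 2 * ip (lag f) (lag g) = ip f (lag g) + ip (lag f) g.
Proof.
have E := iint_parts (prim_lag' f) (prim_lag' g).
rewrite (lag_at0 f) mul0r oppr0 ipBl ipBr in E.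
by lra.
Qed.

Lemma lag0_ip g : 2 * ip lag0 (lag g) = ip lag0 g.
Proof.
have E := iint_parts prim_lag0' (prim_lag' g).
rewrite (lag_at0 g) mulr0 oppr0 ipBr -(scaleN1r lag0) ipZl in E.
by lra.
Qed.

Lemma lag_unique (x : R -> R) f (b : R) : prim x (fun t => f t - x t) -> x 0 = b ->
  forall t, 0 <= t -> x t = lag f t + b * lag0 t.
Proof.
move=> dx x0 t t0.
have dy : prim (fun t => x t + -1 * (lag f t + b * lag0 t))
    (fun t => - (x t + -1 * (lag f t + b * lag0 t))).
  apply: prim_eq (primD dx (primZ (-1) (primD (prim_lag f) (primZ b prim_lag0)))) => s _ //.
  by ring.
have dz : prim (fun t => expR (1 * t) * (x t + -1 * (lag f t + b * lag0 t))) (fun=> 0).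
  by apply: prim_eq (primM (prim_exp 1) dy) => s _ //; ring.
have := prim_const dz t0; rewrite x0 (lag_at0 f) lag0_at0 => /eqP.
rewrite (_ : b + -1 * (0 + b * 1) = 0); last by ring.
rewrite mulr0 mulf_eq0 gt_eqF ?expR_gt0//=.
by rewrite mulN1r subr_eq0 => /eqP.
Qed.

Lemma lagD f g : lag (f + g) = lag f + lag g.
Proof.
apply: l2_eq => t t0; rewrite l2D.
have d : prim (fun t => lag f t + lag g t) (fun t => (f + g : l2fun) t - (lag f t + lag g t)).
  by apply: prim_eq (primD (prim_lag f) (prim_lag g)) => s _ //; rewrite l2D; ring.
have := lag_unique d (erefl _) t0; by rewrite !lag_at0 addr0 mul0r addr0 => ->.
Qed.

Lemma lagZ a f : lag (a *: f) = a *: lag f.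
Proof.
apply: l2_eq => t t0; rewrite l2Z.
have d : prim (fun t => a * lag f t) (fun t => (a *: f : l2fun) t - a * lag f t).
  by apply: prim_eq (primZ a (prim_lag f)) => s _ //; rewrite l2Z; ring.
have := lag_unique d (erefl _) t0; by rewrite (lag_at0 f) mulr0 mul0r addr0 => ->.
Qed.

End square_integrable.

(** * Square integrable solutions of stable equations *)

Section stable_ode.
Variables (R : realType) (n : nat) (A P : 'M[R]_n).

Definition lyapunov := [/\ P^T = P, forall x : 'cV[R]_n, 0 <= (x^T *m P *m x) 0 0 &
  forall x : 'cV[R]_n, 2 * (x^T *m P *m (A *m x)) 0 0 <= - sqnorm x].

Definition l2col m (x : 'I_m -> l2fun R) (t : R) : 'cV[R]_m := \col_i x i t.

Lemma l2col_sqnorm m (x : 'I_m -> l2fun R) : integ Rplus (fun t => sqnorm (l2col x t)).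
Proof.
have : integ Rplus (fun t => \sum_(i < m) x i t ^+ 2).
  elim: (index_enum _) => [|i r IH].
    by apply: integ_eq (integ0 _) => // t _; rewrite big_nil.
  apply: integ_eq (integD _ (l2_integ (x i)) IH) => // t _; by rewrite big_cons.
by apply: integ_eq => // t _; apply: eq_bigr => i _; rewrite mxE.
Qed.

Lemma ode_l2 (F : 'I_n -> l2fun R) (b : 'cV[R]_n) : lyapunov ->
  exists2 x : 'I_n -> l2fun R, l2col x 0 = b &
    vprim (l2col x) (fun t => A *m l2col x t + l2col F t).
Proof.
case=> Psym P0 Plyap.
have LF i : locint (fun t => l2col F t i 0).
  by apply: locint_eq (l2_locint (F i)) => t _; rewrite mxE.
have LF2 := integ_locint (l2col_sqnorm F).
have [x0 x0b dx] := ode_exists A b LF.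
have [C /(_ x0 _ LF LF2 dx) [Lx bx]] := ode_energy Psym P0 Plyap.
have Ix : integ Rplus (fun t => sqnorm (x0 t)).
  apply: (integ_Rplus_bounded (C := 2 * (b^T *m P *m b) 0 0 +
    `|C| * iint (fun t => sqnorm (l2col F t)))) => // [t _|T T0]; first exact: sqnorm_ge0.
  apply: le_trans (bx T T0) _; rewrite x0b lerD2l.
  have F0 : 0 <= pint (fun t => sqnorm (l2col F t)) T.
    by apply: Rintegral_ge0 => t _; exact: sqnorm_ge0.
  apply: (@le_trans _ _ (`|C| * pint (fun t => sqnorm (l2col F t)) T)).
    by rewrite ler_wpM2r// ler_norm.
  rewrite ler_wpM2l// pint_le_iint//; first exact: l2col_sqnorm.
  by move=> t _; exact: sqnorm_ge0.
have xl2 i : is_l2 (fun t => if t < 0 then 0 else x0 t i 0).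
  have Lp : locint (fun t => if t < 0 then 0 else x0 t i 0).
    by apply: locint_eq (prim_locint (dx i)) => t t0; rewrite ltNge t0.
  split=> [t ->//||]; first exact: locint_meas.
  apply: (@integ_dom _ _ _ (fun t => sqnorm (x0 t))) => //.
    by apply: measurable_funX; exact: locint_meas.
  move=> t /RplusP t0; rewrite ltNge t0 /= ger0_norm ?sqr_ge0//; exact: sqnorm_entry.
pose x i := L2Fun (xl2 i).
have xE t : 0 <= t -> l2col x t = x0 t.
  by move=> t0; apply/colP => i; rewrite mxE /= ltNge t0.
exists x; first by rewrite xE.
by move=> i; apply: prim_eq (dx i) => t t0; rewrite xE.
Qed.

(** Since [x' = (x + x') - x], the function [x] is the lag of [x + x'] up to its initial value. The
    differential equation thus becomes an equation in the bounded operator [lag], which is all that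
    the abstract theory sees. *)
Lemma vprim_lag (F x : 'I_n -> l2fun R) (i : 'I_n) :
  vprim (l2col x) (fun t => A *m l2col x t + l2col F t) ->
  x i = lag (x i + \sum_j A i j *: x j + F i) + x i 0 *: lag0 R.
Proof.
move=> /(_ i) dx; apply: l2_eq => t t0; rewrite l2D l2Z.
apply: lag_unique => //; apply: prim_eq dx => s _; first by rewrite mxE.
rewrite !l2D l2_sum !mxE; under [in RHS]eq_bigr do rewrite l2Z.
rewrite (eq_bigr (fun j => A i j * x j s)); last by move=> j _; rewrite mxE.
ring.
Qed.

End stable_ode.

(** * Hermitian matrices and the Lyapunov equation *)

Section complex_matrices.
Variable R : realType.
Local Notation C := (R[i]).
Local Notation Re := (@complex.Re R).
Local Notation Im := (@complex.Im R).

Lemma conjE (z : C) : Num.conj z = conjc z.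
Proof. by []. Qed.

Lemma ctrE m n (M : 'M[C]_(m, n)) i j : ctr M i j = Num.conj (M j i).
Proof. by rewrite !mxE. Qed.

Lemma ctr_tr m n (M : 'M[C]_(m, n)) : ctr M = map_mx Num.conj M^T.
Proof. by rewrite /ctr map_trmx. Qed.

Lemma ctrK m n (M : 'M[C]_(m, n)) : ctr (ctr M) = M.
Proof. by apply/matrixP => i j; rewrite !ctrE conjCK. Qed.

Lemma ctrM m n p (M : 'M[C]_(m, n)) (N : 'M[C]_(n, p)) :
  ctr (M *m N) = ctr N *m ctr M.
Proof. by rewrite /ctr map_mxM trmx_mul. Qed.

Lemma ctrD m n (M N : 'M[C]_(m, n)) : ctr (M + N) = ctr M + ctr N.
Proof. by apply/matrixP => i j; rewrite !mxE rmorphD. Qed.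

Lemma ctrN m n (M : 'M[C]_(m, n)) : ctr (- M) = - ctr M.
Proof. by apply/matrixP => i j; rewrite !mxE rmorphN. Qed.

Lemma ctr_scalar n (c : C) : ctr (c%:M : 'M[C]_n) = (Num.conj c)%:M.
Proof. by rewrite /ctr map_scalar_mx tr_scalar_mx. Qed.

Lemma ctr1 n : ctr (1%:M : 'M[C]_n) = 1%:M.
Proof. by rewrite ctr_scalar rmorph1. Qed.

Lemma Re_add (z w : C) : Re (z + w) = Re z + Re w.
Proof. by case: z w => a b [c d]. Qed.

Lemma Re_sum (I : Type) (r : seq I) (P : pred I) (F : I -> C) :
  Re (\sum_(i <- r | P i) F i) = \sum_(i <- r | P i) Re (F i).
Proof. by elim/big_rec2: _ => // i y1 y2 _ <-; rewrite Re_add. Qed.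

Lemma hermitian_form_real n (M : 'M[C]_n) (z : 'cV[C]_n) : Defs.hermitian M ->
  (ctr z *m M *m z) 0 0 = ((Re ((ctr z *m M *m z) 0 0))%:C)%C.
Proof.
move=> hM; rewrite RRe_real//; apply/CrealP.
by rewrite -ctrE !ctrM ctrK hM mulmxA.
Qed.

Lemma hermitian_psd n (M : 'M[C]_n) : Defs.hermitian M ->
  (forall z : 'cV[C]_n, 0 <= Re ((ctr z *m M *m z) 0 0)) -> psd M.
Proof. by move=> hM M0; split=> // z; rewrite hermitian_form_real// ler0c. Qed.

Lemma psd_spectral n (M : 'M[C]_n) : psd M ->
  exists V : 'M[C]_n, V *m ctr V = 1%:M /\ exists2 e : 'I_n -> R,
    forall i, 0 <= e i & M = ctr V *m diag_mx (\row_i ((e i)%:C)%C) *m V.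
Proof.
case=> hM M0.
have /orthomx_spectral_subproof [[V d] /= VU ME] : M \is normalmx.
  by apply/normalmxP; rewrite -ctr_tr hM.
have cV : invmx V = ctr V by rewrite invmx_unitary// -ctr_tr.
have VV : V *m ctr V = 1%:M by rewrite ctr_tr; apply/unitarymxP.
have d0 i : 0 <= d 0 i.
  have := M0 (ctr V *m delta_mx i 0); rewrite ctrM ctrK ME cV !mulmxA.
  rewrite -[_ *m V *m ctr V]mulmxA VV mulmx1.
  rewrite -[_ *m V *m ctr V]mulmxA VV mulmx1.
  have -> : ctr (delta_mx i 0 : 'cV[C]_n) = delta_mx 0 i.
    by apply/matrixP => x y; rewrite ctrE !mxE andbC conjC_nat.
  by rewrite -rowE -colE !mxE eqxx mulr1n.
exists V; split=> //; exists (fun i => Re (d 0 i)) => [i|].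
  by have := d0 i; rewrite lecE => /andP[].
rewrite {1}ME cV; congr (_ *m diag_mx _ *m _); apply/rowP => i; rewrite !mxE.
by rewrite RRe_real// ger0_real.
Qed.

Lemma psd_factor n (M : 'M[C]_n) : psd M ->
  exists G : 'M[C]_n, M = ctr G *m G.
Proof.
move=> /psd_spectral[V [_ [e e0 ->]]].
exists (diag_mx (\row_i ((Num.sqrt (e i))%:C)%C) *m V).
rewrite ctrM !mulmxA; congr (_ *m _); rewrite -mulmxA; congr (_ *m _).
apply/matrixP => i j; rewrite mul_mx_diag [RHS]mxE ctrE !mxE.
case: (eqVneq j i) => [->|ji]; last by rewrite !mulr0n rmorph0 mul0r.
rewrite !mulr1n conjE conjc_real -rmorphM -expr2 sqr_sqrtr//.
Qed.

Definition rdot (z w : C) : R := Re z * Re w + Im z * Im w.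
Definition nsq (z : C) : R := rdot z z.

Lemma nsq_ge0 z : 0 <= nsq z.
Proof. by rewrite /nsq /rdot addr_ge0// -expr2 sqr_ge0. Qed.

Lemma nsq_eq0 z : (nsq z == 0) = (z == 0).
Proof.
case: z => a b; rewrite /nsq /rdot /= -!expr2 paddr_eq0 ?sqr_ge0//.
by rewrite !sqrf_eq0 eq_complex.
Qed.

Lemma rdotE z w : Re (Num.conj z * w) = rdot z w.
Proof. by case: z w => a b [c d]; rewrite /rdot conjE /=; ring. Qed.

Lemma nsqE z : Num.conj z * z = ((nsq z)%:C)%C.
Proof.
by case: z => a b; rewrite conjE /nsq /rdot; apply/eqP;
   rewrite eq_complex /=; apply/andP; split; apply/eqP; ring.
Qed.

Lemma nsqM z w : nsq (z * w) = nsq z * nsq w.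
Proof. by case: z w => a b [c d]; rewrite /nsq /rdot /=; ring. Qed.

Lemma rdot_weighted z w e : 0 < e -> 2 * rdot z w <= e * nsq z + e^-1 * nsq w.
Proof.
move=> e0; case: z w => a b [c d]; rewrite /nsq /rdot /=.
have H (x y : R) : 2 * (x * y) <= e * (x * x) + e^-1 * (y * y).
  have : 0 <= e * (x - e^-1 * y) ^+ 2 by rewrite mulr_ge0 ?sqr_ge0// ltW.
  have -> : e * (x - e^-1 * y) ^+ 2 = e * (x * x) + e^-1 * (y * y) - 2 * (x * y).
    by field; rewrite gt_eqF.
  by rewrite subr_ge0.
by have := H a c; have := H b d; lra.
Qed.

End complex_matrices.

Ltac pos := repeat first [assumption | apply: ltW; assumption | rewrite invr_ge0
  | rewrite invr_gt0 | apply: exprn_ge0 | apply: exprn_gt0 | apply: mulr_ge0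
  | apply: mulr_gt0 | apply: addr_ge0 | apply: addr_gt0 | done].

(** * Lyapunov's theorem for Hurwitz matrices *)

Section complex_lyapunov.
Variable R : realType.
Local Notation C := (R[i]).
Local Notation Re := (@complex.Re R).

Lemma finite_lower_bound n (f : 'I_n -> R) : (forall i, 0 < f i) ->
  exists2 a : R, 0 < a & forall i, a <= f i.
Proof.
move=> f0; pose s := 1 + \sum_i (f i)^-1.
have s0 : 0 < s by rewrite ltr_pwDl// sumr_ge0// => i _; rewrite invr_ge0 ltW.
exists s^-1; first by rewrite invr_gt0.
move=> i; rewrite -[leRHS]invrK lef_pV2 ?posrE ?invr_gt0//.
rewrite /s (bigD1 i)//= addrCA lerDl addr_ge0// sumr_ge0// => j _.
by rewrite invr_ge0 ltW.
Qed.

Lemma rdot_sum_le (z w : C) (a b e : R) : 0 < e -> nsq z <= a -> nsq w <= b ->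
  rdot z w <= 2^-1 * (e * a + e^-1 * b).
Proof.
move=> e0 za wb; have := rdot_weighted z w e0.
have : e * nsq z <= e * a by rewrite ler_wpM2l// ltW.
have : e^-1 * nsq w <= e^-1 * b by rewrite ler_wpM2l// invr_ge0 ltW.
lra.
Qed.

(** In a lower triangular system the coordinate [i] is driven only by coordinates [j < i]. With
    geometric weights [d ^ i] such a coupling costs [d ^ i <= d * d ^ j], hence for small [d] the
    negative diagonal wins. *)
Lemma triangular_weights n (T : 'M[C]_n) : is_trig_mx T ->
  (forall i, Re (T i i) < 0) ->
  exists w : 'I_n -> R, (forall i, 0 < w i) /\ exists2 c : R, 0 < c &
    forall y : 'I_n -> C, \sum_i w i * \sum_j rdot (y i) (T i j * y j) <=
      - c * \sum_i nsq (y i).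
Proof.
move=> /is_trig_mxP Ttrig T0.
have [a a0 aT] : exists2 a : R, 0 < a & forall i, a <= - Re (T i i).
  by apply: finite_lower_bound => i; rewrite oppr_gt0.
have [M M1 TM] : exists2 M : R, 1 <= M & forall i j, nsq (T i j) <= M.
  exists (1 + \sum_i \sum_j nsq (T i j)).
    by rewrite lerDl; do 2!apply: sumr_ge0 => ? _; exact: nsq_ge0.
  move=> i j.
  have h1 : 0 <= \sum_(k | k != j) nsq (T i k) by apply: sumr_ge0 => *; exact: nsq_ge0.
  have h2 : 0 <= \sum_(k | k != i) \sum_l nsq (T k l).
    by do 2!apply: sumr_ge0 => *; exact: nsq_ge0.
  by rewrite (bigD1 i)//= (bigD1 j)//=; lra.
have [N N1 Nn] : exists2 N : R, 1 <= N & n%:R <= N.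
  by exists (n%:R + 1); rewrite ?lerDl ?lerDr.
have N0 : 0 < N by lra.
have M0 : 0 < M by lra.
have [eta eta0 etaN] : exists2 eta : R, 0 < eta & N * eta = a.
  by exists (a / N); [rewrite divr_gt0|rewrite mulrC divfK ?gt_eqF].
(* Of the diagonal dissipation [a], the choice [N * eta = a] spends [a / 2] on the terms in [y i],
   and this [d] makes the terms in [y j] cost at most [a / 4]. What remains is [a / 4], weighted by
   at least [d ^ n]. *)
pose d := a * eta / (2 * M * N + a * eta).
have d_den : 0 < 2 * M * N + a * eta by rewrite !(addr_gt0, mulr_gt0).
have d0 : 0 < d by rewrite divr_gt0// mulr_gt0.
have d1 : d <= 1.
  have : 0 < M * N by rewrite mulr_gt0.
  by rewrite ler_pdivrMr// mul1r; lra.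
have dM : N * (M / (2 * eta) * d) <= a / 4.
  have -> : N * (M / (2 * eta) * d) = (2 * M * N) * d / (4 * eta) by field; rewrite gt_eqF.
  rewrite ler_pdivrMr ?mulr_gt0//.
  have -> : a / 4 * (4 * eta) = a * eta by field.
  rewrite /d mulrA ler_pdivrMr// mulrC ler_wpM2l ?mulr_ge0 ?ltW//.
  by rewrite ltrDl mulr_gt0.
exists (fun i => d ^+ i); split; first by move=> i; exact: exprn_gt0.
exists (a / 4 * d ^+ n); first by rewrite mulr_gt0 ?exprn_gt0// divr_gt0.
move=> y; have [b bE b0] : exists2 b, forall i, nsq (y i) = b i & forall i, 0 <= b i.
  by exists (fun i => nsq (y i)) => // i; exact: nsq_ge0.
rewrite (eq_bigr _ (fun i _ => bE i)).
have step i : \sum_j rdot (y i) (T i j * y j) <=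
    - a * b i + \sum_(j < n | (j < i)%N) 2^-1 * (eta * b i + eta^-1 * (M * b j)).
  rewrite (bigD1 i)//=; apply: lerD.
    rewrite (_ : rdot _ _ = Re (T i i) * b i).
      by rewrite ler_wpM2r//; have := aT i; lra.
    by rewrite -bE; move: (y i) (T i i) => [p q] [r s]; rewrite /nsq /rdot /=; ring.
  rewrite [leRHS]big_mkcond [leLHS]big_mkcond; apply: ler_sum => j _.
  have [->|ji] := eqVneq j i; first by rewrite ltnn.
  case: ltnP => [lji|]; last first.
    rewrite leq_eqVlt eq_sym => /orP[/eqP/val_inj/eqP|ij]; first by rewrite (negbTE ji).
    by rewrite Ttrig// mul0r /rdot /= !mulr0 addr0.
  by apply: rdot_sum_le => //; rewrite ?nsqM ?bE// ler_wpM2r.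
have bound : \sum_(i < n) d ^+ i * \sum_j rdot (y i) (T i j * y j) <=
    \sum_(i < n) (d ^+ i * ((- a + a / 2) * b i)) +
    \sum_(j < n) (N * (M / (2 * eta) * d) * (d ^+ j * b j)).
  apply: (@le_trans _ _ (\sum_(i < n) (d ^+ i * ((- a + a / 2) * b i) +
      \sum_(j < n) (M / (2 * eta) * d) * (d ^+ j * b j)))).
    apply: ler_sum => i _.
    apply: le_trans (ler_wpM2l (exprn_ge0 _ (ltW d0)) (step i)) _.
    have E1 : \sum_(j < n | (j < i)%N) 2^-1 * (eta * b i) <= a / 2 * b i.
      apply: (@le_trans _ _ (\sum_(j < n) 2^-1 * (eta * b i))).
        rewrite big_mkcond; apply: ler_sum => j _; case: ifP => // _.
        by pos.
      rewrite sumr_const card_ord -mulr_natl.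
      have : n%:R * eta * b i <= N * eta * b i.
        by rewrite ler_wpM2r// ler_wpM2r// ltW.
      by rewrite etaN; lra.
    have E2 : d ^+ i * \sum_(j < n | (j < i)%N) 2^-1 * (eta^-1 * (M * b j)) <=
        \sum_(j < n) (M / (2 * eta) * d) * (d ^+ j * b j).
      rewrite mulr_sumr big_mkcond; apply: ler_sum => j _; case: ifP => [ji|_]; last first.
        by pos.
      have -> : d ^+ i * (2^-1 * (eta^-1 * (M * b j))) = (M / (2 * eta)) * (d ^+ i * b j).
        by field; rewrite gt_eqF.
      rewrite -[leRHS]mulrA; apply: ler_wpM2l; first by pos.
      by rewrite mulrA ler_wpM2r// -exprS ler_wiXn2l// ltW.
    have E3 := ler_wpM2l (exprn_ge0 i (ltW d0)) E1.
    under eq_bigr do rewrite mulrDr.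
    by rewrite big_split /=; lra.
  rewrite big_split /= lerD2l sumr_const card_ord -[leLHS]mulr_natl mulr_sumr; apply: ler_sum => j _.
  rewrite mulrA; apply: ler_wpM2r; first by pos.
  apply: ler_wpM2r; first by pos.
  by [].
apply: le_trans bound _; rewrite -big_split mulr_sumr; apply: ler_sum => i _ /=.
have H1 : d ^+ n <= d ^+ i by rewrite ler_wiXn2l ?(ltW d0) ?(ltnW (ltn_ord i)).
have H2 : d ^+ n * b i <= d ^+ i * b i by rewrite ler_wpM2r.
have H3 : 0 <= d ^+ i * b i by rewrite mulr_ge0// exprn_ge0// ltW.
have H4 := ler_wpM2r H3 dM.
have H5 : a * (d ^+ n * b i) <= a * (d ^+ i * b i) by rewrite ler_wpM2l// ltW.
lra.
Qed.

Lemma Re_scale (r : R) (z : C) : Re ((r%:C)%C * z) = r * Re z.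
Proof. by case: z => a b /=; ring. Qed.

Lemma vec_normE m (z : 'cV[C]_m) : Re ((ctr z *m z) 0 0) = \sum_i nsq (z i 0).
Proof.
by rewrite mxE Re_sum; apply: eq_bigr => i _; rewrite ctrE nsqE.
Qed.

(** Unitary triangularization reduces to [triangular_weights]: a diagonal entry of [T] makes
    [T i i - T] singular, so it is an eigenvalue of [A] and has negative real part. [P] is the
    diagonal matrix of weights, scaled by [k] and carried back by [V]. Triangularization is obtained
    from the version for two commuting matrices, applied to [A] and itself. *)
Lemma hurwitz_complex_lyapunov n (A : 'M[C]_n) :
  (forall s : C, 0 <= Re s -> s%:M - A \in unitmx) ->
  exists P : 'M[C]_n, psd P /\ forall z : 'cV[C]_n,
    2 * Re ((ctr z *m P *m (A *m z)) 0 0) <= - \sum_i nsq (z i 0).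
Proof.
move=> hA; have [V VU /andP[]] := cotrigonalization2 (erefl (A *m A)).
rewrite /similar_to conjymx// -ctr_tr => Ttrig _.
have [T TE] : exists T, T = V *m A *m ctr V by exists (V *m A *m ctr V).
rewrite -TE in Ttrig.
have VV : V *m ctr V = 1%:M by rewrite ctr_tr; apply/unitarymxP.
have VV' : ctr V *m V = 1%:M by exact: mulmx1C.
have T0 i : Re (T i i) < 0.
  rewrite ltNge; apply/negP => /hA; rewrite unitmxE unitfE.
  have -> : \det ((T i i)%:M - A) = \det ((T i i)%:M - T).
    have -> : (T i i)%:M - T = V *m ((T i i)%:M - A) *m ctr V.
      by rewrite mulmxBr mulmxBl mul_mx_scalar -scalemxAl VV scalemx1 -TE.
    by rewrite !det_mulmx mulrAC -det_mulmx VV det1 mul1r.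
  rewrite det_trig; last first.
    apply/is_trig_mxP => x y xy; have Txy : T x y = 0 by move/is_trig_mxP: Ttrig; apply.
    have xny : x == y = false by rewrite -val_eqE ltn_eqF.
    by rewrite 3!mxE Txy xny subr0.
  by rewrite (bigD1 i)//= 3!mxE eqxx mulr1n subrr mul0r eqxx.
have [w [w0 [c c0 wT]]] := triangular_weights Ttrig T0.
pose k := (2 * c)^-1.
have k0 : 0 < k by rewrite invr_gt0 mulr_gt0.
pose W : 'M[C]_n := diag_mx (\row_i ((k * w i)%:C)%C).
have hW : ctr W = W.
  apply/matrixP => i j; rewrite ctrE !mxE; case: (eqVneq j i) => [->|ji].
    by rewrite !mulr1n conjE conjc_real.
  by rewrite !mulr0n rmorph0.
have formE (x y : 'cV[C]_n) : Re ((ctr x *m (ctr V *m W *m V) *m y) 0 0) =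
    k * \sum_i w i * rdot ((V *m x) i 0) ((V *m y) i 0).
  have -> : ctr x *m (ctr V *m W *m V) *m y = ctr (V *m x) *m (W *m (V *m y)).
    by rewrite ctrM !mulmxA.
  rewrite mxE Re_sum mulr_sumr; apply: eq_bigr => i _.
  by rewrite ctrE mul_diag_mx !mxE mulrCA Re_scale rdotE mulrA.
exists (ctr V *m W *m V); split.
  apply: hermitian_psd => [|z]; first by rewrite /Defs.hermitian !ctrM ctrK hW mulmxA.
  rewrite formE mulr_ge0 ?(ltW k0)// sumr_ge0// => i _.
  by rewrite mulr_ge0 ?(ltW (w0 i))// nsq_ge0.
move=> z; rewrite formE; pose y i := (V *m z) i 0.
have -> : \sum_i w i * rdot ((V *m z) i 0) ((V *m (A *m z)) i 0) =
   \sum_i w i * \sum_j rdot (y i) (T i j * y j).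
  apply: eq_bigr => i _; congr (_ * _).
  have -> : V *m (A *m z) = T *m (V *m z).
    by rewrite TE -!mulmxA [ctr V *m _]mulmxA VV' mul1mx.
  have -> : (T *m (V *m z)) i 0 = \sum_j T i j * y j by rewrite mxE.
  rewrite -[LHS]rdotE mulr_sumr Re_sum; apply: eq_bigr => j _; by rewrite rdotE.
have -> : \sum_i nsq (z i 0) = \sum_i nsq (y i).
  rewrite -vec_normE -[z in LHS]mul1mx -VV' -[RHS](vec_normE (V *m z)).
  by rewrite !ctrM ctrK !mulmxA -[_ *m V *m ctr V]mulmxA VV mulmx1.
have kc : 2 * k * c = 1 by rewrite /k; field; rewrite gt_eqF.
have k2 : 0 <= 2 * k by pos.
rewrite mulrA; apply: le_trans (ler_wpM2l k2 (wT y)) _.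
by rewrite mulrA mulrN kc mulN1r.
Qed.

Lemma ctr_cmx m n (M : 'M[R]_(m, n)) : ctr (cmx M) = cmx M^T.
Proof. by apply/matrixP => i j; rewrite ctrE !mxE conjE conjc_real. Qed.

Lemma cmxM m n p (M : 'M[R]_(m, n)) (N : 'M[R]_(n, p)) :
  cmx (M *m N) = cmx M *m cmx N.
Proof. by rewrite /cmx map_mxM. Qed.

(** On real vectors a Hermitian form is given by the real part of its matrix, which is symmetric. *)
Lemma hurwitz_lyapunov n (A : 'M[R]_n) : hurwitz A -> exists P, lyapunov A P.
Proof.
move=> hA; have [P [[hP P0] Plyap]] := hurwitz_complex_lyapunov hA.
pose Pr : 'M[R]_n := map_mx Re P.
have formE (x y : 'cV[R]_n) : (x^T *m Pr *m y) 0 0 =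
    Re ((ctr (cmx x) *m P *m cmx y) 0 0).
  rewrite ctr_cmx !mxE Re_sum; apply: eq_bigr => j _.
  rewrite !mxE !mulr_suml Re_sum; apply: eq_bigr => i _; rewrite !mxE.
  by case: (P i j) => a b /=; ring.
exists Pr; split.
- apply/matrixP => i j; rewrite !mxE -[in RHS]hP ctrE.
  by case: (P j i).
- by move=> x; rewrite formE; have := P0 (cmx x); rewrite lecE /= => /andP[_].
- move=> x; rewrite formE cmxM; apply: le_trans (Plyap _) _.
  rewrite lerN2 /sqnorm; apply: ler_sum => i _.
  by rewrite mxE /nsq /rdot /= mulr0 addr0 expr2.
Qed.

End complex_lyapunov.

(** * Spaces of signals with a lag operator *)

(* Square-zero extension [K * V] of a module [V] over a commutative ring [K]:
   module identities in [V] become ring identities, which [ring] decides. *)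
Section square_zero_extension.
Variables (K : comNzRingType) (V : lmodType K).

Definition sqz := (K * V)%type.

HB.instance Definition _ := GRing.Zmodule.on sqz.

Definition sqz_mul (x y : sqz) : sqz := (x.1 * y.1, x.1 *: y.2 + y.1 *: x.2).

Lemma sqz_mulA : associative sqz_mul.
Proof.
move=> [a x] [b y] [c z]; rewrite /sqz_mul /=; congr pair; first by rewrite mulrA.
by rewrite !scalerDr !scalerA addrA [c * a]mulrC [c * b]mulrC.
Qed.

Lemma sqz_mulC : commutative sqz_mul.
Proof. by move=> [a x] [b y]; rewrite /sqz_mul /= mulrC addrC. Qed.

Lemma sqz_mul1 : left_id ((1, 0) : sqz) sqz_mul.
Proof. by move=> [a x]; rewrite /sqz_mul /= mul1r scale1r scaler0 addr0. Qed.

Lemma sqz_mulD : left_distributive sqz_mul +%R.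
Proof.
move=> [a x] [b y] [c z]; rewrite /sqz_mul /=; congr pair; first by rewrite mulrDl.
by rewrite /= scalerDl scalerDr addrACA.
Qed.

Lemma sqz_1_neq0 : ((1, 0) : sqz) != 0.
Proof. by apply/eqP => -[] /eqP; rewrite oner_eq0. Qed.

HB.instance Definition _ := GRing.Zmodule_isComNzRing.Build sqz
  sqz_mulA sqz_mulC sqz_mul1 sqz_mulD sqz_1_neq0.

Definition sqz_vec (x : V) : sqz := (0, x).
Definition sqz_cst (c : K) : sqz := (c, 0).

Lemma sqz_cst_additive : {morph sqz_cst : x y / x - y}.
Proof. by move=> x y; rewrite /sqz_cst; congr pair; rewrite /= subrr. Qed.

HB.instance Definition _ := GRing.isZmodMorphism.Build K sqz sqz_cst sqz_cst_additive.

Lemma sqz_cst_multiplicative : (sqz_cst 1 = 1) * {morph sqz_cst : x y / x * y}.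
Proof.
split=> // x y; rewrite /sqz_cst; congr pair; rewrite /= ?scaler0 ?addr0//.
Qed.

HB.instance Definition _ :=
  GRing.isMonoidMorphism.Build K sqz sqz_cst sqz_cst_multiplicative.

Lemma sqz_inj x y : sqz_vec x = sqz_vec y -> x = y.
Proof. by case. Qed.

Lemma sqzD x y : sqz_vec (x + y) = sqz_vec x + sqz_vec y.
Proof. by rewrite /sqz_vec; congr pair; rewrite /= addr0. Qed.
Lemma sqzN x : sqz_vec (- x) = - sqz_vec x.
Proof. by rewrite /sqz_vec; congr pair; rewrite /= oppr0. Qed.
Lemma sqzZ c x : sqz_vec (c *: x) = sqz_cst c * sqz_vec x.
Proof. by rewrite /sqz_vec /sqz_cst; congr pair; rewrite /= ?mulr0 ?scaler0 ?addr0. Qed.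
Lemma sqz0 : sqz_vec 0 = 0.
Proof. by []. Qed.

End square_zero_extension.

Ltac lmodule := apply: sqz_inj; rewrite ?(sqzD, sqzN, sqzZ, sqz0); ring.

(** * Semidefinite inner products and vectors with entries in a module *)

Section sesquilinear_forms.
Variable R : realType.
Local Notation C := (R[i]).
Local Notation toC r := ((r%:C)%C : R[i]).

(* Real parts of Hermitian forms: real bilinear, and multiplication by [c] is
   adjoint to multiplication by its conjugate. *)
Record sform (V : lmodType C) (h : V -> V -> R) : Prop := {
  sformC : forall x y, h x y = h y x;
  sformDl : forall x y z, h (x + y) z = h x z + h y z;
  sformZ : forall c x y, h (c *: x) y = h x (Num.conj c *: y);
  sformR : forall (r : R) x y, h (toC r *: x) y = r * h x y }.

Record inner (V : lmodType C) (h : V -> V -> R) : Prop := {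
  inner_sform : sform h;
  inner_ge0 : forall x, 0 <= h x x }.

Section sform_theory.
Variables (V : lmodType C) (h : V -> V -> R).
Hypothesis hf : sform h.
Implicit Types x y z : V.

Lemma sfC x y : h x y = h y x. Proof. exact: sformC. Qed.
Lemma sfDl x y z : h (x + y) z = h x z + h y z. Proof. exact: sformDl. Qed.
Lemma sfDr x y z : h z (x + y) = h z x + h z y.
Proof. by rewrite !(sfC z) sfDl. Qed.
Lemma sfRl (r : R) x y : h (toC r *: x) y = r * h x y. Proof. exact: sformR. Qed.
Lemma sfRr (r : R) x y : h y (toC r *: x) = r * h y x.
Proof. by rewrite !(sfC y) sfRl. Qed.
Lemma sf0l x : h 0 x = 0.
Proof. by have := sfDl 0 0 x; rewrite addr0; lra. Qed.
Lemma sfNl x y : h (- x) y = - h x y.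
Proof. by apply/eqP; rewrite -addr_eq0 -sfDl addNr sf0l. Qed.
Lemma sfNr x y : h x (- y) = - h x y.
Proof. by rewrite !(sfC x) sfNl. Qed.
Lemma sfZl c x y : h (c *: x) y = h x (Num.conj c *: y). Proof. exact: sformZ. Qed.
Lemma sfZr c x y : h x (c *: y) = h (Num.conj c *: x) y.
Proof. by rewrite sfC sfZl sfC. Qed.
Lemma sf_suml (I : Type) (r : seq I) (F : I -> V) y :
  h (\sum_(i <- r) F i) y = \sum_(i <- r) h (F i) y.
Proof. by elim: r => [|i r IH]; rewrite ?big_nil ?sf0l// !big_cons sfDl IH. Qed.
Lemma sf_sumr (I : Type) (r : seq I) (F : I -> V) y :
  h y (\sum_(i <- r) F i) = \sum_(i <- r) h y (F i).
Proof. by rewrite sfC sf_suml; apply: eq_bigr => i _; rewrite sfC. Qed.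
Lemma sf_nsq c x : h (c *: x) (c *: x) = nsq c * h x x.
Proof. by rewrite sfZl scalerA nsqE sfRr. Qed.
Lemma sf_sq_add x y : h (x + y) (x + y) = h x x + 2 * h x y + h y y.
Proof. by rewrite !sfDl !sfDr (sfC y x); ring. Qed.
Lemma sf_parallelogram x y :
  h (x + y) (x + y) + h (x - y) (x - y) = 2 * h x x + 2 * h y y.
Proof. by rewrite !sf_sq_add !sfNl !sfNr; ring. Qed.
End sform_theory.

Lemma sform_lincomb (V : lmodType C) (a b : R) (h k : V -> V -> R) :
  sform h -> sform k -> sform (fun x y => a * h x y + b * k x y).
Proof.
move=> hf kf; split=> [x y|x y z|c x y|r x y].
- by rewrite (sfC hf) (sfC kf).
- by rewrite (sfDl hf) (sfDl kf); ring.
- by rewrite (sfZl hf) (sfZl kf).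
- by rewrite (sfRl hf) (sfRl kf); ring.
Qed.

Section inner_theory.
Variables (V : lmodType C) (rp : V -> V -> R).
Hypothesis hi : inner rp.
Let hf := inner_sform hi.
Implicit Types x y z : V.
Local Notation N x := (rp x x).

Lemma N_ge0 x : 0 <= N x. Proof. exact: inner_ge0. Qed.

Lemma inner_weighted x y e : 0 < e -> 2 * rp x y <= e * N x + e^-1 * N y.
Proof.
move=> e0; have := N_ge0 (toC e *: x - y).
rewrite (sf_sq_add hf) !(sfNr hf) !(sfNl hf) opprK !(sfRl hf) !(sfRr hf).
move=> H; have : 0 <= e^-1 * (e * (e * N x) + 2 * - (e * rp x y) + N y).
  by rewrite mulr_ge0// invr_ge0 ltW.
have -> : e^-1 * (e * (e * N x) + 2 * - (e * rp x y) + N y) =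
   e * N x - 2 * rp x y + e^-1 * N y by field; rewrite gt_eqF.
by lra.
Qed.

Lemma inner_abs_weighted x y e : 0 < e ->
  2 * `|rp x y| <= e * N x + e^-1 * N y.
Proof.
move=> e0; case: (ger0P (rp x y)) => _; first exact: inner_weighted.
by have := inner_weighted x (- y) e0; rewrite !(sfNr hf) (sfNl hf) opprK.
Qed.

Lemma N_add_le x y : N (x + y) <= 2 * N x + 2 * N y.
Proof. by rewrite -(sf_parallelogram hf) lerDl N_ge0. Qed.

Lemma N_opp x : N (- x) = N x.
Proof. by rewrite (sfNr hf) (sfNl hf) opprK. Qed.

Lemma N_sub_le x y : N (x - y) <= 2 * N x + 2 * N y.
Proof. by rewrite -(N_opp y) N_add_le. Qed.

Lemma N_null x y : N x = 0 -> rp x y = 0.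
Proof.
move=> x0; apply/eqP; rewrite -normr_le0 leNgt; apply/negP => H.
have /(inner_abs_weighted x y) : 0 < (N y + 1) / `|rp x y|.
  by rewrite divr_gt0// ltr_wpDl// N_ge0.
rewrite x0 mulr0 add0r invf_div.
have y1 : 0 < N y + 1 by rewrite ltr_wpDl// N_ge0.
have : `|rp x y| / (N y + 1) * N y <= `|rp x y|.
  by rewrite mulrAC ler_pdivrMr// ler_wpM2l// lerDl.
lra.
Qed.

Lemma N_sum_le (I : Type) (r : seq I) (F : I -> V) :
  N (\sum_(i <- r) F i) <= 2 ^+ size r * \sum_(i <- r) N (F i).
Proof.
elim: r => [|i r IH]; first by rewrite !big_nil (sf0l hf) mulr0.
rewrite !big_cons; apply: le_trans (N_add_le _ _) _.
rewrite exprS -mulrA -mulrDr ler_pM2l// mulrDr.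
have : N (F i) <= 2 ^+ size r * N (F i).
  by rewrite ler_peMl ?N_ge0// exprn_ege1// ler1n.
lra.
Qed.
End inner_theory.

Definition bounded_map (V W : lmodType C) (rv : V -> V -> R) (rw : W -> W -> R)
  (T : V -> W) := exists2 K : R, 0 <= K & forall x, rw (T x) (T x) <= K * rv x x.

Lemma sform_scalar : sform (fun z w : C^o => rdot z w).
Proof.
split=> [[a b] [c d]|[a b] [c d] [e f]|[a b] [c d] [e f]|r [c d] [e f]];
  rewrite /rdot ?conjE /=; ring.
Qed.

(** The one-dimensional instance: estimates proved for signals are applied to it to bound the
    entries of transfer matrices. *)
Lemma inner_scalar : inner (fun z w : C^o => rdot z w).
Proof. by split; [exact: sform_scalar|exact: nsq_ge0]. Qed.

Section vectors.
Variables (V : lmodType C) (rp : V -> V -> R).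
Hypothesis hi : inner rp.
Let hf := inner_sform hi.

Definition vec m := {ffun 'I_m -> V}.
HB.instance Definition _ m := GRing.Lmodule.on (vec m).

Definition vrp m (u v : vec m) : R := \sum_i rp (u i) (v i).

Lemma vecD m (u v : vec m) i : (u + v) i = u i + v i. Proof. by rewrite ffunE. Qed.
Lemma vecZ m c (u : vec m) i : (c *: u) i = c *: u i. Proof. by rewrite ffunE. Qed.
Lemma vec0 m i : (0 : vec m) i = 0. Proof. by rewrite ffunE. Qed.

Lemma vec_inner m : inner (@vrp m).
Proof.
split; last by move=> x; apply: sumr_ge0 => i _; exact: N_ge0.
split=> [x y|x y z|c x y|r x y]; rewrite /vrp.
- by apply: eq_bigr => i _; rewrite (sfC hf).
- by rewrite -big_split; apply: eq_bigr => i _; rewrite vecD (sfDl hf).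
- by apply: eq_bigr => i _; rewrite !vecZ (sfZl hf).
- by rewrite mulr_sumr; apply: eq_bigr => i _; rewrite vecZ (sfRl hf).
Qed.

Definition act p m (M : 'M[C]_(p, m)) (u : vec m) : vec p :=
  [ffun i => \sum_j M i j *: u j].

Lemma actE p m (M : 'M[C]_(p, m)) u i : act M u i = \sum_j M i j *: u j.
Proof. by rewrite ffunE. Qed.

Lemma actM p m k (M : 'M[C]_(p, m)) (L : 'M[C]_(m, k)) u :
  act (M *m L) u = act M (act L u).
Proof.
apply/ffunP => i; rewrite !actE.
under [RHS]eq_bigr do rewrite actE scaler_sumr.
rewrite exchange_big /=; apply: eq_bigr => j _; rewrite mxE scaler_suml.
by apply: eq_bigr => l _; rewrite scalerA.
Qed.

Lemma actDl p m (M L : 'M[C]_(p, m)) u : act (M + L) u = act M u + act L u.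
Proof.
apply/ffunP => i; rewrite vecD !actE -big_split; apply: eq_bigr => j _.
by rewrite mxE scalerDl.
Qed.

Lemma actZl p m c (M : 'M[C]_(p, m)) u : act (c *: M) u = c *: act M u.
Proof.
apply/ffunP => i; rewrite vecZ !actE scaler_sumr; apply: eq_bigr => j _.
by rewrite mxE scalerA.
Qed.

Lemma actNl p m (M : 'M[C]_(p, m)) u : act (- M) u = - act M u.
Proof. by rewrite -scaleN1r actZl scaleN1r. Qed.

Lemma act_scalar m (c : C) (u : vec m) : act c%:M u = c *: u.
Proof.
apply/ffunP => i; rewrite vecZ actE (bigD1 i)//= big1 ?addr0 ?mxE ?eqxx ?mulr1n//.
by move=> j ji; rewrite mxE eq_sym (negbTE ji) mulr0n scale0r.
Qed.

Lemma act1 m (u : vec m) : act 1%:M u = u.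
Proof. by rewrite act_scalar scale1r. Qed.

Lemma actD p m (M : 'M[C]_(p, m)) u v : act M (u + v) = act M u + act M v.
Proof.
apply/ffunP => i; rewrite vecD !actE -big_split; apply: eq_bigr => j _.
by rewrite vecD scalerDr.
Qed.

Lemma actZ p m c (M : 'M[C]_(p, m)) u : act M (c *: u) = c *: act M u.
Proof.
apply/ffunP => i; rewrite vecZ !actE scaler_sumr; apply: eq_bigr => j _.
by rewrite vecZ !scalerA mulrC.
Qed.

Lemma actN p m (M : 'M[C]_(p, m)) u : act M (- u) = - act M u.
Proof. by rewrite -scaleN1r actZ scaleN1r. Qed.

Lemma vrp_adj p m (M : 'M[C]_(p, m)) u v : vrp (act M u) v = vrp u (act (ctr M) v).
Proof.
rewrite /vrp.
under eq_bigr do rewrite actE (sf_suml hf).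
rewrite exchange_big /=; apply: eq_bigr => j _.
rewrite actE (sf_sumr hf); apply: eq_bigr => i _.
by rewrite (sfZl hf) ctrE.
Qed.

(** Positivity on complex vectors carries over to vectors of signals because [M = ctr G *m G] turns
    the form into the square norm of [act G u]. *)
Lemma psd_act_ge0 m (M : 'M[C]_m) : psd M -> forall u : vec m, 0 <= vrp (act M u) u.
Proof.
move=> /psd_factor [G ->] u; rewrite actM vrp_adj ctrK.
exact: (inner_ge0 (vec_inner m)).
Qed.

Lemma act_bounded p m (M : 'M[C]_(p, m)) : bounded_map (@vrp m) (@vrp p) (act M).
Proof.
exists (\sum_i \sum_j 2 ^+ size (index_enum 'I_m) * nsq (M i j)).
  by do 2!apply: sumr_ge0 => ? _; rewrite mulr_ge0 ?exprn_ge0// nsq_ge0.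
move=> u; rewrite {1}/vrp mulr_suml; apply: ler_sum => i _; rewrite actE.
apply: le_trans (N_sum_le hi _ _) _; rewrite mulr_sumr mulr_suml.
apply: ler_sum => j _; rewrite (sf_nsq hf) -mulrA ler_pM2l ?exprn_gt0//.
rewrite ler_wpM2l ?nsq_ge0// /vrp (bigD1 j)//= lerDl sumr_ge0// => l _.
exact: N_ge0.
Qed.

End vectors.
End sesquilinear_forms.

(** * The lag operator and positivity of shift-invariant forms *)

Section lagged_spaces.
Variable R : realType.
Local Notation C := (R[i]).

(* An abstract copy of the operator [f |-> y], [y' = - y + f], [y 0 = 0], on
   square integrable signals: its symbol is [1 / (s + 1)]. *)
Record lagged (V : lmodType C) (rp : V -> V -> R) (S : V -> V) : Prop := {
  lagged_inner : inner rp;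
  laggedD : {morph S : x y / x + y};
  laggedZ : forall c, {morph S : x / c *: x};
  lagged_rp : forall x y, 2 * rp (S x) (S y) = rp x (S y) + rp (S x) y;
  lagged_null : forall x, rp x x = 0 -> S x = 0 }.

Definition vlag (V : lmodType C) (S : V -> V) m (u : vec V m) : vec V m :=
  [ffun i => S (u i)].

Lemma vlagE (V : lmodType C) (S : V -> V) m (u : vec V m) i : vlag S u i = S (u i).
Proof. by rewrite ffunE. Qed.

Lemma vec_lagged (V : lmodType C) (rp : V -> V -> R) (S : V -> V) m :
  lagged rp S -> lagged (@vrp R V rp m) (@vlag V S m).
Proof.
move=> hL; have hi := lagged_inner hL; split.
- exact: vec_inner.
- by move=> u v; apply/ffunP => i; rewrite !(vlagE, vecD) (laggedD hL).
- by move=> c u; apply/ffunP => i; rewrite !(vlagE, vecZ) (laggedZ hL).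
- move=> u v; rewrite /vrp mulr_sumr -big_split; apply: eq_bigr => i _.
  by rewrite !vlagE (lagged_rp hL).
move=> u u0; apply/ffunP => i; rewrite vlagE vec0; apply: (lagged_null hL).
apply/eqP; rewrite eq_le N_ge0// andbT -u0 /vrp (bigD1 i)//= lerDl.
by apply: sumr_ge0 => j _; exact: N_ge0.
Qed.

Lemma vlag_act (V : lmodType C) (rp : V -> V -> R) (S : V -> V) p m
    (M : 'M[C]_(p, m)) (u : vec V m) : lagged rp S ->
  vlag S (act M u) = act M (vlag S u).
Proof.
move=> hL; apply/ffunP => i; rewrite vlagE !actE.
have S0 : S 0 = 0 by have := laggedZ hL 0 0; rewrite !scale0r.
elim: (index_enum _) => [|j r IH]; first by rewrite !big_nil.
by rewrite !big_cons (laggedD hL) IH (laggedZ hL) vlagE.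
Qed.

Section shift.
Variables (V : lmodType C) (rp : V -> V -> R) (S : V -> V).
Hypothesis hL : lagged rp S.
Let hi := lagged_inner hL.
Let hf := inner_sform hi.
Local Notation N x := (rp x x).

Lemma lagN x : S (- x) = - S x.
Proof. by rewrite -scaleN1r (laggedZ hL) scaleN1r. Qed.
Lemma lagB x y : S (x - y) = S x - S y.
Proof. by rewrite (laggedD hL) lagN. Qed.
Lemma lag_zero : S 0 = 0.
Proof. by have := laggedZ hL 0 0; rewrite !scale0r. Qed.

(* The Laguerre shift, with symbol [(s - 1) / (s + 1)]. *)
Definition shift x := x - (S x + S x).
Local Notation U := shift.

Lemma shiftD : {morph U : x y / x + y}.
Proof. by move=> x y; rewrite /U (laggedD hL); lmodule. Qed.
Lemma shiftZ c : {morph U : x / c *: x}.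
Proof. by move=> x; rewrite /U (laggedZ hL); lmodule. Qed.
Lemma shiftN : {morph U : x / - x}.
Proof. by move=> x; rewrite -scaleN1r shiftZ scaleN1r. Qed.
Lemma shiftB : {morph U : x y / x - y}.
Proof. by move=> x y; rewrite shiftD shiftN. Qed.

Lemma shift_rp x y : rp (U x) (U y) = rp x y.
Proof.
rewrite /U !(sfDl hf, sfDr hf, sfNl hf, sfNr hf).
by have := lagged_rp hL x y; lra.
Qed.

Lemma iter_shiftD m : {morph iter m U : x y / x + y}.
Proof. by elim: m => // m IH x y; rewrite !iterS IH shiftD. Qed.
Lemma iter_shiftZ m c : {morph iter m U : x / c *: x}.
Proof. by elim: m => // m IH x; rewrite !iterS IH shiftZ. Qed.
Lemma iter_shiftN m : {morph iter m U : x / - x}.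
Proof. by elim: m => // m IH x; rewrite !iterS IH shiftN. Qed.

Lemma nsq_unit_sqrt (eta : C) : nsq eta = 1 -> nsq (sqrtC eta) = 1.
Proof.
move=> eta1; have := nsqM (sqrtC eta) (sqrtC eta); rewrite -expr2 sqrtCK eta1 -expr2.
move/esym/eqP; rewrite -subr_eq0 subr_sqr_1 mulf_eq0 subr_eq0 => /orP[/eqP//|].
by rewrite paddr_eq0 ?nsq_ge0// oner_eq0 andbF.
Qed.

Section invariant_form.
Variable h : V -> V -> R.
Hypothesis hh : sform h.
Hypothesis h_shift : forall x, h (U x) (U x) = h x x.

Lemma iter_shift_form m x : h (iter m U x) (iter m U x) = h x x.
Proof. by elim: m => // m IH; rewrite iterS h_shift. Qed.

(* Factoring [U^2m - eta = (U^m - xi) (U^m + xi)] with [xi^2 = eta], the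
   parallelogram law lets one choose the sign of [xi] so that the form at most
   doubles. *)
Lemma shift_descent p x eta : nsq eta = 1 -> eta != 1 ->
  exists z y, [/\ nsq z = 1, z != 1, U y - z *: y = iter (2 ^ p) U x - eta *: x
    & h y y <= 2 ^+ p * h x x].
Proof.
elim: p x eta => [|p IH] x eta eta1 etaN1.
  by exists eta, x; split=> //; rewrite mul1r.
pose xi := sqrtC eta; have xi2 : xi * xi = eta by rewrite -expr2 sqrtCK.
have xi1 : nsq xi = 1 by exact: nsq_unit_sqrt.
have xiN1 : xi != 1 by apply: contraNneq etaN1 => e; rewrite -xi2 e mulr1.
have xiN1' : - xi != 1.
  by apply: contraNneq etaN1 => e; rewrite -xi2 -mulrNN e mulr1.
pose W := iter (2 ^ p) U; have WE : iter (2 ^ p.+1) U x = W (W x).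
  by rewrite expnS mul2n -addnn iterD.
have par := sf_parallelogram hh (W x) (xi *: x).
rewrite iter_shift_form (sf_nsq hh) xi1 mul1r in par.
have nxi : nsq (- xi) = 1 by rewrite -mulN1r nsqM xi1 mulr1 /nsq /rdot /=; ring.
have [le1|le2] := leP (h (W x + xi *: x) (W x + xi *: x)) (2 * h x x).
  have [z [y [z1 zN1 e le]]] := IH (W x + xi *: x) xi xi1 xiN1.
  exists z, y; split=> //.
    by rewrite e WE iter_shiftD iter_shiftZ -/W -xi2; lmodule.
  by apply: le_trans le _; rewrite exprSr -mulrA ler_pM2l ?exprn_gt0.
have [z [y [z1 zN1 e le]]] := IH (W x - xi *: x) (- xi) nxi xiN1'.
exists z, y; split=> //.
  by rewrite e WE iter_shiftD iter_shiftN iter_shiftZ -/W -xi2; lmodule.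
apply: le_trans le _; rewrite exprSr -mulrA ler_pM2l ?exprn_gt0//; lra.
Qed.
End invariant_form.

Lemma archimedean_ge0 (a b : R) : (forall p : nat, - b <= 2 ^+ p * a) -> 0 <= a.
Proof.
move=> H; rewrite leNgt; apply/negP => a0.
pose p := (Num.trunc (`|b| / - a)).+1.
have := H p; rewrite leNgt => /negP; apply.
have pb : `|b| < p%:R * - a by rewrite -ltr_pdivrMr ?oppr_gt0// truncnS_gt.
have : p%:R * - a <= 2 ^+ p * - a.
  rewrite ler_wpM2r ?oppr_ge0 ?(ltW a0)//.
  by have := ltn_expl p (isT : (1 < 2)%N); rewrite -(ltr_nat R) natrX => /ltW.
by have := ler_norm b; lra.
Qed.

(** The hypothesis loses a multiple of [N y], and the norm of the approximate eigenvector is not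
    controlled along the descent. So the descent is run on [h + lam * rp], which is invariant as
    well and absorbs this loss; [lam] tends to 0 at the end. It starts from the eigenvalue -1, with
    residual [U^(2^p) x + x] of square norm at most [4 * N x]. *)
Lemma invariant_form_ge0 (h : V -> V -> R) : sform h ->
  (forall x, h (U x) (U x) = h x x) ->
  (forall lam, 0 < lam -> exists K, forall z x, nsq z = 1 -> z != 1 ->
     - lam * N x - K * N (U x - z *: x) <= h x x) ->
  forall x, 0 <= h x x.
Proof.
move=> hh hU Happ x.
have key lam : 0 < lam -> 0 <= 1 * h x x + lam * N x.
  move=> l0; have [K HK] := Happ _ l0.
  pose h' y z := 1 * h y z + lam * rp y z.
  have hh' : sform h' by exact: sform_lincomb.
  have hU' y : h' (U y) (U y) = h' y y by rewrite /h' hU shift_rp.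
  apply: (@archimedean_ge0 _ (`|K| * (4 * N x))) => p.
  have m1 : nsq (-1 : C) = 1 by rewrite /nsq /rdot /=; ring.
  have m1N : (-1 : C) != 1 by rewrite -subr_eq0 -opprD oppr_eq0 -mulr2n pnatr_eq0.
  have [z [y [z1 zN1 e le]]] := shift_descent hh' hU' p x m1 m1N.
  apply: le_trans le; have := HK z y z1 zN1; rewrite e scaleN1r opprK => H.
  have N4 : N (iter (2 ^ p) U x + x) <= 4 * N x.
    have := N_add_le hi (iter (2 ^ p) U x) x.
    by rewrite iter_shift_form; [lra|move=> w; exact: shift_rp].
  have : K * N (iter (2 ^ p) U x + x) <= `|K| * (4 * N x).
    apply: (@le_trans _ _ (`|K| * N (iter (2 ^ p) U x + x))).
      by rewrite ler_wpM2r ?N_ge0// ler_norm.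
    by rewrite ler_wpM2l.
  by rewrite /h'; lra.
rewrite leNgt; apply/negP => h0.
have d0 : 0 < 2 * (N x + 1) by have := N_ge0 hi x; lra.
have /key : 0 < - h x x / (2 * (N x + 1)) by rewrite divr_gt0// oppr_gt0.
rewrite mul1r -mulrA => H.
have : (2 * (N x + 1))^-1 * N x <= 2^-1.
  by rewrite mulrC ler_pdivrMr//; lra.
by have := N_ge0 hi x; nra.
Qed.

End shift.
End lagged_spaces.

(** * Energy estimates and transfer matrices *)

Section energy.
Variables (R : realType) (V : lmodType R[i]) (rp : V -> V -> R).
Local Notation C := (R[i]).
Local Notation Re := (@complex.Re R).
Hypothesis hi : inner rp.
Let hiv m := vec_inner hi m.
Let hfv m := inner_sform (hiv m).
Local Notation N x := (vrp rp x x).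

Variables (n : nat) (A P : 'M[C]_n).

Definition complex_lyapunov := psd P /\ forall z : 'cV[C]_n,
  2 * Re ((ctr z *m P *m (A *m z)) 0 0) <= - \sum_i nsq (z i 0).

Hypothesis hP : complex_lyapunov.

Let Pherm : ctr P = P. Proof. by case: hP => -[]. Qed.

(** The Lyapunov inequality says that [- (ctr A *m P + P *m A) - 1] is positive semidefinite, a form
    in which it passes to vectors of signals. *)
Lemma lyapunov_form (u : vec V n) : N u <= - (2 * vrp rp (act P u) (act A u)).
Proof.
pose M := - (ctr A *m P + P *m A) - 1%:M.
have Mpsd : psd M.
  apply: hermitian_psd => [|z].
    by rewrite /Defs.hermitian /M ctrD !ctrN ctrD !ctrM ctrK Pherm ctr1 [X in - X - _]addrC.
  have -> : ctr z *m M *m z = - (ctr z *m P *m (A *m z))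
       - ctr (ctr z *m P *m (A *m z)) - ctr z *m z.
    rewrite /M mulmxBr mulmx1 mulmxBl mulmxN mulNmx mulmxDr mulmxDl !ctrM ctrK Pherm.
    by rewrite opprD [- _ - _]addrC !mulmxA.
  have e (a b c : 'M[C]_1) : (- a - b - c) 0 0 = - (a 0 0) - b 0 0 - c 0 0 by rewrite !mxE.
  rewrite e ctrE; have := (proj2 hP) z; rewrite -vec_normE.
  move: ((ctr z *m P *m (A *m z)) 0 0) ((ctr z *m z) 0 0) => [a b] [c d].
  by rewrite conjE /=; lra.
have E1 : vrp rp (act (ctr A) (act P u)) u = vrp rp (act P u) (act A u).
  by rewrite (vrp_adj hi) ctrK.
have E2 : vrp rp (act P (act A u)) u = vrp rp (act P u) (act A u).
  by rewrite (vrp_adj hi) Pherm (sfC (hfv n)).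
have := psd_act_ge0 hi Mpsd u; rewrite /M !actDl !actNl !actDl act1 !actM.
by rewrite !(sfDl (hfv n), sfNl (hfv n)) E1 E2; lra.
Qed.

(** The orthogonality expresses that the Lyapunov energy has no net variation. It holds for
    [s u = A u + f] on the imaginary axis ([resolvent_orth]) and for responses from rest
    ([lag_energy]), so one estimate bounds both transfer matrices and responses. *)
Lemma energy_bound : exists2 K : R, 0 <= K & forall u f : vec V n,
  vrp rp (act P u) (act A u + f) = 0 -> N u <= K * N f.
Proof.
have [K K0 HK] := act_bounded hi P; exists (4 * K); first by pos.
move=> u f; rewrite (sfDr (hfv n)) => e.
have e2 : vrp rp (act P u) f = vrp rp u (act P f) by rewrite (vrp_adj hi) Pherm.
have h2 : 0 < 2^-1 :> R by pos.
have := inner_weighted (hiv n) u (act P f) h2; rewrite invrK.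
by have := lyapunov_form u; have := HK f; lra.
Qed.

Lemma resolvent_orth (s : C) (u : vec V n) : Re s = 0 ->
  vrp rp (act P u) (s *: u) = 0.
Proof.
move=> s0; have sc : Num.conj s = - s.
  by case: s s0 => a b /= ->; rewrite conjE; apply/eqP; rewrite eq_complex /= oppr0 !eqxx.
have := sfZr (hfv n) s (act P u) u.
have -> : vrp rp (Num.conj s *: act P u) u = - vrp rp (act P u) (s *: u).
  by rewrite sc -actZ (vrp_adj hi) Pherm scaleNr (sfNl (hfv n)) (sfC (hfv n)).
lra.
Qed.

Definition transfer m (B : 'M[C]_(n, m)) (s : C) : 'M[C]_(n, m) :=
  invmx (s%:M - A) *m B.

Hypothesis hA : forall s : C, 0 <= Re s -> s%:M - A \in unitmx.

Lemma transfer_eq m (B : 'M[C]_(n, m)) s (u : vec V m) : Re s = 0 ->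
  act A (act (transfer B s) u) + act B u = s *: act (transfer B s) u.
Proof.
move=> s0; have := mulKVmx (hA (_ : 0 <= Re s)) B; rewrite s0 => /(_ (lexx _)) e.
have -> : act B u = s *: act (transfer B s) u - act A (act (transfer B s) u).
  by rewrite -{1}e actM actDl actNl act_scalar.
by rewrite addrCA subrr addr0.
Qed.

(** The bound is uniform along the axis. Its second half, read off from [s G = A G + B], controls
    the behaviour near [s] infinite, that is, near the excluded point of the circle. *)
Lemma transfer_bounded m (B : 'M[C]_(n, m)) : exists2 K : R, 0 <= K &
  forall s (u : vec V m), Re s = 0 ->
    N (act (transfer B s) u) <= K * N u /\ N (s *: act (transfer B s) u) <= K * N u.
Proof.
have [K K0 HK] := energy_bound; have [L L0 HL] := act_bounded hi B.
have [M M0 HM] := act_bounded hi A.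
have KL : 0 <= K * L by pos.
have MKL : 0 <= M * (K * L) by pos.
exists (K * L + (2 * (M * (K * L)) + 2 * L)); first by pos.
move=> s u s0; pose x := act (transfer B s) u.
have x1 : N x <= K * L * N u.
  rewrite -mulrA; apply: le_trans (HK x (act B u) _) _; last first.
    by rewrite ler_wpM2l.
  by rewrite (transfer_eq B u s0) resolvent_orth.
have Nu : 0 <= N u by exact: N_ge0.
split; first by apply: le_trans x1 _; rewrite ler_wpM2r// lerDl; pos.
rewrite -(transfer_eq B u s0); apply: le_trans (N_add_le (hiv n) _ _) _.
have : N (act A x) <= M * (K * L) * N u.
  by apply: le_trans (HM x) _; rewrite -mulrA ler_wpM2l.
have : 0 <= K * L * N u by pos.
by have := HL u; lra.
Qed.

End energy.

(** * Rational matrix functions on the unit circle *)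

Section unit_circle_functions.
Variable R : realType.
Local Notation C := (R[i]).
Local Notation Re := (@complex.Re R).
Local Notation toC r := ((r%:C)%C : R[i]).

(** The point 1 is removed because it corresponds to infinite frequency. *)
Definition circle (z : C) := nsq z = 1 /\ z != 1.

Lemma circle_conj z : circle z -> Num.conj z * z = 1.
Proof. by case=> z1 _; rewrite nsqE z1. Qed.

Lemma circle_neq0 z : circle z -> z != 0.
Proof. by case=> z1 _; rewrite -nsq_eq0 z1 oner_eq0. Qed.

Lemma circle_sub1 z : circle z -> 1 - z != 0.
Proof. by case=> _; rewrite subr_eq0 eq_sym. Qed.

Lemma nsq_conj (z : C) : nsq (Num.conj z) = nsq z.
Proof. by case: z => a b; rewrite conjE /nsq /rdot /=; ring. Qed.

(** The inverse of the symbol [(s - 1) / (s + 1)] of the shift. *)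
Definition cayley (z : C) : C := (1 + z) / (1 - z).

Lemma Re_cayley z : circle z -> Re (cayley z) = 0.
Proof.
case; case: z => a b; rewrite /nsq /rdot /= => e _; rewrite /cayley /=.
move: (_^-1) => d.
have -> : (1 + a) * ((1 - a) * d) - (0 + b) * - ((0 - b) * d) = (1 - (a * a + b * b)) * d.
  by ring.
by rewrite e subrr mul0r.
Qed.

Lemma cayley_inv (s : C) : Re s = 0 ->
  circle ((s - 1) / (s + 1)) /\ cayley ((s - 1) / (s + 1)) = s.
Proof.
move=> s0; have s1 : s + 1 != 0.
  apply/eqP => /(congr1 (fun w : C => Re w)); rewrite Re_add s0 /= add0r.
  by move/eqP; rewrite oner_eq0.
have sn1 : nsq (s - 1) = nsq (s + 1).
  by case: s s0 {s1} => a b /= ->; rewrite /nsq /rdot /=; ring.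
have two : (1 + 1 : C) != 0 by rewrite -mulr2n pnatr_eq0.
split; first split.
- have := nsqM ((s - 1) / (s + 1)) (s + 1); rewrite divfK// sn1.
  by rewrite -[X in X = _]mul1r => /mulIf <- //; rewrite nsq_eq0.
- apply: contra two => /eqP /(congr1 (fun w => w * (s + 1))).
  by rewrite divfK// mul1r => /addrI/eqP; rewrite eq_sym -subr_eq0 opprK.
- rewrite /cayley; have -> : 1 + (s - 1) / (s + 1) = (1 + 1) * s / (s + 1) by field.
  have -> : 1 - (s - 1) / (s + 1) = (1 + 1) / (s + 1) by field.
  by field; rewrite s1.
Qed.

Definition ebounded m p (F : C -> 'M[C]_(m, p)) :=
  exists2 K : R, 0 <= K & forall z i j, circle z -> nsq (F z i j) <= K.

Lemma nsq_sum_le (I : Type) (r : seq I) (F : I -> C) :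
  nsq (\sum_(i <- r) F i) <= 2 ^+ size r * \sum_(i <- r) nsq (F i).
Proof. exact: (N_sum_le (inner_scalar R)). Qed.

Lemma ebounded_cst m p (M : 'M[C]_(m, p)) : ebounded (fun=> M).
Proof.
exists (\sum_i \sum_j nsq (M i j)); first by do 2!apply: sumr_ge0 => *; exact: nsq_ge0.
move=> _ i j _; rewrite (bigD1 i)//= (bigD1 j)//= -addrA lerDl.
by apply: addr_ge0; apply: sumr_ge0 => * /=; rewrite ?nsq_ge0// sumr_ge0// => *; exact: nsq_ge0.
Qed.

Lemma ebounded_mul m p q (F : C -> 'M[C]_(m, p)) (G : C -> 'M[C]_(p, q)) :
  ebounded F -> ebounded G -> ebounded (fun z => F z *m G z).
Proof.
move=> [K K0 HK] [L L0 HL].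
exists (2 ^+ size (index_enum 'I_p) * \sum_(i < p) K * L).
  by rewrite mulr_ge0 ?exprn_ge0// sumr_ge0// => *; pos.
move=> z i j hz; rewrite mxE; apply: le_trans (nsq_sum_le _ _) _.
rewrite ler_pM2l ?exprn_gt0//; apply: ler_sum => l _; rewrite nsqM.
by apply: ler_pM; rewrite ?nsq_ge0 ?HK ?HL.
Qed.

Lemma ebounded_ctr m p (F : C -> 'M[C]_(m, p)) :
  ebounded F -> ebounded (fun z => ctr (F z)).
Proof.
move=> [K K0 HK]; exists K => // z i j hz; rewrite ctrE nsq_conj; exact: HK.
Qed.

Lemma ebounded_col m p q (F : C -> 'M[C]_(m, q)) (G : C -> 'M[C]_(p, q)) :
  ebounded F -> ebounded G -> ebounded (fun z => col_mx (F z) (G z)).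
Proof.
move=> [K K0 HK] [L L0 HL]; exists (K + L); first by pos.
move=> z i j hz; case: (split_ordP i) => l ->; rewrite ?col_mxEu ?col_mxEd.
  by apply: le_trans (HK z l j hz) _; rewrite lerDl.
by apply: le_trans (HL z l j hz) _; rewrite lerDr.
Qed.

Lemma ebounded_act (V : lmodType C) (rp : V -> V -> R) m p (F : C -> 'M[C]_(m, p)) :
  inner rp -> ebounded F -> exists2 K : R, 0 <= K & forall z (u : vec V p),
    circle z -> vrp rp (act (F z) u) (act (F z) u) <= K * vrp rp u u.
Proof.
move=> hi [K K0 HK]; have hf := inner_sform hi.
exists (\sum_(i < m) 2 ^+ size (index_enum 'I_p) * K).
  by apply: sumr_ge0 => *; pos.
move=> z u hz; rewrite {1}/vrp mulr_suml; apply: ler_sum => i _; rewrite actE.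
apply: le_trans (N_sum_le hi _ _) _; rewrite -mulrA ler_pM2l ?exprn_gt0//.
rewrite /vrp mulr_sumr; apply: ler_sum => j _; rewrite (sf_nsq hf).
by rewrite ler_wpM2r ?HK// N_ge0.
Qed.

Lemma poly_bounded (p : {poly C}) : exists2 K : R, 0 < K &
  forall z, nsq z = 1 -> nsq p.[z] <= K.
Proof.
exists (1 + 2 ^+ size (index_enum 'I_(size p)) * \sum_(i < size p) nsq p`_i).
  by rewrite ltr_pwDl// mulr_ge0 ?exprn_ge0// sumr_ge0// => *; exact: nsq_ge0.
move=> z z1; rewrite horner_coef; apply: le_trans (nsq_sum_le _ _) _.
rewrite ler_wpDl// ler_pM2l ?exprn_gt0//; apply: ler_sum => i _; rewrite nsqM.
have -> : nsq (z ^+ i) = 1; last by rewrite mulr1.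
elim: (nat_of_ord i) => [|j IH]; first by rewrite /nsq /rdot /=; ring.
by rewrite exprS nsqM z1 IH mulr1.
Qed.

Lemma root_distance (w : C) : nsq w != 1 -> exists2 d : R, 0 < d &
  forall z, nsq z = 1 -> d <= nsq (z - w).
Proof.
(* On the circle [|z - w|^2 >= 1 - (e + |w|^2 / e) + |w|^2] for every weight [e]. Taking for [e] the
   mean of 1 and [|w|^2] makes the right-hand side equal to [(1 - |w|^2)^2 / (4 e)]. *)
move=> w1; have w0 := nsq_ge0 w; pose e := (1 + nsq w) / 2.
have e0 : 0 < e by rewrite divr_gt0//; lra.
exists ((1 - nsq w) ^+ 2 / (4 * e)).
  by apply: divr_gt0; [rewrite exprn_even_gt0//= subr_eq0 eq_sym|apply: mulr_gt0].
move=> z z1; have := rdot_weighted z w e0; rewrite z1 mulr1 => H.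
have -> : nsq (z - w) = nsq z - 2 * rdot z w + nsq w.
  by case: z w {z1 w1 w0 e e0 H} => a b [c d]; rewrite /nsq /rdot /=; ring.
rewrite z1; apply: le_trans (_ : 1 - (e + e^-1 * nsq w) + nsq w <= _); last by lra.
rewrite le_eqVlt; apply/orP; left; apply/eqP.
have e1 : 1 + nsq w != 0 by rewrite gt_eqF//; lra.
by rewrite /e; field.
Qed.

Lemma roots_product_bound (rs : seq C) : exists2 c : R, 0 < c &
  forall z, nsq z = 1 ->
  c * \prod_(w <- [seq w <- rs | nsq w == 1]) nsq (z - w) <= \prod_(w <- rs) nsq (z - w).
Proof.
elim: rs => [|w rs [c c0 IH]]; first by exists 1 => // z _; rewrite !big_nil mulr1.
have P0 z (s : seq C) : 0 <= \prod_(v <- s) nsq (z - v).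
  by apply: prodr_ge0 => v _; exact: nsq_ge0.
have [w1|w1] := eqVneq (nsq w) 1.
  exists c => // z z1 /=; rewrite w1 eqxx !big_cons mulrCA.
  by rewrite ler_wpM2l ?nsq_ge0 ?IH.
have [d d0 Hd] := root_distance w1.
exists (d * c); first by pos.
move=> z z1 /=; rewrite (negbTE w1) big_cons -mulrA.
by apply: ler_pM; rewrite ?Hd ?IH// ?mulr_ge0 ?(ltW c0) ?(ltW d0).
Qed.

(** * Rational functions on the circle and lower bounds for densities *)

Section rational.
Variable z0 : C.
Hypothesis hz0 : circle z0.

(* Zeros of [r] on the circle are harmless; [r.[z0] != 0] serves to infer
   [p != 0] from [f z0 != 0]. *)
Definition ratf (f : C -> C) := exists p r : {poly C}, r.[z0] != 0 /\
  forall z, circle z -> f z * r.[z] = p.[z].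

Lemma ratf_eq f g : (forall z, circle z -> f z = g z) -> ratf f -> ratf g.
Proof.
by move=> fg [p [r [r0 H]]]; exists p, r; split=> // z hz; rewrite -fg// H.
Qed.

Lemma ratf_cst c : ratf (fun=> c).
Proof.
by exists c%:P, 1; split=> [|z _]; rewrite !hornerE ?oner_eq0.
Qed.

Lemma ratf_id : ratf id.
Proof. by exists 'X, 1; split=> [|z _]; rewrite !hornerE ?oner_eq0. Qed.

Lemma ratf_add f g : ratf f -> ratf g -> ratf (fun z => f z + g z).
Proof.
move=> [p [r [r0 H]]] [p' [r' [r0' H']]]; exists (p * r' + p' * r), (r * r').
split=> [|z hz]; rewrite !hornerM ?mulf_neq0// hornerD !hornerM -H// -H'//; ring.
Qed.

Lemma ratf_mul f g : ratf f -> ratf g -> ratf (fun z => f z * g z).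
Proof.
move=> [p [r [r0 H]]] [p' [r' [r0' H']]]; exists (p * p'), (r * r').
split=> [|z hz]; rewrite !hornerM ?mulf_neq0// -H// -H'//; ring.
Qed.

Lemma ratf_inv f : (forall z, circle z -> f z != 0) -> ratf f ->
  ratf (fun z => (f z)^-1).
Proof.
move=> f0 [p [r [r0 H]]]; exists r, p; split=> [|z hz]; rewrite -H//.
  by rewrite mulf_neq0 ?f0.
by rewrite mulKf ?f0.
Qed.

Lemma ratf_sum (I : Type) (s : seq I) (F : I -> C -> C) :
  (forall i, ratf (F i)) -> ratf (fun z => \sum_(i <- s) F i z).
Proof.
move=> H; elim: s => [|i s IH].
  by apply: ratf_eq (ratf_cst 0) => z _; rewrite big_nil.
by apply: ratf_eq (ratf_add (H i) IH) => z _; rewrite big_cons.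
Qed.

Lemma ratf_prod (I : Type) (s : seq I) (F : I -> C -> C) :
  (forall i, ratf (F i)) -> ratf (fun z => \prod_(i <- s) F i z).
Proof.
move=> H; elim: s => [|i s IH].
  by apply: ratf_eq (ratf_cst 1) => z _; rewrite big_nil.
by apply: ratf_eq (ratf_mul (H i) IH) => z _; rewrite big_cons.
Qed.

(** The conjugate reciprocal polynomial. On the circle the conjugate of [z] is [1 / z], so
    multiplying by a power of [z] makes the conjugate of [p.[z]] polynomial again; conjugate
    transposes thus stay rational. *)
Definition conj_rev (p : {poly C}) : {poly C} :=
  \poly_(i < size p) Num.conj p`_(size p - i.+1).

Lemma conj_rev_horner p z : circle z ->
  (conj_rev p).[z] = Num.conj p.[z] * z ^+ (size p).-1.
Proof.
move=> hz; rewrite horner_poly horner_coef rmorph_sum mulr_suml.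
rewrite (reindex_inj rev_ord_inj) /=; apply: eq_bigr => i _.
have ip := ltn_ord i.
have -> : (size p - (size p - i.+1).+1)%N = i by rewrite [LHS]subnS subKn.
rewrite rmorphM rmorphXn -mulrA; congr (_ * _).
have -> : (size p).-1 = (i + (size p - i.+1))%N by rewrite -[in LHS](subnKC ip).
by rewrite exprD mulrA -exprMn circle_conj// expr1n mul1r.
Qed.

Lemma ratf_conj f : ratf f -> ratf (fun z => Num.conj (f z)).
Proof.
move=> [p [r [r0 H]]].
exists (conj_rev p * 'X^((size r).-1)), (conj_rev r * 'X^((size p).-1)); split.
  rewrite hornerM hornerXn conj_rev_horner// !mulf_neq0 ?conjC_eq0//;
  by rewrite expf_neq0// circle_neq0.
move=> z hz; rewrite !hornerM !hornerXn !conj_rev_horner// -H// rmorphM; ring.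
Qed.

Definition mxrat m p (F : C -> 'M[C]_(m, p)) := forall i j, ratf (fun z => F z i j).

Lemma mxrat_cst m p (M : 'M[C]_(m, p)) : mxrat (fun=> M).
Proof. by move=> i j; exact: ratf_cst. Qed.

Lemma mxrat_mul m p q (F : C -> 'M[C]_(m, p)) (G : C -> 'M[C]_(p, q)) :
  mxrat F -> mxrat G -> mxrat (fun z => F z *m G z).
Proof.
move=> HF HG i j; have := ratf_sum (index_enum 'I_p) (fun l => ratf_mul (HF i l) (HG l j)).
by apply: ratf_eq => z _; rewrite mxE.
Qed.

Lemma mxrat_ctr m p (F : C -> 'M[C]_(m, p)) : mxrat F -> mxrat (fun z => ctr (F z)).
Proof. by move=> HF i j; apply: ratf_eq (ratf_conj (HF j i)) => z _; rewrite ctrE. Qed.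

Lemma mxrat_col m p q (F : C -> 'M[C]_(m, q)) (G : C -> 'M[C]_(p, q)) :
  mxrat F -> mxrat G -> mxrat (fun z => col_mx (F z) (G z)).
Proof.
move=> HF HG i j; case: (split_ordP i) => l ->.
  by apply: ratf_eq (HF l j) => z _; rewrite col_mxEu.
by apply: ratf_eq (HG l j) => z _; rewrite col_mxEd.
Qed.

Lemma ratf_det m (F : C -> 'M[C]_m) : mxrat F -> ratf (fun z => \det (F z)).
Proof.
move=> HF; rewrite /determinant; apply: ratf_sum => s; apply: ratf_mul.
  exact: ratf_cst.
by apply: ratf_prod => i; exact: HF.
Qed.

Lemma mxrat_inv m (F : C -> 'M[C]_m) : (forall z, circle z -> F z \in unitmx) ->
  mxrat F -> mxrat (fun z => invmx (F z)).
Proof.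
move=> Fu HF i j.
have Hd : ratf (fun z => (\det (F z))^-1).
  by apply: ratf_inv (ratf_det HF) => z /Fu; rewrite unitmxE unitfE.
have Hm : mxrat (fun z => row' j (col' i (F z))).
  by move=> x y; apply: ratf_eq (HF (lift j x) (lift i y)) => z _; rewrite !mxE.
apply: ratf_eq (ratf_mul Hd (ratf_mul (ratf_cst ((-1) ^+ (j + i))) (ratf_det Hm))) => z hz.
by rewrite /invmx Fu// !mxE.
Qed.

Lemma mxrat_transfer n m (A : 'M[C]_n) (B : 'M[C]_(n, m)) :
  (forall s : C, 0 <= Re s -> s%:M - A \in unitmx) ->
  mxrat (fun z => transfer A B (cayley z)).
Proof.
move=> hA; apply: mxrat_mul (mxrat_cst _); apply: mxrat_inv.
  by move=> z hz; rewrite hA// Re_cayley.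
move=> i j.
have Hc : ratf cayley.
  apply: ratf_mul; first exact: ratf_add (ratf_cst 1) ratf_id.
  apply: ratf_inv => [z hz|]; first exact: circle_sub1.
  apply: ratf_eq (ratf_add (ratf_cst 1) (ratf_mul (ratf_cst (-1)) ratf_id)) => z _.
  by rewrite mulN1r.
apply: ratf_eq (ratf_add (ratf_mul Hc (ratf_cst (i == j)%:R)) (ratf_cst (- A i j))) => z _.
by rewrite !mxE mulr_natr.
Qed.

Lemma diagonal_form m (V : 'M[C]_m) (e : 'I_m -> R) (z : 'cV[C]_m) :
  Re ((ctr z *m (ctr V *m diag_mx (\row_i toC (e i)) *m V) *m z) 0 0) =
  \sum_i e i * nsq ((V *m z) i 0).
Proof.
have -> : ctr z *m (ctr V *m diag_mx (\row_i toC (e i)) *m V) *m z =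
    ctr (V *m z) *m (diag_mx (\row_i toC (e i)) *m (V *m z)) by rewrite ctrM !mulmxA.
rewrite [X in Re X]mxE Re_sum; apply: eq_bigr => i _.
rewrite ctrE mul_diag_mx; move: (V *m z) => y; rewrite !mxE mulrCA nsqE.
by rewrite -rmorphM.
Qed.

(* Each eigenvalue is at least the determinant divided by a bound for the
   product of the other ones. *)
Lemma psd_det_bound m (M : 'M[C]_m) (T : R) : 1 <= T -> psd M -> Re (\tr M) <= T ->
  exists D : R, [/\ 0 <= D <= T ^+ m, \det M = toC D &
    forall mu, mu * T ^+ m <= D -> psd (M - (toC mu)%:M)].
Proof.
move=> T1 Mpsd trT; have [V [VV [e e0 ME]]] := psd_spectral Mpsd.
have T0 : 0 <= T by lra.
have VV' : ctr V *m V = 1%:M by exact: mulmx1C.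
have eT i : e i <= T.
  apply: le_trans trT; rewrite ME -mulmxA mxtrace_mulC -mulmxA VV mulmx1 mxtrace_diag.
  rewrite Re_sum (bigD1 i)//= mxE lerDl; by apply: sumr_ge0 => j _; rewrite mxE /= e0.
pose D := \prod_i e i.
have prodT (s : seq 'I_m) : \prod_(i <- s) e i <= T ^+ size s.
  elim: s => [|i s IH]; first by rewrite big_nil.
  rewrite big_cons exprS; apply: ler_pM => //; exact: prodr_ge0.
have sz : size (index_enum 'I_m) = m by rewrite -[RHS]card_ord cardT enumT.
exists D; split.
- by rewrite prodr_ge0//= -[X in _ <= _ ^+ X]sz prodT.
- rewrite ME !det_mulmx mulrAC -det_mulmx VV' det1 mul1r det_diag.
  by rewrite rmorph_prod; apply: eq_bigr => i _; rewrite mxE.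
move=> mu muD.
have emu i : mu <= e i.
  have Tm : 0 < T ^+ m by rewrite exprn_gt0//; lra.
  rewrite -(ler_pM2r Tm); apply: le_trans muD _; rewrite /D (bigD1 i)//=.
  rewrite ler_wpM2l// -big_filter; apply: le_trans (prodT _) _.
  apply: ler_weXn2l => //; rewrite -[X in (_ <= X)%N]sz size_filter; exact: count_size.
have -> : M - (toC mu)%:M = ctr V *m diag_mx (\row_i toC (e i - mu)) *m V.
  have -> : diag_mx (\row_i toC (e i - mu)) = diag_mx (\row_i toC (e i)) - (toC mu)%:M.
    apply/matrixP => i j; rewrite !mxE rmorphB -mulrnBl//.
  by rewrite mulmxBr mulmxBl -ME mul_mx_scalar -scalemxAl VV' scalemx1.
apply: hermitian_psd => [|z].
  rewrite /Defs.hermitian !ctrM ctrK mulmxA; congr (_ *m _ *m _).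
  apply/matrixP => i j; rewrite ctrE !mxE; case: (eqVneq j i) => [->|ji].
    by rewrite !mulr1n conjE conjc_real.
  by rewrite !mulr0n rmorph0.
by rewrite diagonal_form; apply: sumr_ge0 => i _; rewrite mulr_ge0 ?nsq_ge0 ?subr_ge0.
Qed.

Lemma posdef_det m (M : 'M[C]_m) : posdef M -> \det M != 0.
Proof.
case=> _ pd; apply/det0P => -[v v0 vM].
have /pd : ctr v != 0 by apply: contra v0 => /eqP e; rewrite -(ctrK v) e /ctr map_mx0 trmx0.
by rewrite ctrK vM mul0mx mxE ltxx.
Qed.

Lemma density_lower_bound m (F : C -> 'M[C]_m) : mxrat F -> ebounded F ->
  (forall z, circle z -> psd (F z)) -> posdef (F z0) ->
  exists c : R, 0 < c /\ exists2 zs : seq C, {in zs, forall w, nsq w = 1} &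
    forall z, circle z -> psd (F z - (toC (c * \prod_(w <- zs) nsq (z - w)))%:M).
Proof.
move=> HF [K K0 HK] Fpsd Fpd.
have [p [r [r0 rp]]] := ratf_det HF.
have p0 : p != 0.
  apply: contraTneq (mulf_neq0 (posdef_det Fpd) r0) => p0.
  by rewrite rp// p0 horner0 eqxx.
have [rs pE] := closed_field_poly_normal p.
have [c c0 Hc] := roots_product_bound rs.
have [L L0 HL] := poly_bounded r.
pose T : R := 1 + m%:R * (1 + K).
have T1 : 1 <= T by rewrite lerDl; pos.
have T0 : 0 < T by lra.
have trT z : circle z -> Re (\tr (F z)) <= T.
  move=> hz; rewrite /mxtrace Re_sum.
  apply: (@le_trans _ _ (\sum_(i < m) (1 + K))); last first.
    by rewrite sumr_const card_ord -mulr_natl /T lerDr.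
  apply: ler_sum => i _; have := HK z i i hz; case: (F z i i) => a b.
  by rewrite /nsq /rdot /=; nra.
pose l := nsq (lead_coef p).
have l0 : 0 < l by rewrite lt0r nsq_eq0 lead_coef_eq0 p0 nsq_ge0.
(* Factoring the numerator of the determinant bounds [D ^ 2] from below. As [D <= T ^ m], one factor
   [T ^ m] converts [D ^ 2] into [D]; the other is the one required by [psd_det_bound], and [L]
   bounds the denominator. *)
exists (l * c / (L * T ^+ m * T ^+ m)); split.
  by rewrite divr_gt0 ?mulr_gt0 ?exprn_gt0.
exists [seq w <- rs | nsq w == 1]; first by move=> w; rewrite mem_filter => /andP[/eqP].
move=> z hz; have [D [/andP[D0 DT] detD HD]] := psd_det_bound T1 (Fpsd z hz) (trT z hz).
apply: HD; have [z1 _] := hz.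
have := Hc z z1; move: (\prod_(w <- _ | _) _) => pi1 H1.
have pz : nsq p.[z] = l * \prod_(w <- rs) nsq (z - w).
  rewrite {1}pE hornerZ nsqM horner_prod; congr (_ * _).
  elim: (rs) => [|w s IH]; rewrite ?big_nil ?big_cons; first by rewrite /nsq /rdot /=; ring.
  by rewrite nsqM IH !hornerE.
have := congr1 (@nsq R) (rp z hz); rewrite pz detD nsqM.
have -> : nsq (toC D) = D * D by rewrite /nsq /rdot /=; ring.
move=> e; have H2 : l * (c * pi1) <= D * D * L.
  by apply: le_trans (ler_wpM2l (ltW l0) H1) _; rewrite -e ler_wpM2l ?HL ?mulr_ge0.
have H3 : D * D * L <= D * T ^+ m * L by rewrite ler_wpM2r ?(ltW L0)// ler_wpM2l.
have Tm : 0 < T ^+ m by rewrite exprn_gt0.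
have -> : l * c / (L * T ^+ m * T ^+ m) * pi1 * T ^+ m = l * (c * pi1) / (L * T ^+ m).
  by field; rewrite !gt_eqF.
rewrite ler_pdivrMr ?mulr_gt0//; lra.
Qed.

End rational.

Lemma transfer_ebounded n m (A P : 'M[C]_n) (B : 'M[C]_(n, m)) :
  complex_lyapunov A P -> (forall s : C, 0 <= Re s -> s%:M - A \in unitmx) ->
  ebounded (fun z => transfer A B (cayley z)).
Proof.
move=> hP hA; have [K K0 HK] := transfer_bounded (inner_scalar R) hP hA B.
exists K => // z i j hz.
pose u : vec C^o m := [ffun l => (l == j)%:R].
have u1 : vrp (fun z w : C^o => rdot z w) u u = 1.
  rewrite /vrp (bigD1 j)//= big1 ?addr0; last first.
    by move=> l lj; rewrite !ffunE (negbTE lj) /rdot /= !mul0r addr0.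
  by rewrite !ffunE eqxx /rdot /= mul1r mulr0 addr0.
have := (HK _ u (Re_cayley hz)).1; rewrite u1 mulr1; apply: le_trans.
rewrite /vrp (bigD1 i)//= actE.
have -> : \sum_l transfer A B (cayley z) i l *: u l = transfer A B (cayley z) i j.
  rewrite (bigD1 j)//= big1 ?addr0; first by rewrite ffunE eqxx /GRing.scale /= mulr1.
  by move=> l lj; rewrite ffunE (negbTE lj) scaler0.
by rewrite lerDl; apply: sumr_ge0 => l _; exact: nsq_ge0.
Qed.

End unit_circle_functions.

(** * Symbols of shift-invariant operators *)

Section symbols.
Variables (R : realType) (V : lmodType R[i]) (rp : V -> V -> R) (S : V -> V).
Local Notation C := (R[i]).
Local Notation Re := (@complex.Re R).
Local Notation toC r := ((r%:C)%C : R[i]).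
Hypothesis hL : lagged rp S.
Let hi := lagged_inner hL.
Let hiv m := vec_inner hi m.
Let hfv m := inner_sform (hiv m).
Let hLv m := vec_lagged m hL.
Local Notation N x := (vrp rp x x).
Local Notation U := (shift (@vlag R V S _)).

Lemma shift_act p m (M : 'M[C]_(p, m)) (u : vec V m) : U (act M u) = act M (U u).
Proof. by rewrite /shift (vlag_act M u hL) actD actN actD. Qed.

(* [Y] acts like multiplication by [F z] on approximate eigenvectors of the
   shift for the eigenvalue [z], uniformly in [z]. *)
Definition tracks m p (Y : vec V m -> vec V p) (F : C -> 'M[C]_(p, m)) :=
  ebounded F /\ exists2 K : R, 0 <= K & forall z u, circle z ->
    N (Y u - act (F z) u) <= K * N (U u - z *: u).

Lemma tracks_act p m (M : 'M[C]_(p, m)) : tracks (act M) (fun=> M).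
Proof.
split; first exact: ebounded_cst.
by exists 0 => // z u _; rewrite subrr (sf0l (hfv p)) mul0r.
Qed.

Lemma tracks_left p q m (M : 'M[C]_(q, p)) (Y : vec V m -> vec V p) F :
  tracks Y F -> tracks (fun u => act M (Y u)) (fun z => M *m F z).
Proof.
move=> [bF [K K0 HK]]; split; first exact: ebounded_mul (ebounded_cst _) bF.
have [L L0 HL] := act_bounded hi M; exists (L * K); first by pos.
move=> z u hz; rewrite actM -actN -actD; apply: le_trans (HL _) _.
by rewrite -mulrA ler_wpM2l ?HK.
Qed.

Lemma tracks_right p q m (M : 'M[C]_(m, q)) (Y : vec V m -> vec V p) F :
  tracks Y F -> tracks (fun u => Y (act M u)) (fun z => F z *m M).
Proof.
move=> [bF [K K0 HK]]; split; first exact: ebounded_mul bF (ebounded_cst _).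
have [L L0 HL] := act_bounded hi M; exists (K * L); first by pos.
move=> z u hz; rewrite actM; apply: le_trans (HK z _ hz) _.
by rewrite shift_act -actZ -actN -actD -mulrA ler_wpM2l ?HL.
Qed.

Lemma tracks_col p q m (Y : vec V m -> vec V p) F (Y' : vec V m -> vec V q) F' :
  tracks Y F -> tracks Y' F' ->
  tracks (fun u => act (col_mx 1%:M 0) (Y u) + act (col_mx 0 1%:M) (Y' u))
         (fun z => col_mx (F z) (F' z)).
Proof.
move=> tY tY'; split; first exact: ebounded_col tY.1 tY'.1.
have [_ [K K0 HK]] := tracks_left (col_mx 1%:M 0 : 'M[C]_(p + q, p)) tY.
have [_ [L L0 HL]] := tracks_left (col_mx 0 1%:M : 'M[C]_(p + q, q)) tY'.
exists (2 * K + 2 * L); first by pos.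
move=> z u hz.
have -> : act (col_mx (F z) (F' z)) u =
    act (col_mx 1%:M 0 *m F z) u + act (col_mx 0 1%:M *m F' z) u.
  by rewrite -actDl !mul_col_mx !mul1mx !mul0mx add_col_mx addr0 add0r.
rewrite opprD addrACA; apply: le_trans (N_add_le (hiv _) _ _) _.
by have := HK z u hz; have := HL z u hz; lra.
Qed.

Lemma residual_bound m z (u : vec V m) : circle z -> N (U u - z *: u) <= 4 * N u.
Proof.
move=> [z1 _]; apply: le_trans (N_sub_le (hiv m) _ _) _.
by rewrite (shift_rp (hLv m)) (sf_nsq (hfv m)) z1; lra.
Qed.

Lemma circleN1 : circle (-1 : C).
Proof.
split; first by rewrite /nsq /rdot /=; ring.
by rewrite -subr_eq0 -opprD oppr_eq0 -mulr2n pnatr_eq0.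
Qed.

(** Comparison with the constant matrix [F (-1)]: by [residual_bound] the tracking error at any
    point of the circle is at most a multiple of [N u]. *)
Lemma tracks_bounded m p (Y : vec V m -> vec V p) F : tracks Y F ->
  bounded_map (@vrp R V rp m) (@vrp R V rp p) Y.
Proof.
move=> [bF [K K0 HK]]; have [L L0 HL] := ebounded_act hi bF.
exists (2 * (K * 4) + 2 * L); first by pos.
move=> u; have -> : Y u = (Y u - act (F (-1)) u) + act (F (-1)) u by rewrite subrK.
apply: le_trans (N_add_le (hiv p) _ _) _.
have := HK _ u circleN1; have := HL _ u circleN1.
have := ler_wpM2l K0 (residual_bound u circleN1); lra.
Qed.

Lemma tracks_shift m p (Y : vec V m -> vec V p) F w :
  tracks Y F -> {morph Y : x y / x - y} -> (forall c, {morph Y : x / c *: x}) ->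
  (forall u, Y (U u) = U (Y u)) -> nsq w = 1 ->
  tracks (fun u => U (Y u) - w *: Y u) (fun z => (z - w)%:M *m F z).
Proof.
move=> tY YB YZ YU w1; have [bF [K K0 HK]] := tY; split.
  apply: ebounded_mul bF; exists 4 => // z i j [z1 _]; rewrite mxE.
  case: (i == j); last by rewrite mulr0n /nsq /rdot /= mul0r addr0.
  rewrite mulr1n; apply: le_trans (N_sub_le (inner_scalar R) z w) _.
  by rewrite -/(nsq z) -/(nsq w) z1 w1; lra.
have [L L0 HL] := tracks_bounded tY.
exists (2 * L + 8 * K); first by pos.
move=> z u hz.
have -> : U (Y u) - w *: Y u - act ((z - w)%:M *m F z) u =
    Y (U u - z *: u) + (z - w) *: (Y u - act (F z) u).
  by rewrite YB YZ YU actM act_scalar; lmodule.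
apply: le_trans (N_add_le (hiv p) _ _) _; rewrite (sf_nsq (hfv p)).
have zw : nsq (z - w) <= 4.
  apply: le_trans (N_sub_le (inner_scalar R) z w) _.
  by rewrite -/(nsq z) -/(nsq w) w1 (proj1 hz); lra.
have : nsq (z - w) * N (Y u - act (F z) u) <= 4 * (K * N (U u - z *: u)).
  by apply: ler_pM => //; [exact: nsq_ge0|exact: (N_ge0 (hiv p))|exact: HK].
by have := HL (U u - z *: u); lra.
Qed.

(** The quadratic counterpart of [tracks]. The small multiple of [N u] pays for the products of a
    tracked value with a tracking error, which the square of the residual alone does not bound. *)
Definition has_symbol m (q : vec V m -> R) (T : C -> 'M[C]_m) :=
  forall lam, 0 < lam -> exists K, forall z u, circle z ->
    `|q u - vrp rp (act (T z) u) u| <= lam * N u + K * N (U u - z *: u).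

Lemma has_symbol_eq m (q q' : vec V m -> R) T T' : (forall u, q u = q' u) ->
  (forall z, circle z -> T z = T' z) -> has_symbol q T -> has_symbol q' T'.
Proof.
move=> qq TT H lam /H[K HK]; exists K => z u hz.
by rewrite -qq -TT// HK.
Qed.

Lemma has_symbol_tracks m p (Y : vec V m -> vec V p) F (Y' : vec V m -> vec V p) F' :
  tracks Y F -> tracks Y' F' ->
  has_symbol (fun u => vrp rp (Y u) (Y' u)) (fun z => ctr (F' z) *m F z).
Proof.
move=> [bF [K K0 HK]] [bF' [K' K0' HK']] lam l0.
have [L L0 HL] := ebounded_act hi bF; have [L' L0' HL'] := ebounded_act hi bF'.
(* In the products of values and errors the values get the weight [e], costing at most [lam * N u]
   altogether; the errors get [e^-1], which goes into the factor of the residual. *)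
pose e := lam / (L + L' + 1).
have e_den : 0 < L + L' + 1 by lra.
have e0 : 0 < e by rewrite divr_gt0.
have eL : e * (L + L') <= lam.
  by rewrite /e mulrAC ler_pdivrMr// ler_wpM2l ?(ltW l0)//; lra.
exists (K + K' + e^-1 * (K + K')) => z u hz.
pose a := act (F z) u; pose a' := act (F' z) u; pose d := Y u - a; pose d' := Y' u - a'.
have -> : vrp rp (Y u) (Y' u) - vrp rp (act (ctr (F' z) *m F z) u) u =
    vrp rp d d' + vrp rp d a' + vrp rp d' a.
  have key (x y c c' : vec V p) : vrp rp x y - vrp rp c c' =
      vrp rp (x - c) (y - c') + vrp rp (x - c) c' + vrp rp (y - c') c.
    rewrite !(sfDl (hfv p), sfDr (hfv p), sfNl (hfv p), sfNr (hfv p)).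
    by rewrite (sfC (hfv p) y c) (sfC (hfv p) c' c); ring.
  by rewrite actM (vrp_adj hi) ctrK key.
have := inner_abs_weighted (hiv p) d d' ltr01; rewrite invr1 !mul1r => H1.
have ei0 : 0 < e^-1 by rewrite invr_gt0.
have := inner_abs_weighted (hiv p) d a' ei0; rewrite invrK => H2.
have := inner_abs_weighted (hiv p) d' a ei0; rewrite invrK => H3.
have Hd := HK z u hz; have Hd' := HK' z u hz; rewrite -/d in Hd; rewrite -/d' in Hd'.
have Ha := HL z u hz; have Ha' := HL' z u hz; rewrite -/a in Ha; rewrite -/a' in Ha'.
have := ler_wpM2l (ltW ei0) Hd; have := ler_wpM2l (ltW ei0) Hd'.
have := ler_wpM2l (ltW e0) Ha; have := ler_wpM2l (ltW e0) Ha'.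
have Nu := N_ge0 (hiv m) u; have := ler_wpM2r Nu eL.
have tri (x y t : R) : `|x + y + t| <= `|x| + `|y| + `|t|.
  by rewrite (le_trans (ler_normD _ _))// lerD2r ler_normD.
move=> h1 h2 h3 h4 h5; apply: le_trans (tri _ _ _) _.
have := N_ge0 (hiv m) (U u - z *: u); have := N_ge0 (hiv p) a; have := N_ge0 (hiv p) a'.
have := N_ge0 (hiv p) d; have := N_ge0 (hiv p) d'.
have KB : 0 <= K * N (U u - z *: u) by rewrite mulr_ge0// (N_ge0 (hiv m)).
have KB' : 0 <= K' * N (U u - z *: u) by rewrite mulr_ge0// (N_ge0 (hiv m)).
have l0' := mulr_ge0 (ltW l0) Nu.
have eK := mulr_ge0 (ltW ei0) KB; have eK' := mulr_ge0 (ltW ei0) KB'.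
by clear -eK eK' H1 H2 H3 Hd Hd' h1 h2 h3 h4 h5 KB KB' l0'; lra.
Qed.

Lemma has_symbol_lincomb m (a b : R) (q q' : vec V m -> R) T T' :
  has_symbol q T -> has_symbol q' T' ->
  has_symbol (fun u => a * q u + b * q' u) (fun z => toC a *: T z + toC b *: T' z).
Proof.
move=> H H' lam l0; pose e := lam / (`|a| + `|b| + 1).
have ab : 0 < `|a| + `|b| + 1 by rewrite ltr_wpDl// addr_ge0.
have e0 : 0 < e by rewrite divr_gt0.
have eab : (`|a| + `|b|) * e <= lam.
  by rewrite /e mulrA ler_pdivrMr// mulrC ler_wpM2l ?(ltW l0)//; lra.
have [K HK] := H e e0; have [K' HK'] := H' e e0.
exists (`|a| * K + `|b| * K') => z u hz.
rewrite actDl !actZl (sfDl (hfv m) (toC a *: _)) !(sfRl (hfv m)).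
have -> : forall x y s t : R, a * x + b * y - (a * s + b * t) = a * (x - s) + b * (y - t).
  by move=> *; ring.
apply: le_trans (ler_normD _ _) _; rewrite !normrM.
have := ler_wpM2l (normr_ge0 a) (HK z u hz).
have := ler_wpM2l (normr_ge0 b) (HK' z u hz).
have Nu := N_ge0 (hiv m) u; have := ler_wpM2r Nu eab.
by lra.
Qed.

(** Takes the place of Parseval's identity: every frequency inequality reaches the signals through
    it. *)
Theorem symbol_ge0 m (h : vec V m -> vec V m -> R) T : sform h ->
  (forall u, h (U u) (U u) = h u u) -> has_symbol (fun u => h u u) T ->
  (forall z, circle z -> psd (T z)) -> forall u, 0 <= h u u.
Proof.
move=> hh hU hT Tpsd; apply: (invariant_form_ge0 (hLv m) hh hU) => lam l0.
have [K HK] := hT lam l0; exists K => z u z1 zN1.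
have hz : circle z by split.
have := HK z u hz; have := psd_act_ge0 hi (Tpsd z hz) u.
rewrite ler_norml => h1 /andP[]; lra.
Qed.

End symbols.

(** * Response of a stable plant *)

Section plant.
Variables (R : realType) (V : lmodType R[i]) (rp : V -> V -> R) (S : V -> V).
Local Notation C := (R[i]).
Local Notation Re := (@complex.Re R).
Hypothesis hL : lagged rp S.
Let hi := lagged_inner hL.
Let hf := inner_sform hi.
Let hiv m := vec_inner hi m.
Let hfv m := inner_sform (hiv m).
Let hLv m := vec_lagged m hL.
Local Notation N x := (vrp rp x x).
Local Notation vS := (@vlag R V S _).
Local Notation U := (shift (@vlag R V S _)).

Lemma inner_cauchy_schwarz m (x y : vec V m) : vrp rp x y ^+ 2 <= N x * N y.
Proof.
have [x0|x0] := eqVneq (N x) 0; first by rewrite (N_null (hiv m) y x0) x0 expr0n mul0r.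
have Nx : 0 < N x by rewrite lt0r x0 (N_ge0 (hiv m)).
have [r0|r0] := eqVneq (vrp rp x y) 0.
  by rewrite r0 expr0n mulr_ge0// (N_ge0 (hiv m)).
have p0 : 0 < `|vrp rp x y| by rewrite normr_gt0.
have /(inner_abs_weighted (hiv m) x y) : 0 < `|vrp rp x y| / N x by rewrite divr_gt0.
rewrite divfK// invf_div -(real_normK (num_real (vrp rp x y))) => H.
have : `|vrp rp x y| <= N x / `|vrp rp x y| * N y by lra.
by rewrite mulrAC ler_pdivlMr// expr2.
Qed.

Lemma act0 p m (M : 'M[C]_(p, m)) : act M (0 : vec V m) = 0.
Proof. by rewrite -(scale0r 0) actZ scale0r. Qed.

Variable phi : V.
Hypothesis phi_rp : forall x, 2 * rp phi (S x) = rp phi x.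

Variables (n : nat) (A P : 'M[C]_n).
Hypothesis hP : complex_lyapunov A P.
Hypothesis hA : forall s : C, 0 <= Re s -> s%:M - A \in unitmx.

Definition initial (b : 'cV[C]_n) : vec V n := [ffun i => b i 0 *: phi].

(* [x' = A x + f], [x 0 = b], with [S] the inverse of [1 + d/dt] at initial value
   zero and [phi] its impulse response [exp (- t)]. *)
Definition is_response (f : vec V n) (b : 'cV[C]_n) (x : vec V n) :=
  x = vS (x + act A x + f) + initial b.

Hypothesis solvable : forall f b, exists x, is_response f b x.

Lemma initialD b c : initial (b + c) = initial b + initial c.
Proof. by apply/ffunP => i; rewrite vecD !ffunE mxE scalerDl. Qed.

Lemma initialZ c b : initial (c *: b) = c *: initial b.
Proof. by apply/ffunP => i; rewrite vecZ !ffunE mxE scalerA. Qed.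

Lemma initial0 : initial 0 = 0.
Proof. by rewrite -(scale0r 0) initialZ scale0r. Qed.

Lemma initial_act (M : 'M[C]_n) b : act M (initial b) = initial (M *m b).
Proof.
apply/ffunP => i; rewrite actE ffunE mxE scaler_suml; apply: eq_bigr => j _.
by rewrite ffunE scalerA.
Qed.

Lemma initial_rp b y : 2 * vrp rp (initial b) (vS y) = vrp rp (initial b) y.
Proof.
rewrite /vrp mulr_sumr; apply: eq_bigr => i _.
by rewrite !ffunE !(sfZl hf) -(laggedZ hL) phi_rp.
Qed.

Lemma lag_energy (y : vec V n) : vrp rp (act P (vS y)) (y - vS y) = 0.
Proof.
have Ph : ctr P = P by case: hP => -[].
have := lagged_rp (hLv n) (act P y) y; rewrite (vlag_act P y hL).
rewrite (vrp_adj hi P y (vS y)) Ph (sfC (hfv n) y).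
by rewrite (sfDr (hfv n)) (sfNr (hfv n)); lra.
Qed.

Lemma response_bound : exists2 K : R, 0 <= K &
  forall f x, is_response f 0 x -> N x <= K * N f.
Proof.
have [K K0 HK] := energy_bound hi hP; exists K => // f x; rewrite /is_response.
rewrite initial0 addr0 => e; apply: HK.
have := lag_energy (x + act A x + f); rewrite -e.
by have -> : x + act A x + f - x = act A x + f by lmodule.
Qed.

Lemma response_lin f b x g c y z : is_response f b x -> is_response g c y ->
  is_response (f + z *: g) (b + z *: c) (x + z *: y).
Proof.
rewrite /is_response => ex ey; rewrite {1}ex {1}ey initialD initialZ.
have -> : x + z *: y + act A (x + z *: y) + (f + z *: g) =
    (x + act A x + f) + z *: (y + act A y + g) by rewrite actD actZ; lmodule.
by rewrite (laggedD (hLv n) _ (z *: _)) (laggedZ (hLv n)); lmodule.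
Qed.

(** The energy estimate only shows that the difference is null. But the difference is also the lag
    of a null vector, hence zero by [lagged_null]. *)
Lemma response_unique f b x y : is_response f b x -> is_response f b y -> x = y.
Proof.
move=> ex ey; have := response_lin (-1) ex ey.
rewrite !scaleN1r !subrr => ed; apply/eqP; rewrite -subr_eq0; apply/eqP.
have [K K0 HK] := response_bound; have := HK _ _ ed.
rewrite (sf0l (hfv n)) mulr0 => d0.
have {}d0 : N (x - y) = 0 by apply/eqP; rewrite eq_le d0 (N_ge0 (hiv n)).
rewrite ed initial0 !addr0; apply: (lagged_null (hLv n)).
have [L L0 HL] := act_bounded hi A.
have := HL (x - y); rewrite d0 mulr0 => Ad.
apply/eqP; rewrite eq_le (N_ge0 (hiv n)) andbT.
by apply: le_trans (N_add_le (hiv n) _ _) _; rewrite d0; lra.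
Qed.

Definition response f b := sval (cid (solvable f b)).

Lemma responseP f b : is_response f b (response f b).
Proof. exact: (svalP (cid (solvable f b))). Qed.

Lemma response_linE f b g c z :
  response (f + z *: g) (b + z *: c) = response f b + z *: response g c.
Proof.
exact: response_unique (responseP _ _) (response_lin _ (responseP _ _) (responseP _ _)).
Qed.

Lemma response0 : response 0 0 = 0.
Proof.
apply: response_unique (responseP _ _) _.
rewrite /is_response initial0 !addr0 act0 addr0.
by rewrite (lag_zero (hLv n)).
Qed.

Lemma responseD f g b c : response (f + g) (b + c) = response f b + response g c.
Proof. by have := response_linE f b g c 1; rewrite !scale1r. Qed.

Lemma responseZ z f b : response (z *: f) (z *: b) = z *: response f b.
Proof. by have := response_linE 0 0 f b z; rewrite !add0r response0 add0r. Qed.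

Lemma responseN f b : response (- f) (- b) = - response f b.
Proof. by rewrite -scaleN1r -(scaleN1r b) responseZ scaleN1r. Qed.

Lemma response_lag f : response (vS f) 0 = vS (response f 0).
Proof.
apply: response_unique (responseP _ _) _; rewrite /is_response initial0 addr0.
have e := responseP f 0; rewrite /is_response initial0 addr0 in e.
by rewrite {1}e -(vlag_act A _ hL) -!(laggedD (hLv n)).
Qed.

Lemma response_shift f : response (U f) 0 = U (response f 0).
Proof.
have := responseD f (- (vS f + vS f)) 0 0; rewrite addr0 => ->.
have := responseN (vS f + vS f) 0; rewrite oppr0 => ->.
by have := responseD (vS f) (vS f) 0 0; rewrite addr0 => ->; rewrite response_lag.
Qed.

Lemma response_act M f b : M *m A = A *m M ->
  response (act M f) (M *m b) = act M (response f b).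
Proof.
move=> MA; apply: response_unique (responseP _ _) _; rewrite /is_response -initial_act.
have e := responseP f b; rewrite /is_response in e.
by rewrite {1}e actD -(vlag_act M _ hL) !actD -!actM MA.
Qed.

Section inputs.
Variables (m : nat) (B : 'M[C]_(n, m)).

(* With [s = cayley z], [G] the transfer matrix at [s] and [beta = U u - z u],
   the frequency response [G u] misses being the response to [u] by
   [r = G beta / (1 - z)], and [(s + 1) = 2 / (1 - z)] keeps [r] bounded. *)
Lemma tracks_response : tracks rp S (fun u : vec V m => response (act B u) 0)
  (fun z => transfer A B (cayley z)).
Proof.
split; first exact: transfer_ebounded hP hA.
have [K K0 HK] := response_bound.
have [L L0 HL] := transfer_bounded hi hP hA B.
have [M M0 HM] := act_bounded hi A.
exists (2 * (K * (2 * L + 2 * (M * L))) + 2 * L); first by pos.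
move=> z u hz; set x := response _ _; set s := cayley z; set G := transfer A B s.
pose beta := U u - z *: u; pose rho := (1 - z)^-1.
have z1 := circle_sub1 hz; have s0 : Re s = 0 by exact: Re_cayley.
have two : (1 + 1 : C) != 0 by rewrite -mulr2n pnatr_eq0.
have rhoE : rho = (1 + 1)^-1 * (s + 1).
  rewrite /rho /s /cayley; field.
  exact: z1.
have rz : rho * (1 - z) = 1 by rewrite mulVf.
have e := responseP (act B u) 0; rewrite /is_response initial0 addr0 -/x in e.
pose r := rho *: act G beta.
have rE : r = act G u - vS (act G u + (act A (act G u) + act B u)).
  rewrite (transfer_eq hA B u s0) -/G (laggedD (hLv n)) (laggedZ (hLv n)) (vlag_act G u hL).
  rewrite /r /beta /shift !(actD, actN, actZ).
  have -> : forall a b : vec V n, rho *: (a - (b + b) - z *: a) =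
      (rho * (1 - z)) *: a - (rho * (1 + 1)) *: b by move=> a b; lmodule.
  have -> : rho * (1 + 1) = s + 1 by rewrite rhoE mulrAC mulVf// mul1r.
  by rewrite rz; lmodule.
have ed : is_response (- (r + act A r)) 0 (x - act G u + r).
  rewrite /is_response initial0 addr0 {1}e {1}rE.
  rewrite [LHS](_ : _ = vS (x + act A x + act B u) -
      vS (act G u + (act A (act G u) + act B u))); last by lmodule.
  rewrite -(lagB (hLv n)); congr (vS _); rewrite !(actD, actN); lmodule.
have Nr : N r <= L * N beta.
  have [g1 g2] := HL s beta s0; rewrite -/G in g1 g2.
  have -> : r = (1 + 1)^-1 *: (s *: act G beta + act G beta).
    by rewrite /r rhoE; lmodule.
  rewrite (sf_nsq (hfv n)).
  have -> : nsq ((1 + 1)^-1 : C) = 4^-1.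
    have := nsqM ((1 + 1)^-1) (1 + 1 : C); rewrite mulVf//.
    have -> : nsq (1 : C) = 1 by rewrite /nsq /rdot /=; ring.
    have -> : nsq (1 + 1 : C) = 4 by rewrite /nsq /rdot /=; ring.
    by lra.
  by have := N_add_le (hiv n) (s *: act G beta) (act G beta); lra.
have H1 := HK _ _ ed; rewrite (N_opp (hiv n)) in H1.
have H2 := N_add_le (hiv n) r (act A r); have H3 := HM r.
have -> : x - act G u = (x - act G u + r) - r by rewrite addrK.
apply: le_trans (N_sub_le (hiv n) _ _) _; rewrite -/beta.
have H4 := ler_wpM2l M0 Nr.
have : K * N (r + act A r) <= K * (2 * (L * N beta) + 2 * (M * (L * N beta))).
  by rewrite ler_wpM2l//; lra.
by lra.
Qed.

Definition output (u : vec V m) : vec V (n + m) :=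
  act (col_mx 1%:M 0) (response (act B u) 0) + act (col_mx 0 1%:M) u.

Definition free_output (b : 'cV[C]_n) : vec V (n + m) :=
  act (col_mx 1%:M 0) (response 0 b).

Definition plant_symbol (z : C) : 'M[C]_(n + m, m) :=
  col_mx (transfer A B (cayley z)) 1%:M.

Lemma tracks_output : tracks rp S output plant_symbol.
Proof.
have t1 : tracks rp S (fun u : vec V m => u) (fun=> 1%:M).
  have [b [K K0 HK]] := tracks_act hL (1%:M : 'M[C]_m).
  by split=> //; exists K => // z u hz; have := HK z u hz; rewrite !act1.
exact: (tracks_col hL tracks_response t1).
Qed.

Lemma outputD u v : output (u + v) = output u + output v.
Proof.
rewrite /output actD; have := responseD (act B u) (act B v) 0 0; rewrite addr0 => ->.
by rewrite !actD addrACA.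
Qed.

Lemma outputZ c u : output (c *: u) = c *: output u.
Proof.
rewrite /output actZ; have := responseZ c (act B u) 0; rewrite scaler0 => ->.
by rewrite !actZ scalerDr.
Qed.

Lemma output_shift u : output (U u) = U (output u).
Proof.
rewrite /output -(shift_act hL) response_shift (shiftD (hLv _)).
by rewrite !(shift_act hL).
Qed.

(** Free responses are stable under the adjoint of the lag: pairing the response equation with [S y]
    shows that the adjoint sends the response of [c - A c] to that of [c]. So the adjoint of [U]
    sends it to the response of [- (c + A c)]. Starting from [c - A c] avoids inverting [1 - A]. *)
Lemma response_adjoint c (y : vec V n) :
  vrp rp (response 0 (c - A *m c)) (U y) = vrp rp (response 0 (- (c + A *m c))) y.
Proof.
pose w := response 0 c.
have hw : is_response 0 c w := responseP 0 c.
have Aw : response 0 (A *m c) = act A w.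
  by rewrite -(response_act 0 c (erefl (A *m A))) act0.
have -> : response 0 (c - A *m c) = w - act A w.
  have := responseD 0 0 c (- (A *m c)); rewrite addr0 => ->; congr (_ + _).
  by have := responseN 0 (A *m c); rewrite oppr0 Aw.
have -> : response 0 (- (c + A *m c)) = - (w + act A w).
  have := responseN 0 (c + A *m c); rewrite oppr0 => ->; congr (- _).
  by have := responseD 0 0 c (A *m c); rewrite addr0 Aw.
have key : 2 * vrp rp w (vS y) = vrp rp (w + act A w) (vS y) + vrp rp w y.
  rewrite {1 4}hw addr0 !(sfDl (hfv n) (vS _)) mulrDr initial_rp (lagged_rp (hLv n)).
  by rewrite -addrA.
rewrite /shift (sfDr (hfv n)) (sfNr (hfv n)) (sfDr (hfv n)).
rewrite !(sfNl (hfv n)) !(sfDl (hfv n)) !(sfNl (hfv n)) in key *.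
by lra.
Qed.

Variable Q : 'M[C]_(n + m).

Definition coupling b u := vrp rp (act Q (free_output b)) (output u).

Lemma couplingE b u :
  coupling b u = vrp rp (response 0 b) (act (ctr (Q *m col_mx 1%:M 0)) (output u)).
Proof. by rewrite /coupling /free_output -actM (vrp_adj hi). Qed.

Lemma coupling_bound b : exists2 K : R, 0 <= K &
  forall u, coupling b u ^+ 2 <= K * N u.
Proof.
have [K K0 HK] := tracks_bounded hL tracks_output.
exists (N (act Q (free_output b)) * K); first by rewrite mulr_ge0 ?(N_ge0 (hiv _)).
move=> u; apply: le_trans (inner_cauchy_schwarz _ _) _; rewrite -mulrA.
by rewrite ler_wpM2l ?(N_ge0 (hiv _))// HK.
Qed.

(* A factor [U - w] on the input can be traded for another initial state: by
   [response_adjoint], [U^* - conj w] acts on free responses as a Moebius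
   transform of [A], which is invertible as [A] is Hurwitz. *)
Lemma coupling_shift (w : C) (a : 'cV[C]_n) : nsq w = 1 ->
  exists b, forall u, coupling b (U u - w *: u) = coupling a u.
Proof.
move=> w1; pose v := Num.conj w.
(* The equation reads [- (1 + v) c - (1 - v) A c = a]. If [v = 1], a case that zeros at infinite
   frequency produce, [A] drops out. Otherwise it is a resolvent equation at [s = - cayley v], on
   the imaginary axis. *)
have [c ce] : exists c : 'cV[C]_n, - (c + A *m c) - v *: (c - A *m c) = a.
  have two : (1 + 1 : C) != 0 by rewrite -mulr2n pnatr_eq0.
  have [wv|wv] := eqVneq v 1.
    exists (- (1 + 1)^-1 *: a); rewrite wv -scalemxAr.
    rewrite [LHS](_ : _ = ((1 + 1)^-1 * (1 + 1)) *: a); last by lmodule.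
    by rewrite mulVf// scale1r.
  have hv : circle v by split; rewrite /v ?nsq_conj.
  have v1 := circle_sub1 hv; pose s := - cayley v.
  have s0 : 0 <= Re s by have := Re_cayley hv; rewrite /s; case: (cayley v) => x y /= ->; lra.
  have := mulKVmx (hA s0) a; set d := invmx _ *m a => de.
  exists ((1 - v)^-1 *: d).
  have sv : (1 - v)^-1 * (1 + v) = - s by rewrite /s opprK /cayley mulrC.
  have vv : (1 - v)^-1 * (1 - v) = 1 by rewrite mulVf.
  rewrite -de mulmxBl mul_scalar_mx -scalemxAr.
  rewrite [LHS](_ : _ = - ((1 - v)^-1 * (1 + v)) *: d - ((1 - v)^-1 * (1 - v)) *: (A *m d)).
    by rewrite sv vv opprK scale1r.
  by move: (A *m d) (_^-1) => Ad r; lmodule.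
exists (c - A *m c) => u.
rewrite !couplingE outputD -scaleN1r outputZ scaleN1r outputZ output_shift actD actN actZ.
rewrite -(shift_act hL) (sfDr (hfv n)) (sfNr (hfv n)) response_adjoint.
rewrite (sfZr (hfv n)) -/v -ce.
have := responseD 0 0 (- (c + A *m c)) (- (v *: (c - A *m c))); rewrite addr0 => ->.
have := responseN 0 (v *: (c - A *m c)); rewrite oppr0 => ->.
have := responseZ v 0 (c - A *m c); rewrite scaler0 => ->.
by rewrite (sfDl (hfv n) (response 0 (- _))) (sfNl (hfv n) (v *: _)).
Qed.

End inputs.

Definition shift_poly m (zs : seq C) (u : vec V m) : vec V m :=
  foldr (fun w y => U y - w *: y) u zs.

Lemma shift_polyD m zs (u v : vec V m) :
  shift_poly zs (u + v) = shift_poly zs u + shift_poly zs v.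
Proof. by elim: zs => //= w zs ->; rewrite (shiftD (hLv m)); lmodule. Qed.

Lemma shift_polyZ m zs c (u : vec V m) : shift_poly zs (c *: u) = c *: shift_poly zs u.
Proof. by elim: zs => //= w zs ->; rewrite (shiftZ (hLv m)); lmodule. Qed.

Lemma shift_polyB m zs (u v : vec V m) :
  shift_poly zs (u - v) = shift_poly zs u - shift_poly zs v.
Proof. by rewrite shift_polyD -scaleN1r shift_polyZ scaleN1r. Qed.

Lemma shift_poly_shift m zs (u : vec V m) : shift_poly zs (U u) = U (shift_poly zs u).
Proof.
by elim: zs => //= w zs ->; rewrite (shiftB (hLv m)) (shiftZ (hLv m)).
Qed.

Lemma shift_poly_act m p zs (M : 'M[C]_(p, m)) (u : vec V m) :
  shift_poly zs (act M u) = act M (shift_poly zs u).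
Proof. by elim: zs => //= w zs ->; rewrite (shift_act hL) -actZ -actN -actD. Qed.

Lemma tracks_shift_poly m zs : {in zs, forall w, nsq w = 1} ->
  tracks rp S (@shift_poly m zs) (fun z => (\prod_(w <- zs) (z - w))%:M).
Proof.
elim: zs => [|w zs IH] hz.
  have [b [K K0 HK]] := tracks_act hL (1%:M : 'M[C]_m).
  split; first by have -> : (fun z : C => (\prod_(w <- [::]) (z - w))%:M) = (fun=> 1%:M : 'M[C]_m);
     [apply/funext => z; rewrite big_nil|].
  by exists K => // z u hu; rewrite big_nil; have := HK z u hu; rewrite !act1.
have t := IH (fun v vz => hz v (mem_behead (s := w :: zs) vz)).
have := tracks_shift hL t (shift_polyB zs) (shift_polyZ zs) (shift_poly_shift zs)
  (hz w (mem_head _ _)).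
rewrite [X in tracks _ _ _ X -> _](_ : _ = (fun z => (\prod_(v <- w :: zs) (z - v))%:M))//.
by apply/funext => z; rewrite big_cons mul_scalar_mx scale_scalar_mx.
Qed.

Lemma sform_pull m p (h : vec V p -> vec V p -> R) (T : vec V m -> vec V p) :
  sform h -> {morph T : x y / x + y} -> (forall c, {morph T : x / c *: x}) ->
  sform (fun x y => h (T x) (T y)).
Proof.
move=> hh TD TZ; split=> [x y|x y z|c x y|r x y].
- by rewrite (sfC hh).
- by rewrite TD (sfDl hh).
- by rewrite !TZ (sfZl hh).
- by rewrite TZ (sfRl hh).
Qed.

(** [symbol_ge0] is applied to the difference of the two sides, whose symbol is [F] minus the scalar
    bound of [density_lower_bound]. *)
Lemma form_lower_bound m (h : vec V m -> vec V m -> R) F z0 : circle z0 -> sform h ->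
  (forall u, h (U u) (U u) = h u u) -> has_symbol rp S (fun u => h u u) F ->
  mxrat z0 F -> ebounded F -> (forall z, circle z -> psd (F z)) -> posdef (F z0) ->
  exists c : R, 0 < c /\ exists2 zs : seq C, {in zs, forall w, nsq w = 1} &
    forall u, c * N (shift_poly zs u) <= h u u.
Proof.
move=> hz0 hh hU hF rF bF Fpsd Fpd.
have [c [c0 [zs zs1 Hpsd]]] := density_lower_bound hz0 rF bF Fpsd Fpd.
exists c; split=> //; exists zs => // u.
have t := tracks_shift_poly m zs1.
have hN : sform (fun x y : vec V m => vrp rp (shift_poly zs x) (shift_poly zs y)).
  exact: sform_pull (hfv m) (shift_polyD zs) (shift_polyZ zs).
have := symbol_ge0 hL (sform_lincomb 1 (- c) hh hN) _
  (has_symbol_lincomb hL 1 (- c) hF (has_symbol_tracks hL t t)).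
move=> /(_ _ _ u); rewrite mul1r mulNr subr_ge0; apply.
  by move=> v; rewrite hU shift_poly_shift (shift_rp (hLv m)).
move=> z hz; have := Hpsd z hz; congr psd.
rewrite rmorph1 scale1r; congr (_ + _).
have -> : \prod_(w <- zs) nsq (z - w) = nsq (\prod_(w <- zs) (z - w)).
  elim: (zs) => [|w s IH]; rewrite ?big_nil ?big_cons ?nsqM ?IH//.
  by rewrite /nsq /rdot /=; ring.
rewrite ctr_scalar -scalar_mxM nsqE scale_scalar_mx -rmorphM mulNr rmorphN.
by rewrite raddfN.
Qed.

Lemma coupling_controlled m (B : 'M[C]_(n, m)) Q k (E : 'M[C]_(m, k))
    (h : vec V k -> vec V k -> R) F z0 (a : 'cV[C]_n) : circle z0 -> sform h ->
  (forall u, h (U u) (U u) = h u u) -> has_symbol rp S (fun u => h u u) F ->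
  mxrat z0 F -> ebounded F -> (forall z, circle z -> psd (F z)) -> posdef (F z0) ->
  exists2 K : R, 0 <= K & forall u, coupling B Q a (act E u) ^+ 2 <= K * h u u.
Proof.
move=> hz0 hh hU hF rF bF Fpsd Fpd.
have [c [c0 [zs zs1 Hc]]] := form_lower_bound hz0 hh hU hF rF bF Fpsd Fpd.
(* Each root costs one change of initial state, so after finitely many changes the coupling sees [u]
   only through [shift_poly zs u], which [h] controls. *)
have [b Hb] : exists b, forall u, coupling B Q b (shift_poly zs u) = coupling B Q a u.
  elim: zs zs1 {Hc} => [|w zs IH] zs1; first by exists a.
  have [b0 Hb0] := IH (fun v vz => zs1 v (mem_behead (s := w :: zs) vz)).
  have [b Hb] := coupling_shift B Q b0 (zs1 w (mem_head _ _)).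
  by exists b => u; rewrite /= Hb Hb0.
have [K K0 HK] := coupling_bound B Q b.
have [L L0 HL] := act_bounded hi E.
exists (K * L / c); first by rewrite divr_ge0 ?mulr_ge0// ltW.
move=> u; rewrite -Hb; apply: le_trans (HK _) _; rewrite shift_poly_act.
rewrite -!mulrA ler_wpM2l//; apply: le_trans (HL _) _; rewrite ler_wpM2l//.
by rewrite ler_pdivlMl.
Qed.

End plant.

(** * Quadratic games *)

Section quadratic_games.
Variable R : realType.

Definition real_linear (X : lmodType R) (f : X -> R) :=
  forall x y t, f (x + t *: y) = f x + t * f y.

(* Pay-off [c + 2 l1 v + 2 l2 w + q1 v v + 2 b v w - q2 w w]; the last three
   fields say that [l1], [l2], [b] are bounded for the seminorms [q1], [q2]. *)
Record quadratic_game (V W : lmodType R) := QuadraticGame {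
  qg_c : R; qg_l1 : V -> R; qg_l2 : W -> R;
  qg_q1 : V -> V -> R; qg_q2 : W -> W -> R; qg_b : V -> W -> R; qg_K : R;
  qg_l1_lin : real_linear qg_l1; qg_l2_lin : real_linear qg_l2;
  qg_q1_lin : forall z, real_linear (qg_q1 ^~ z);
  qg_q2_lin : forall z, real_linear (qg_q2 ^~ z);
  qg_b_linl : forall w, real_linear (qg_b ^~ w);
  qg_b_linr : forall v, real_linear (qg_b v);
  qg_q1_sym : forall x y, qg_q1 x y = qg_q1 y x;
  qg_q2_sym : forall x y, qg_q2 x y = qg_q2 y x;
  qg_q1_ge0 : forall x, 0 <= qg_q1 x x;
  qg_q2_ge0 : forall x, 0 <= qg_q2 x x;
  qg_K_ge0 : 0 <= qg_K;
  qg_l1_le : forall v, qg_l1 v ^+ 2 <= qg_K * qg_q1 v v;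
  qg_l2_le : forall w, qg_l2 w ^+ 2 <= qg_K * qg_q2 w w;
  qg_b_le : forall v w, qg_b v w ^+ 2 <= qg_K * qg_q1 v v * qg_q2 w w }.

Definition payoff V W (G : quadratic_game V W) (v : V) (w : W) : R :=
  qg_c G + 2 * qg_l1 G v + 2 * qg_l2 G w + qg_q1 G v v + 2 * qg_b G v w - qg_q2 G w w.

Lemma real_linearN (X : lmodType R) (f : X -> R) : real_linear f ->
  real_linear (fun x => - f x).
Proof. by move=> fl x y t; rewrite fl; ring. Qed.

(** Exchanging the players and the sign of the pay-off, so that facts about [lower] are facts about
    [upper]. *)
Definition flip V W (G : quadratic_game V W) : quadratic_game W V.
Proof.
refine (@QuadraticGame W V (- qg_c G) (fun w => - qg_l2 G w) (fun v => - qg_l1 G v)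
  (qg_q2 G) (qg_q1 G) (fun w v => - qg_b G v w) (qg_K G) _ _ _ _ _ _ _ _ _ _ _ _ _ _).
- exact: real_linearN (qg_l2_lin G).
- exact: real_linearN (qg_l1_lin G).
- exact: qg_q2_lin.
- exact: qg_q1_lin.
- by move=> v; exact: real_linearN (qg_b_linr G v).
- by move=> w; exact: real_linearN (qg_b_linl G w).
- exact: qg_q2_sym.
- exact: qg_q1_sym.
- exact: qg_q2_ge0.
- exact: qg_q1_ge0.
- exact: qg_K_ge0.
- by move=> w; rewrite sqrrN; exact: qg_l2_le.
- by move=> v; rewrite sqrrN; exact: qg_l1_le.
- by move=> w v; rewrite sqrrN mulrAC; exact: qg_b_le.
Defined.

Lemma payoff_flip V W (G : quadratic_game V W) v w :
  payoff (flip G) w v = - payoff G v w.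
Proof. by rewrite /payoff /=; ring. Qed.

Definition upper V W (G : quadratic_game V W) (v : V) : R := sup (range (payoff G v)).
Definition lower V W (G : quadratic_game V W) (w : W) : R :=
  inf (range (fun v => payoff G v w)).

Section theory.
Variables (V W : lmodType R) (G : quadratic_game V W).
Local Notation l1 := (qg_l1 G). Local Notation l2 := (qg_l2 G).
Local Notation q1 := (qg_q1 G). Local Notation q2 := (qg_q2 G).
Local Notation b := (qg_b G). Local Notation K := (qg_K G).
Local Notation g := (payoff G).

Lemma q1_move x t y : q1 (x + t *: y) (x + t *: y) =
  q1 x x + 2 * t * q1 x y + t ^+ 2 * q1 y y.
Proof.
rewrite (qg_q1_lin G) !(qg_q1_sym G _ (x + t *: y)) !(qg_q1_lin G).
by rewrite (qg_q1_sym G y x); ring.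
Qed.

Lemma q2_move x t y : q2 (x + t *: y) (x + t *: y) =
  q2 x x + 2 * t * q2 x y + t ^+ 2 * q2 y y.
Proof.
rewrite (qg_q2_lin G) !(qg_q2_sym G _ (x + t *: y)) !(qg_q2_lin G).
by rewrite (qg_q2_sym G y x); ring.
Qed.

Lemma q1_0 z : q1 0 z = 0.
Proof. by have := qg_q1_lin G z 0 0 1; rewrite scaler0 addr0; lra. Qed.

Lemma q1_scale t z : q1 (t *: z) (t *: z) = t ^+ 2 * q1 z z.
Proof. by have := q1_move 0 t z; rewrite add0r !q1_0 mulr0 !add0r. Qed.

Lemma q1_opp z : q1 (- z) (- z) = q1 z z.
Proof. by rewrite -scaleN1r q1_scale sqrrN expr1n mul1r. Qed.

Definition slope1 v w h := l1 h + q1 v h + b h w.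
Definition slope2 v w k := l2 k + b v k - q2 w k.

Lemma payoff_move1 v w t h :
  g (v + t *: h) w = g v w + 2 * t * slope1 v w h + t ^+ 2 * q1 h h.
Proof.
by rewrite /payoff /slope1 q1_move (qg_l1_lin G) (qg_b_linl G); ring.
Qed.

Lemma payoff_move2 v w s k :
  g v (w + s *: k) = g v w + 2 * s * slope2 v w k - s ^+ 2 * q2 k k.
Proof.
by rewrite /payoff /slope2 q2_move (qg_l2_lin G) (qg_b_linr G); ring.
Qed.

(** With [p = 2 K (1 + q1 v v)], the bounds on [l2] and [b] give [(l2 w + b v w) ^ 2 <= p * q2 w w],
    hence [2 (l2 w + b v w) <= p + q2 w w]: the concave term compensates everything linear in
    [w]. *)
Lemma payoff_upper_bound v w : g v w <=
  qg_c G + 2 * l1 v + q1 v v + 2 * K * (1 + q1 v v).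
Proof.
have E : 2 * (l2 w + b v w) <= q2 w w + 2 * K * (1 + q1 v v).
  have h1 := qg_l2_le G w; have h2 := qg_b_le G v w.
  have q10 := qg_q1_ge0 G v; have q20 := qg_q2_ge0 G w; have K0 := qg_K_ge0 G.
  pose p := 2 * K * (1 + q1 v v).
  have p0 : 0 <= p by rewrite !mulr_ge0// addr_ge0.
  have : (l2 w + b v w) ^+ 2 <= p * q2 w w.
    by have := sqr_ge0 (l2 w - b v w); move: h1 h2; rewrite /p !expr2; lra.
  rewrite -/p; move: (l2 w + b v w) => x.
  move=> Hx; rewrite leNgt; apply/negP => Hlt.
  have : (q2 w w + p) ^+ 2 < (2 * x) ^+ 2 by rewrite ltr_pXn2r// nnegrE; lra.
  by have := sqr_ge0 (q2 w w - p); move: Hx; rewrite !expr2; lra.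
by rewrite /payoff; lra.
Qed.

Lemma upper_has_sup v : has_sup (range (g v)).
Proof.
split; first by exists (g v 0); exists 0.
exists (qg_c G + 2 * l1 v + q1 v v + 2 * K * (1 + q1 v v)) => _ [w _ <-].
exact: payoff_upper_bound.
Qed.

Lemma le_upper v w : g v w <= upper G v.
Proof. by apply: ub_le_sup; [case: (upper_has_sup v)|exists w]. Qed.

Lemma upper_le v M : (forall w, g v w <= M) -> upper G v <= M.
Proof.
by move=> H; apply: ge_sup => [|_ [w _ <-]//]; case: (upper_has_sup v).
Qed.

Lemma upper_convex x h t : 0 <= t <= 1 ->
  upper G (x + t *: h) <= (1 - t) * upper G x + t * upper G (x + h).
Proof.
move=> /andP[t0 t1]; apply: upper_le => w.
have h1 := ler_wpM2l (_ : 0 <= 1 - t) (le_upper x w).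
have h2 := ler_wpM2l t0 (le_upper (x + h) w).
have e : x + h = x + 1 *: h by rewrite scale1r.
rewrite {1}e payoff_move1 in h2; rewrite payoff_move1.
have : t ^+ 2 * q1 h h <= t * q1 h h.
  by rewrite ler_wpM2r ?qg_q1_ge0// expr2 ler_piMl.
have {}h1 : (1 - t) * g x w <= (1 - t) * upper G x by apply: h1; lra.
lra.
Qed.

(* A convex function bounded above near a point is continuous there. *)
Lemma upper_continuous x e : 0 < e -> exists2 d : R, 0 < d &
  forall h, q1 h h <= d -> `|upper G (x + h) - upper G x| < e.
Proof.
move=> e0; have K0 := qg_K_ge0 G; have qx0 := qg_q1_ge0 G x.
pose M := `|qg_c G| + (2 * `|l1 x| + 1 + K) + (2 + 2 * K) * (1 + 2 * (1 + q1 x x)).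
have HM h : q1 h h <= 1 -> upper G (x + h) <= M.
  move=> h1; have qh0 := qg_q1_ge0 G h.
  have e1 : x + h = x + 1 *: h by rewrite scale1r.
  have E1 : l1 (x + h) = l1 x + l1 h by rewrite e1 (qg_l1_lin G) mul1r.
  have E2 : q1 (x + h) (x + h) <= 2 * (1 + q1 x x).
    rewrite e1 q1_move; have := qg_q1_ge0 G (x + -1 *: h); rewrite q1_move; lra.
  have E3 : 2 * l1 h <= 1 + K.
    have := qg_l1_le G h; have : K * q1 h h <= K by rewrite ler_piMr.
    by have := sqr_ge0 (l1 h - 1); move=> + + +; rewrite !expr2; lra.
  apply: upper_le => w; apply: le_trans (payoff_upper_bound _ _) _; rewrite E1 /M.
  have := ler_norm (qg_c G); have := ler_norm (l1 x).
  have : K * q1 (x + h) (x + h) <= K * (2 * (1 + q1 x x)) by rewrite ler_wpM2l.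
  lra.
have M0 : upper G x <= M.
  by have := HM 0; rewrite addr0; apply; rewrite q1_0.
pose D := M - upper G x + 1; have D0 : 0 < D by rewrite /D; lra.
pose t := Num.min 1 (e / (2 * D)).
have t0 : 0 < t by rewrite lt_min ltr01 divr_gt0// mulr_gt0.
have t1 : t <= 1 by rewrite ge_min lexx.
have tD : t * D < e.
  have : t <= e / (2 * D) by rewrite ge_min lexx orbT.
  by rewrite ler_pdivlMr ?mulr_gt0//; lra.
exists (t ^+ 2); first by rewrite exprn_gt0.
move=> h qh; pose k := t^-1 *: h.
have hk : h = t *: k by rewrite /k scalerA mulfV ?scale1r// gt_eqF.
have qk : q1 k k <= 1.
  have t2 : 0 < t ^+ 2 by rewrite exprn_gt0.
  by rewrite -(ler_pM2l t2) mulr1 -q1_scale -hk.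
have up : upper G (x + h) - upper G x <= t * D.
  have := upper_convex x k (_ : 0 <= t <= 1); rewrite (ltW t0) t1 -hk => /(_ isT).
  have := ler_wpM2l (ltW t0) (HM k qk); rewrite /D; lra.
have dn : upper G x - upper G (x + h) <= t * D.
  have HMk : upper G (x - k) <= M by apply: HM; rewrite q1_opp.
  (* The point [x] lies between [x + h = x + t k] and [x - k], with weight [t / (1 + t)] on the
     latter; convexity there gives the bound from below. *)
  pose s := t / (1 + t); have t10 : 0 < 1 + t by lra.
  have s0 : 0 <= s by rewrite divr_ge0// ltW.
  have s1 : s <= 1 by rewrite ler_pdivrMr//; lra.
  have := upper_convex (x + h) (- h - k) (_ : 0 <= s <= 1); rewrite s0 s1 => /(_ isT).
  have -> : x + h + (- h - k) = x - k by lmodule.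
  have -> : x + h + s *: (- h - k) = x.
    have -> : - h - k = - (1 + t) *: k by rewrite hk; lmodule.
    rewrite scalerA mulrN /s divfK ?gt_eqF// hk; lmodule.
  move=> H; have := ler_wpM2l (ltW t10) H.
  have -> : (1 + t) * ((1 - s) * upper G (x + h) + s * upper G (x - k)) =
    upper G (x + h) + t * upper G (x - k) by rewrite /s; field; rewrite gt_eqF.
  have := ler_wpM2l (ltW t0) HMk; rewrite /D; lra.
by rewrite ltr_norml; apply/andP; split; lra.
Qed.

(** Along [k] the pay-off is a downward parabola that can rise by at most [r ^ 2]; with slope [a]
    its actual rise is [a ^ 2 / q2 k k], and a direction with [q2 k k = 0] must have slope 0. *)
Lemma near_max_slope r v w : 0 <= r -> upper G v - r ^+ 2 <= g v w -> forall k,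
  slope2 v w k ^+ 2 <= r ^+ 2 * q2 k k.
Proof.
move=> r0 H k; have q0 := qg_q2_ge0 G k.
have B s : 2 * s * slope2 v w k - s ^+ 2 * q2 k k <= r ^+ 2.
  by have := le_upper v (w + s *: k); rewrite payoff_move2; lra.
move: (slope2 v w k) B => a B.
have [qk|qk] := eqVneq (q2 k k) 0.
  rewrite qk mulr0; have [->|a0] := eqVneq a 0; first by rewrite expr0n.
  have := B ((r ^+ 2 + 1) / (2 * a)); rewrite qk mulr0 subr0.
  have -> : 2 * ((r ^+ 2 + 1) / (2 * a)) * a = r ^+ 2 + 1 by field.
  lra.
have qp : 0 < q2 k k by rewrite lt0r qk.
have := B (a / q2 k k).
have -> : 2 * (a / q2 k k) * a - (a / q2 k k) ^+ 2 * q2 k k = a ^+ 2 / q2 k k.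
  by field.
by rewrite ler_pdivrMr.
Qed.

(* Instead of a saddle point: if [v0] almost minimizes [upper] and [w0] almost
   maximizes [payoff G v0], then comparing with near-maximizers at
   [v0 + r h] shows that the slope of [payoff G _ w0] at [v0] is almost
   nonnegative, hence [v0] almost minimizes this convex function. *)
Lemma inf_upper_le_sup_lower :
  (exists m, forall v, m <= upper G v) -> forall e, 0 < e ->
  exists v0 w0, forall v, upper G v0 <= g v w0 + e.
Proof.
move=> [m Hm] e e0; have K0 := qg_K_ge0 G.
(* [C1] comes from the square of a sum of three terms, bounded by [K], 1 and 1 times
   [r ^ 2 * q2 k k]; the summand 2 in [C] covers the near-optimality errors. The total loss is
   [r ^ 2 + 2 r C + (r C) ^ 2], which the choice of [r] keeps below [e]. *)
pose C1 := 3 * (K + 2); pose C := 2 + C1.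
have C0 : 0 < C by rewrite /C /C1; lra.
pose r := Num.min 1 (e / (1 + 2 * C + C ^+ 2)).
have den : 0 < 1 + 2 * C + C ^+ 2 by have := sqr_ge0 C; lra.
have r0 : 0 < r by rewrite lt_min ltr01 divr_gt0.
have r1 : r <= 1 by rewrite ge_min lexx.
have re : r * (1 + 2 * C + C ^+ 2) <= e.
  by rewrite -ler_pdivlMr// ge_min lexx orbT.
have rr : 0 < r ^+ 2 by rewrite exprn_gt0.
have hinf : has_inf (range (upper G)).
  by split; [exists (upper G 0); exists 0|exists m => _ [v _ <-]].
have [_ [v0 _ <-] Hv0] := inf_adherent rr hinf.
have Hlow v : upper G v0 - r ^+ 2 <= upper G v.
  have : inf (range (upper G)) <= upper G v by apply: ge_inf; [case: hinf|exists v].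
  lra.
have nearmax v : exists w, upper G v - r ^+ 2 <= g v w.
  have [_ [w _ <-] Hw] := sup_adherent rr (upper_has_sup v).
  by exists w; apply: ltW.
have [w0 Hw0] := nearmax v0.
have slope h : q1 h h <= 1 -> - (r * C) <= slope1 v0 w0 h.
  move=> qh; have qh0 := qg_q1_ge0 G h; have [w Hw] := nearmax (v0 + r *: h).
  pose k := w - w0; have wE : w = w0 + 1 *: k by rewrite scale1r addrC subrK.
  have S1 := near_max_slope (ltW r0) Hw k.
  have S0 := near_max_slope (ltW r0) Hw0 k.
  have qk0 := qg_q2_ge0 G k.
  (* [w] and [w0] are nearly stationary for [v0 + r h] and [v0]. Subtracting the two slopes along
     their difference [k] isolates [q2 k k], so moving [v0] by [r h] moves the maximizer only by
     order [r]. *)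
  have E : q2 k k = r * b h k - slope2 (v0 + r *: h) w k + slope2 v0 w0 k.
    by rewrite /slope2 wE (qg_q2_lin G) (qg_b_linl G); ring.
  have bk : b h k ^+ 2 <= K * q2 k k.
    by apply: le_trans (qg_b_le G h k) _; rewrite ler_wpM2r// ler_piMr.
  have qk : q2 k k <= r ^+ 2 * C1.
    have [->|qkn] := eqVneq (q2 k k) 0; first by rewrite mulr_ge0 ?(ltW rr)// /C1; lra.
    have qp : 0 < q2 k k by rewrite lt0r qkn.
    rewrite -(ler_pM2r qp) -expr2.
    have tri (x y z : R) : (x - y + z) ^+ 2 <= 3 * (x ^+ 2 + y ^+ 2 + z ^+ 2).
      have := sqr_ge0 (x + y); have := sqr_ge0 (x - z); have := sqr_ge0 (y + z).
      by rewrite !expr2; lra.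
    rewrite [X in X ^+ 2]E; apply: le_trans (tri _ _ _) _.
    have : r ^+ 2 * b h k ^+ 2 <= r ^+ 2 * (K * q2 k k) by rewrite ler_pM2l.
    by rewrite exprMn /C1; lra.
  have bC : `|b h k| <= r * C1.
    rewrite -(ler_pXn2r (ltn0Sn 1)) ?nnegrE ?mulr_ge0 ?(ltW r0)//; last by rewrite /C1; lra.
    rewrite real_normK ?num_real// exprMn; apply: le_trans bk _.
    have := ler_wpM2l K0 qk; have : K * (r ^+ 2 * C1) <= r ^+ 2 * C1 ^+ 2.
      rewrite mulrCA ler_pM2l// expr2 ler_wpM2r//; rewrite /C1; lra.
    lra.
  have M1 : upper G v0 - 2 * r ^+ 2 <= g (v0 + r *: h) w.
    by have := Hlow (v0 + r *: h); lra.
  rewrite payoff_move1 in M1; have M2 := le_upper v0 w.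
  have E1 : slope1 v0 w h = slope1 v0 w0 h + b h k.
    by rewrite /slope1 wE (qg_b_linr G); ring.
  have M3 : - (2 * r ^+ 2) <= 2 * r * (slope1 v0 w0 h + b h k) + r ^+ 2.
    have M0 : r ^+ 2 * q1 h h <= r ^+ 2 by rewrite ler_piMr// ltW.
    by rewrite -E1; lra.
  have M4 : 0 <= r * (2 * slope1 v0 w0 h + 2 * b h k + 3 * r) by lra.
  rewrite pmulr_rge0// in M4; have := ler_norm (b h k); rewrite /C; lra.
exists v0, w0 => v; pose h := v - v0.
have vE : v = v0 + 1 *: h by rewrite scale1r addrC subrK.
suff : - (2 * (r * C) + (r * C) ^+ 2) <= 2 * slope1 v0 w0 h + q1 h h.
  rewrite vE payoff_move1; have : (r * C) ^+ 2 <= r * C ^+ 2.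
    by rewrite exprMn ler_wpM2r ?sqr_ge0// expr2 ler_piMl// ltW.
  have : r ^+ 2 <= r by rewrite expr2 ler_piMl// ltW.
  lra.
have rC : 0 < r * C by rewrite mulr_gt0.
have qh0 := qg_q1_ge0 G h.
have [qh|qh] := leP (q1 h h) 1.
  by have := slope h qh; have := sqr_ge0 (r * C); lra.
(* Far from [v0] the slope bound is rescaled from the unit seminorm, and
   [p ^ 2 - 2 p r C >= - (r C) ^ 2]. *)
pose p := Num.sqrt (q1 h h); have pp : p ^+ 2 = q1 h h by rewrite sqr_sqrtr.
have p0 : 0 < p by rewrite sqrtr_gt0; lra.
pose h1 := p^-1 *: h; have hE : h = 0 + p *: h1.
  by rewrite add0r /h1 scalerA mulfV ?scale1r// gt_eqF.
have qh1 : q1 h1 h1 <= 1.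
  rewrite -(@ler_pM2l _ (p ^+ 2)) ?exprn_gt0// mulr1 -q1_scale.
  by rewrite -[p *: h1]add0r -hE pp.
have := slope h1 qh1.
have -> : slope1 v0 w0 h = p * slope1 v0 w0 h1.
  have l10 : l1 0 = 0 by have := qg_l1_lin G 0 0 1; rewrite scaler0 addr0; lra.
  have b0 : b 0 w0 = 0 by have := qg_b_linl G w0 0 0 1; rewrite scaler0 addr0; lra.
  rewrite /slope1 {1 2 3}hE (qg_l1_lin G) (qg_b_linl G) l10 b0.
  by rewrite !(qg_q1_sym G v0) (qg_q1_lin G) q1_0; ring.
move=> H; have := ler_wpM2l (ltW p0) H; rewrite -pp.
by have := sqr_ge0 (p - r * C); rewrite !expr2; lra.
Qed.

End theory.
End quadratic_games.

(** * Lower values by symmetry, and the minimax equality *)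

Section game_values.
Variables (R : realType) (V W : lmodType R) (G : quadratic_game V W).

Lemma lower_flip w : lower G w = - upper (flip G) w.
Proof.
rewrite /lower /upper /inf; congr (- sup _); apply/seteqP; split => x /=.
  by move=> [_ [v _ <-] <-]; exists v => //; rewrite payoff_flip.
by move=> [v _ <-]; exists (payoff G v w); [exists v|rewrite payoff_flip].
Qed.

Lemma lower_le v w : lower G w <= payoff G v w.
Proof. by rewrite lower_flip lerNl -payoff_flip le_upper. Qed.

Lemma lower_ge w m : (forall v, m <= payoff G v w) -> m <= lower G w.
Proof.
by move=> H; rewrite lower_flip lerNr; apply: upper_le => v; rewrite payoff_flip lerN2.
Qed.

Lemma lower_continuous w e : 0 < e -> exists2 d : R, 0 < d &
  forall h, qg_q2 G h h <= d -> `|lower G (w + h) - lower G w| < e.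
Proof.
move=> e0; have [d d0 H] := upper_continuous (flip G) w e0; exists d => // h /H.
by rewrite !lower_flip -opprD normrN.
Qed.

Lemma ereal_sup_upper v :
  ereal_sup (range (fun w => (payoff G v w)%:E)) = (upper G v)%:E.
Proof.
apply/eqP; rewrite eq_le; apply/andP; split.
  by apply: ge_ereal_sup => _ [w _ <-]; rewrite lee_fin le_upper.
have lb w : ((payoff G v w)%:E <= ereal_sup (range (fun w => (payoff G v w)%:E)))%E.
  by apply: ereal_sup_ubound; exists w.
case: (ereal_sup _) lb => [r|_|/(_ 0)//]; last by rewrite leey.
move=> lb; rewrite lee_fin; apply: upper_le => w; have := lb w; by rewrite lee_fin.
Qed.

Lemma ereal_inf_lower w :
  ereal_inf (range (fun v => (payoff G v w)%:E)) = (lower G w)%:E.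
Proof.
apply/eqP; rewrite eq_le; apply/andP; split; last first.
  by apply: le_ereal_inf_tmp => _ [v _ <-]; rewrite lee_fin lower_le.
have lb v : (ereal_inf (range (fun v => (payoff G v w)%:E)) <= (payoff G v w)%:E)%E.
  by apply: ereal_inf_lbound; exists v.
case: (ereal_inf _) lb => [r|/(_ 0)//|_]; last by rewrite leNye.
move=> lb; rewrite lee_fin; apply: lower_ge => v; have := lb v; by rewrite lee_fin.
Qed.

Lemma upper_bounded_below : exists m, forall v, m <= upper G v.
Proof.
exists (qg_c G - qg_K G) => v; apply: le_trans (le_upper G v 0).
have l20 : qg_l2 G 0 = 0 by have := qg_l2_lin G 0 0 1; rewrite scaler0 addr0; lra.
have b0 : qg_b G v 0 = 0 by have := qg_b_linr G v 0 0 1; rewrite scaler0 addr0; lra.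
have q0 : qg_q2 G 0 0 = 0 by have := qg_q2_lin G 0 0 0 1; rewrite scaler0 addr0; lra.
rewrite /payoff l20 b0 q0.
have K0 := qg_K_ge0 G; have q1 := qg_q1_ge0 G v; have := qg_l1_le G v.
move: (qg_l1 G v) (qg_K G) (qg_q1 G v v) K0 q1 => x K q K0 q1 H.
suff : - (2 * x) <= K + q by lra.
rewrite leNgt; apply/negP => Hlt.
have : (K + q) ^+ 2 < (- (2 * x)) ^+ 2 by rewrite ltr_pXn2r// nnegrE; lra.
by have := sqr_ge0 (K - q); move: H; rewrite !expr2; lra.
Qed.

Lemma minimax_value : ereal_inf (range (fun v => (upper G v)%:E)) =
  ereal_sup (range (fun w => (lower G w)%:E)).
Proof.
apply/eqP; rewrite eq_le; apply/andP; split; last first.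
  apply: ge_ereal_sup => _ [w _ <-]; apply: le_ereal_inf_tmp => _ [v _ <-].
  by rewrite lee_fin (le_trans (lower_le v w))// le_upper.
apply/lee_addgt0Pr => e e0.
have [v0 [w0 H]] := inf_upper_le_sup_lower upper_bounded_below e0.
apply: (@le_trans _ _ (upper G v0)%:E); first by apply: ereal_inf_lbound; exists v0.
apply: (@le_trans _ _ ((lower G w0)%:E + e%:E)%E).
  by rewrite -EFinD lee_fin -lerBlDr; apply: lower_ge => v; have := H v; lra.
by rewrite leeD2r//; apply: ereal_sup_ubound; exists w0.
Qed.

End game_values.

(** * The game of a stable plant *)

(** Polarization for blocks: conjugating by [diag(1, 1)] and [diag(1, -1)] and subtracting leaves
    twice the off-diagonal blocks. It is used with [e] equal to half of [eps]. *)
Lemma block_combination (K : comNzRingType) (k q : nat) (x11 : 'M[K]_k)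
    (x12 : 'M[K]_(k, q)) (x21 : 'M[K]_(q, k)) (x22 : 'M[K]_q) (e : K) :
  block_mx x11 ((e + e) *: x12) ((e + e) *: x21) (- x22) =
  1 *: (1 *: block_mx x11 (0 *: x12) (0 *: x21) ((0 * 0) *: x22) +
        -1 *: block_mx 0 0 0 x22) +
  1 *: (e *: block_mx x11 (1 *: x12) (1 *: x21) ((1 * 1) *: x22) +
        - e *: block_mx x11 (-1 *: x12) (-1 *: x21) ((-1 * -1) *: x22)).
Proof.
apply/matrixP => i j; rewrite !mxE.
by case: (fintype.split i) => i'; rewrite !mxE; case: (fintype.split j) => j'; rewrite !mxE; ring.
Qed.

Section plant_game.
Variables (R : realType) (V : lmodType R[i]) (rp : V -> V -> R) (S : V -> V).
Local Notation C := (R[i]).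
Local Notation Re := (@complex.Re R).
Local Notation toC r := ((r%:C)%C : R[i]).
Hypothesis hL : lagged rp S.
Let hi := lagged_inner hL.
Let hiv m := vec_inner hi m.
Let hfv m := inner_sform (hiv m).
Let hLv m := vec_lagged m hL.
Local Notation U := (shift (@vlag R V S _)).
Variable phi : V.
Hypothesis phi_rp : forall x, 2 * rp phi (S x) = rp phi x.
Variables (n : nat) (A P : 'M[C]_n).
Hypothesis hP : complex_lyapunov A P.
Hypothesis hA : forall s : C, 0 <= Re s -> s%:M - A \in unitmx.
Hypothesis solvable : forall f b, exists x, is_response S phi A f b x.

Lemma discriminant_le (a b c : R) : 0 <= a ->
  (forall t, 0 <= t ^+ 2 * a + 2 * t * b + c) -> b ^+ 2 <= a * c.
Proof.
rewrite le_eqVlt => /orP[/eqP<- H|a0 H].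
  rewrite mul0r; have [->|b0] := eqVneq b 0; first by rewrite expr0n.
  have := H (- (c + 1) / (2 * b)).
  have -> : (- (c + 1) / (2 * b)) ^+ 2 * 0 + 2 * (- (c + 1) / (2 * b)) * b + c = -1.
    by field.
  lra.
have := H (- b / a).
have -> : (- b / a) ^+ 2 * a + 2 * (- b / a) * b + c = c - b ^+ 2 / a.
  by field; rewrite gt_eqF.
by rewrite subr_ge0 ler_pdivrMr// mulrC.
Qed.

Lemma psd_block (k q : nat) (a : 'M[C]_k) b c (d : 'M[C]_q) :
  psd (block_mx a b c d) -> psd a /\ psd d.
Proof.
case=> h0 p0; have ctr_block : ctr (block_mx a b c d) = block_mx (ctr a) (ctr c) (ctr b) (ctr d).
  by rewrite /ctr map_block_mx tr_block_mx.
move: h0; rewrite /Defs.hermitian ctr_block => /eq_block_mx[ha _ _ hd].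
have ctr_col (x : 'cV[C]_k) (y : 'cV[C]_q) : ctr (col_mx x y) = row_mx (ctr x) (ctr y).
  by rewrite /ctr map_col_mx tr_col_mx.
have c0 m : ctr (0 : 'cV[C]_m) = 0 by rewrite /ctr map_mx0 trmx0.
split; split=> // z.
  have := p0 (col_mx z 0); rewrite ctr_col c0 mul_row_block mul_row_col.
  by rewrite !mul0mx !addr0 mulmx0 addr0.
have := p0 (col_mx 0 z); rewrite ctr_col c0 mul_row_block mul_row_col.
by rewrite !mul0mx !add0r mulmx0 add0r.
Qed.

Section form.
Variables (m : nat) (B : 'M[C]_(n, m)) (Q : 'M[C]_(n + m)).
Hypothesis hQ : ctr Q = Q.
Local Notation out := (output solvable B).

(* The frequency density [Pi] at [s = cayley z]. *)
Definition density (z : C) : 'M[C]_m :=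
  ctr (plant_symbol A B z) *m Q *m plant_symbol A B z.

Lemma weight_sform : sform (fun x y : vec V (n + m) => vrp rp (act Q x) y).
Proof.
split=> [x y|x y z|c x y|r x y].
- by rewrite (vrp_adj hi) hQ (sfC (hfv _)).
- by rewrite actD (sfDl (hfv _)).
- by rewrite actZ (sfZl (hfv _)).
- by rewrite actZ (sfRl (hfv _)).
Qed.

Definition cost p (M : 'M[C]_(m, p)) (u v : vec V p) : R :=
  vrp rp (act Q (out (act M u))) (out (act M v)).

Lemma cost_is_sform p (M : 'M[C]_(m, p)) : sform (cost M).
Proof.
apply: (sform_pull (T := fun u => out (act M u)) weight_sform).
  by move=> u v; rewrite actD (outputD hL hP).
by move=> c u; rewrite actZ (outputZ hL hP).
Qed.

Lemma cost_bounded p (M : 'M[C]_(m, p)) : exists2 K : R, 0 <= K &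
  forall u, `|cost M u u| <= K * vrp rp u u.
Proof.
have [K K0 HK] := tracks_bounded hL (tracks_right hL M (tracks_output hL hP hA solvable B)).
have [L L0 HL] := act_bounded hi Q.
exists ((L + 1) * K); first by pos.
move=> u; rewrite /cost; have Ku := HK u; move: (out (act M u)) Ku => y Ku.
have := inner_abs_weighted (hiv (n + m)) (act Q y) y ltr01; rewrite invr1 !mul1r => E.
have := ler_wpM2l (addr_ge0 L0 ler01) Ku; have := HL y; have := normr_ge0 (vrp rp (act Q y) y).
by rewrite mulrA mulrDl mul1r; move=> *; lra.
Qed.

Lemma cost_shift p (M : 'M[C]_(m, p)) u : cost M (U u) (U u) = cost M u u.
Proof.
by rewrite /cost -(shift_act hL) (output_shift hL hP) -(shift_act hL) (shift_rp (hLv _)).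
Qed.

Lemma cost_symbol p (M : 'M[C]_(m, p)) :
  has_symbol rp S (fun u => cost M u u) (fun z => ctr M *m density z *m M).
Proof.
have t := tracks_right hL M (tracks_output hL hP hA solvable B).
apply: has_symbol_eq (has_symbol_tracks hL (tracks_left hL Q t) t) => // z hz.
by rewrite /density ctrM !mulmxA.
Qed.

Lemma density_mxrat z0 p (M : 'M[C]_(m, p)) : circle z0 ->
  mxrat z0 (fun z => ctr M *m density z *m M).
Proof.
move=> hz0; have c q r (X : 'M[C]_(q, r)) : mxrat z0 (fun=> X) by exact: mxrat_cst.
have s : mxrat z0 (plant_symbol A B).
  by apply: mxrat_col => //; exact: mxrat_transfer.
by do !apply: mxrat_mul => //; exact: mxrat_ctr.
Qed.

Lemma density_ebounded p (M : 'M[C]_(m, p)) :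
  ebounded (fun z => ctr M *m density z *m M).
Proof.
have c q r (X : 'M[C]_(q, r)) : ebounded (fun=> X) by exact: ebounded_cst.
have s : ebounded (plant_symbol A B).
  by apply: ebounded_col => //; exact: transfer_ebounded hP hA.
by do !apply: ebounded_mul => //; exact: ebounded_ctr.
Qed.

(** The factor [r] is 1 for the minimizing player and -1 for the maximizing one, so that a single
    argument covers both. *)
Lemma cost_coupling p (M : 'M[C]_(m, p)) (r : R) z0 (a : 'cV[C]_n) : circle z0 ->
  (forall z, circle z -> psd (toC r *: (ctr M *m density z *m M))) ->
  posdef (toC r *: (ctr M *m density z0 *m M)) ->
  (forall u, 0 <= r * cost M u u) /\ exists2 K : R, 0 <= K & forall u,
    coupling rp solvable B Q a (act M u) ^+ 2 <= K * (r * cost M u u).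
Proof.
move=> hz0 Dpsd Dpd.
(* The zero summand only gives the multiple the shape expected by [sform_lincomb] and
   [has_symbol_lincomb]. *)
pose h u v := 0 * cost M u v + r * cost M u v.
have hE u v : h u v = r * cost M u v by rewrite /h mul0r add0r.
have hs : sform h := sform_lincomb 0 r (cost_is_sform M) (cost_is_sform M).
have hU u : h (U u) (U u) = h u u by rewrite /h cost_shift.
have hT : has_symbol rp S (fun u => h u u) (fun z => toC r *: (ctr M *m density z *m M)).
  apply: has_symbol_eq (has_symbol_lincomb hL 0 r (cost_symbol M) (cost_symbol M)) => // z _.
  by rewrite rmorph0 scale0r add0r.
have rat : mxrat z0 (fun z => toC r *: (ctr M *m density z *m M)).
  move=> i j; apply: ratf_eq (ratf_mul (ratf_cst z0 (toC r)) (density_mxrat M hz0 i j)) => z _.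
  by rewrite [RHS]mxE.
have bd : ebounded (fun z => toC r *: (ctr M *m density z *m M)).
  have [K K0 HK] := density_ebounded M.
  exists (nsq (toC r) * K) => [|z i j hz]; first by rewrite mulr_ge0 ?nsq_ge0.
  by rewrite [X in nsq X]mxE nsqM ler_wpM2l ?nsq_ge0 ?HK.
split=> [u|]; first by rewrite -hE; exact: (symbol_ge0 hL hs hU hT Dpsd).
have [K K0 HK] := coupling_controlled hL phi_rp hP hA solvable B Q M a hz0 hs hU hT rat bd Dpsd Dpd.
by exists K => // u; rewrite -hE HK.
Qed.

End form.

Variables (k q : nat) (B : 'M[C]_(n, k + q)) (Q : 'M[C]_(n + (k + q))).
Hypothesis hQ : ctr Q = Q.
Variables (eps : R) (z0 : C).
Hypothesis eps_gt0 : 0 < eps.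
Hypothesis hz0 : circle z0.
Local Notation D := (density B Q).
Hypothesis D_psd : forall z, circle z ->
  psd (block_mx (ulsubmx (D z)) (toC eps *: ursubmx (D z))
                (toC eps *: dlsubmx (D z)) (- drsubmx (D z))).
Hypothesis D_pos : posdef (ulsubmx (D z0)).
Hypothesis D_neg : negdef (drsubmx (D z0)).
Local Notation out := (output solvable B).

Let E1 : 'M[C]_(k + q, k) := col_mx 1%:M 0.
Let E2 : 'M[C]_(k + q, q) := col_mx 0 1%:M.
Let J1 : 'M[C]_(k + q) := block_mx 1%:M 0 0 0.
Let J2 : 'M[C]_(k + q) := block_mx 0 0 0 1%:M.

Let ctr0 p r : ctr (0 : 'M[C]_(p, r)) = 0.
Proof. by rewrite /ctr map_mx0 trmx0. Qed.

Let ctr_blockE p r p' r' (a : 'M[C]_(p, r)) b c (d : 'M[C]_(p', r')) :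
  ctr (block_mx a b c d) = block_mx (ctr a) (ctr c) (ctr b) (ctr d).
Proof. by rewrite /ctr map_block_mx tr_block_mx. Qed.

Let ctr_colE p r r' (a : 'M[C]_(r, p)) (b : 'M[C]_(r', p)) :
  ctr (col_mx a b) = row_mx (ctr a) (ctr b).
Proof. by rewrite /ctr map_col_mx tr_col_mx. Qed.

Lemma density_corner1 z : ctr E1 *m D z *m E1 = ulsubmx (D z).
Proof.
rewrite -[in LHS](submxK (D z)) ctr_colE ctr1 ctr0 mul_row_block mul_row_col.
by rewrite !mul0mx !mul1mx !addr0 mulmx1 mulmx0 addr0.
Qed.

Lemma density_corner2 z : ctr E2 *m D z *m E2 = drsubmx (D z).
Proof.
rewrite -[in LHS](submxK (D z)) ctr_colE ctr1 ctr0 mul_row_block mul_row_col.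
by rewrite !mul0mx !mul1mx !add0r mulmx1 mulmx0 add0r.
Qed.

Lemma density_sandwich z (b : C) : let J := block_mx 1%:M 0 0 b%:M in
  ctr J *m D z *m J = block_mx (ulsubmx (D z)) (b *: ursubmx (D z))
    (Num.conj b *: dlsubmx (D z)) ((Num.conj b * b) *: drsubmx (D z)).
Proof.
rewrite /= -[in LHS](submxK (D z)) ctr_blockE !ctr0 ctr1 ctr_scalar !mulmx_block.
rewrite !(mul0mx, mulmx0, addr0, add0r, mul1mx, mulmx1) !mul_scalar_mx !mul_mx_scalar.
by rewrite scalerA mulrC.
Qed.

(** The block matrix of the hypothesis is not the density of the pay-off itself, but a combination
    of densities for inputs cut down by [J1], [J2] or [J1 - J2]. The cross term comes by
    polarization, as [eps / 2] times the cost of the sum minus that of the difference. *)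
Lemma mixed_cost_ge0 (u : vec V k) (w : vec V q) :
  0 <= cost B Q E1 u u + 2 * eps * vrp rp (act Q (out (act E1 u))) (out (act E2 w))
       - cost B Q E2 w w.
Proof.
pose h1 x y := 1 * cost B Q J1 x y + -1 * cost B Q J2 x y.
pose h2 x y := (eps / 2) * cost B Q 1%:M x y + - (eps / 2) * cost B Q (J1 - J2) x y.
pose h x y := 1 * h1 x y + 1 * h2 x y.
have s1 : sform h1 := sform_lincomb 1 (-1) (cost_is_sform B hQ J1) (cost_is_sform B hQ J2).
have s2 : sform h2 := sform_lincomb _ _ (cost_is_sform B hQ 1%:M) (cost_is_sform B hQ (J1 - J2)).
have s : sform h := sform_lincomb 1 1 s1 s2.
have hU x : h (U x) (U x) = h x x by rewrite /h /h1 /h2 !cost_shift.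
have cs := cost_symbol B Q.
have hT := has_symbol_lincomb hL 1 1
  (has_symbol_lincomb hL 1 (-1) (cs _ J1) (cs _ J2))
  (has_symbol_lincomb hL (eps / 2) (- (eps / 2)) (cs _ 1%:M) (cs _ (J1 - J2))).
have := symbol_ge0 hL s hU hT; move=> /(_ _ (act E1 u + act E2 w)).
have a0 p r (x : vec V r) : act (0 : 'M[C]_(p, r)) x = 0.
  by rewrite -(scale0r (0 : 'M[C]_(p, r))) actZl scale0r.
have J1E1 : J1 *m E1 = E1 by rewrite mul_block_col !mul0mx mul1mx !addr0.
have J1E2 : J1 *m E2 = 0 by rewrite mul_block_col !mul0mx mulmx0 !addr0 col_mx0.
have J2E1 : J2 *m E1 = 0 by rewrite mul_block_col !mul0mx mulmx0 !addr0 col_mx0.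
have J2E2 : J2 *m E2 = E2 by rewrite mul_block_col !mul0mx mul1mx !add0r.
have e1 : act J1 (act E1 u + act E2 w) = act E1 u.
  by rewrite actD -!actM J1E1 J1E2 a0 addr0.
have e2 : act J2 (act E1 u + act E2 w) = act E2 w.
  by rewrite actD -!actM J2E1 J2E2 a0 add0r.
have -> : h (act E1 u + act E2 w) (act E1 u + act E2 w) =
    cost B Q E1 u u + 2 * eps * vrp rp (act Q (out (act E1 u))) (out (act E2 w)) - cost B Q E2 w w.
  rewrite /h /h1 /h2 /cost !actDl !actNl e1 e2 act1 (outputD hL hP).
  have oN x : out (- x) = - out x by rewrite -scaleN1r (outputZ hL hP) scaleN1r.
  rewrite (outputD hL hP) oN.
  move: (out (act E1 u)) (out (act E2 w)) => x y.
  have W := weight_sform hQ.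
  by rewrite !(sfDl W) !(sfDr W) !(sfNl W) !(sfNr W) (sfC W y x); field.
apply=> z hz; have := D_psd hz; congr psd.
have J1E : J1 = block_mx 1%:M 0 0 (0 : C)%:M by rewrite raddf0.
have J12 : J1 - J2 = block_mx 1%:M 0 0 (-1 : C)%:M.
  by rewrite opp_block_mx add_block_mx !oppr0 !addr0 sub0r raddfN.
have I1 : 1%:M = block_mx 1%:M 0 0 (1 : C)%:M :> 'M[C]_(k + q) by rewrite -scalar_mx_block.
have J2S : ctr J2 *m D z *m J2 = block_mx 0 0 0 (drsubmx (D z)).
  rewrite -[in LHS](submxK (D z)) ctr_blockE !ctr0 ctr1 !mulmx_block.
  by rewrite !(mul0mx, mulmx0, addr0, add0r, mul1mx, mulmx1).
rewrite J2S J12 I1 J1E !density_sandwich !rmorphN !rmorph1 !rmorph0.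
have -> : toC eps = toC (eps / 2) + toC (eps / 2) by rewrite -rmorphD; congr (toC _); field.
exact: block_combination.
Qed.

Variables (X Y : lmodType R) (i1 : X -> vec V k) (i2 : Y -> vec V q).
Hypothesis i1_lin : forall x y t, i1 (x + t *: y) = i1 x + toC t *: i1 y.
Hypothesis i2_lin : forall x y t, i2 (x + t *: y) = i2 x + toC t *: i2 y.
Variable a : 'cV[C]_n.
Local Notation free := (free_output solvable (k + q) a).

Theorem plant_quadratic_game : exists G : quadratic_game X Y,
  (forall x y, payoff G x y =
    let s := free + out (act E1 (i1 x)) + out (act E2 (i2 y)) in vrp rp (act Q s) s) /\
  (forall x, qg_q1 G x x = cost B Q E1 (i1 x) (i1 x)) /\
  (forall y, qg_q2 G y y = - cost B Q E2 (i2 y) (i2 y)).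
Proof.
have psd1 z : circle z -> psd (toC 1 *: (ctr E1 *m D z *m E1)).
  by move=> /D_psd /psd_block[h _]; rewrite density_corner1 rmorph1 scale1r.
have pos1 : posdef (toC 1 *: (ctr E1 *m D z0 *m E1)).
  by rewrite density_corner1 rmorph1 scale1r.
have psd2 z : circle z -> psd (toC (-1) *: (ctr E2 *m D z *m E2)).
  by move=> /D_psd /psd_block[_ h]; rewrite density_corner2 rmorphN1 scaleN1r.
have pos2 : posdef (toC (-1) *: (ctr E2 *m D z0 *m E2)).
  rewrite density_corner2 rmorphN1 scaleN1r; case: D_neg => h0 hneg; split.
    by rewrite /Defs.hermitian ctrN h0.
  by move=> z zn0; rewrite mulmxN mulNmx mxE oppr_gt0 hneg.
have [q1_ge0 [K1 K10 HK1]] := cost_coupling hQ a hz0 psd1 pos1.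
have [q2_ge0 [K2 K20 HK2]] := cost_coupling hQ a hz0 psd2 pos2.
have W := weight_sform hQ.
pose o1 x := out (act E1 (i1 x)); pose o2 y := out (act E2 (i2 y)).
have o1_lin x y t : o1 (x + t *: y) = o1 x + toC t *: o1 y.
  by rewrite /o1 i1_lin actD actZ (outputD hL hP) (outputZ hL hP).
have o2_lin x y t : o2 (x + t *: y) = o2 x + toC t *: o2 y.
  by rewrite /o2 i2_lin actD actZ (outputD hL hP) (outputZ hL hP).
pose K := K1 + K2 + (eps ^+ 2)^-1.
have ei0 : 0 <= (eps ^+ 2)^-1 by rewrite invr_ge0 sqr_ge0.
have q1g x : 0 <= vrp rp (act Q (o1 x)) (o1 x) by have := q1_ge0 (i1 x); rewrite mul1r.
have q2g y : 0 <= - vrp rp (act Q (o2 y)) (o2 y) by have := q2_ge0 (i2 y); rewrite mulN1r.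
(* Scaling [x] by [t] in [mixed_cost_ge0] gives a quadratic polynomial in [t] that is never
   negative; its discriminant bounds [(eps * b) ^ 2]. *)
have bE x y : vrp rp (act Q (o1 x)) (o2 y) ^+ 2 <=
    (eps ^+ 2)^-1 * vrp rp (act Q (o1 x)) (o1 x) * - vrp rp (act Q (o2 y)) (o2 y).
  have e2 : 0 < eps ^+ 2 by rewrite exprn_gt0.
  rewrite -mulrA ler_pdivlMl// -exprMn; apply: discriminant_le => // t.
  have := mixed_cost_ge0 (toC t *: i1 x) (i2 y).
  rewrite /cost !actZ (outputZ hL hP) -/(o1 x) -/(o2 y) actZ.
  rewrite (sfRl (hfv _)) (sfRl (hfv _)) (sfRr (hfv _)); lra.
pose l1 x := vrp rp (act Q free) (o1 x); pose l2 y := vrp rp (act Q free) (o2 y).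
pose q1 x x' := vrp rp (act Q (o1 x)) (o1 x').
pose q2 y y' := - vrp rp (act Q (o2 y)) (o2 y').
pose b x y := vrp rp (act Q (o1 x)) (o2 y).
have f1 : real_linear l1 by move=> x y t; rewrite /l1 o1_lin (sfDr W) (sfRr W).
have f2 : real_linear l2 by move=> x y t; rewrite /l2 o2_lin (sfDr W) (sfRr W).
have f3 z : real_linear (q1 ^~ z) by move=> x y t; rewrite /q1 o1_lin (sfDl W) (sfRl W).
have f4 z : real_linear (q2 ^~ z).
  by move=> x y t; rewrite /q2 o2_lin (sfDl W) (sfRl W) opprD mulrN.
have f5 y : real_linear (b ^~ y) by move=> x x' t; rewrite /b o1_lin (sfDl W) (sfRl W).
have f6 x : real_linear (b x) by move=> y y' t; rewrite /b o2_lin (sfDr W) (sfRr W).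
have f7 x y : q1 x y = q1 y x by rewrite /q1 (sfC W).
have f8 x y : q2 x y = q2 y x by rewrite /q2 (sfC W).
have f9 : 0 <= K by rewrite /K; lra.
have f10 x : l1 x ^+ 2 <= K * q1 x x.
  apply: le_trans (HK1 (i1 x)) _; rewrite mul1r /cost -/(o1 x).
  by apply: ler_wpM2r; [exact: q1g|rewrite /K; lra].
have f11 y : l2 y ^+ 2 <= K * q2 y y.
  apply: le_trans (HK2 (i2 y)) _; rewrite mulN1r /cost -/(o2 y).
  by apply: ler_wpM2r; [exact: q2g|rewrite /K; lra].
have f12 x y : b x y ^+ 2 <= K * q1 x x * q2 y y.
  apply: le_trans (bE x y) _; apply: ler_wpM2r; first exact: q2g.
  by apply: ler_wpM2r; [exact: q1g|rewrite /K; lra].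
exists (QuadraticGame (vrp rp (act Q free) free) f1 f2 f3 f4 f5 f6 f7 f8 q1g q2g f9 f10 f11 f12).
split=> [x y|]; last by split.
rewrite /payoff /= -/(o1 x) -/(o2 y) /l1 /l2 /q1 /q2 /b.
move: free (o1 x) (o2 y) => F X1 Y1.
rewrite !(sfDl W) !(sfDr W) (sfC W X1 F) (sfC W Y1 F) (sfC W Y1 X1).
by ring.
Qed.

End plant_game.

(** * Complex square integrable signals *)

Section complex_signals.
Variable R : realType.
Local Notation C := (R[i]).
Local Notation H := (l2fun R).

Definition cl2 := (H * H)%type.

HB.instance Definition _ := GRing.Zmodule.on cl2.

Definition cl2_scale (c : C) (F : cl2) : cl2 :=
  (complex.Re c *: F.1 - complex.Im c *: F.2, complex.Im c *: F.1 + complex.Re c *: F.2).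

Lemma cl2_scaleA a b F : cl2_scale a (cl2_scale b F) = cl2_scale (a * b) F.
Proof.
by case: a b F => [a1 a2] [b1 b2] [f1 f2]; rewrite /cl2_scale /=; congr pair; lmodule.
Qed.

Lemma cl2_scale1 : left_id 1 cl2_scale.
Proof. by case=> f1 f2; rewrite /cl2_scale /=; congr pair; lmodule. Qed.

Lemma cl2_scaleDr : right_distributive cl2_scale +%R.
Proof.
by move=> [a1 a2] [f1 f2] [g1 g2]; rewrite /cl2_scale /=; congr pair; rewrite /=; lmodule.
Qed.

Lemma cl2_scaleDl F a b : cl2_scale (a + b) F = cl2_scale a F + cl2_scale b F.
Proof.
by case: a b F => [a1 a2] [b1 b2] [f1 f2]; rewrite /cl2_scale /=; congr pair; rewrite /=; lmodule.
Qed.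

HB.instance Definition _ := GRing.Zmodule_isLmodule.Build C cl2
  cl2_scaleA cl2_scale1 cl2_scaleDr cl2_scaleDl.

Lemma cl2Z (c : C) (F : cl2) : c *: F =
  (complex.Re c *: F.1 - complex.Im c *: F.2, complex.Im c *: F.1 + complex.Re c *: F.2) :> cl2.
Proof. by []. Qed.

Lemma cl2D (F G : cl2) : F + G = (F.1 + G.1, F.2 + G.2) :> cl2.
Proof. by []. Qed.

Definition crp (F G : cl2) : R := ip F.1 G.1 + ip F.2 G.2.

Definition clag (F : cl2) : cl2 := (lag F.1, lag F.2).

Definition clag0 : cl2 := (lag0 R, 0).

Lemma ipDr (f g h : H) : ip f (g + h) = ip f g + ip f h.
Proof. by rewrite ipC ipDl !(ipC f). Qed.
Lemma ipZr a (f g : H) : ip f (a *: g) = a * ip f g.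
Proof. by rewrite ipC ipZl ipC. Qed.
Lemma ip0r (f : H) : ip f 0 = 0.
Proof. by rewrite -(scale0r 0) ipZr mul0r. Qed.

Lemma crp_inner : inner crp.
Proof.
split; last by move=> F; apply: addr_ge0; exact: ip_ge0.
split=> [F G|F G K|c F G|r F G].
- by rewrite /crp (ipC G.1) (ipC G.2).
- by rewrite /crp cl2D /= !ipDl; ring.
- rewrite /crp !cl2Z; case: c => a b; rewrite conjE /=.
  by rewrite !(ipDl, ipBl, ipDr, ipBr, ipZl, ipZr); ring.
- by rewrite /crp !cl2Z /= !(ipDl, ipBl, ipZl); ring.
Qed.

Lemma clag_lagged : lagged crp clag.
Proof.
split; first exact: crp_inner.
- by move=> F G; rewrite /clag cl2D /= !lagD.
- move=> c F; have lagN' f : lag (- f) = - lag f :> H by rewrite -scaleN1r lagZ scaleN1r.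
  by rewrite /clag !cl2Z /= !lagD lagN' !lagZ.
- move=> F G; rewrite /crp /clag /=.
  rewrite mulrDr; apply: etrans (f_equal2 +%R (lag_ip F.1 G.1) (lag_ip F.2 G.2)) _.
  exact: addrACA.
- move=> [f g] /eqP; rewrite /crp /= paddr_eq0 ?ip_ge0// => /andP[/eqP f0 /eqP g0].
  by rewrite /clag /= !lag_null.
Qed.

Lemma clag0_rp F : 2 * crp clag0 (clag F) = crp clag0 F.
Proof.
have z (f : H) : ip 0 f = 0 by rewrite ipC ip0r.
by rewrite /crp /= !z !addr0 lag0_ip.
Qed.

Definition real_part m (u : vec cl2 m) (i : 'I_m) : H := (u i).1.
Definition imag_part m (u : vec cl2 m) (i : 'I_m) : H := (u i).2.

Lemma cl2_sum (I : Type) (r : seq I) (F : I -> cl2) :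
  \sum_(i <- r) F i = (\sum_(i <- r) (F i).1, \sum_(i <- r) (F i).2) :> cl2.
Proof. by elim: r => [|i r IH]; rewrite ?big_nil// !big_cons IH. Qed.

Lemma act_cmx p m (M : 'M[R]_(p, m)) (u : vec cl2 m) i : act (cmx M) u i =
  (\sum_j M i j *: (u j).1, \sum_j M i j *: (u j).2) :> cl2.
Proof.
rewrite actE cl2_sum; congr pair; apply: eq_bigr => j _; rewrite cl2Z mxE /= scale0r.
  by rewrite subr0.
by rewrite add0r.
Qed.

Lemma is_response_split n (A : 'M[R]_n) f (b1 b2 : 'cV[R]_n) (x1 x2 : 'I_n -> H) :
  (forall i, x1 i = lag (x1 i + \sum_j A i j *: x1 j + real_part f i) + b1 i 0 *: lag0 R) ->
  (forall i, x2 i = lag (x2 i + \sum_j A i j *: x2 j + imag_part f i) + b2 i 0 *: lag0 R) ->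
  is_response clag clag0 (cmx A) f (\col_i (b1 i 0 +i* b2 i 0)%C)
    [ffun i => (x1 i, x2 i) : cl2].
Proof.
move=> h1 h2; apply/ffunP => i; rewrite vecD vlagE !vecD act_cmx !ffunE mxE.
rewrite [RHS]cl2D cl2Z /clag /= scaler0 subr0 scaler0 addr0.
have e1 : \sum_j A i j *: ([ffun l => (x1 l, x2 l) : cl2] j).1 = \sum_j A i j *: x1 j.
  by apply: eq_bigr => j _; rewrite ffunE.
have e2 : \sum_j A i j *: ([ffun l => (x1 l, x2 l) : cl2] j).2 = \sum_j A i j *: x2 j.
  by apply: eq_bigr => j _; rewrite ffunE.
rewrite e1 e2; apply: (f_equal2 pair); [exact: h1|exact: h2].
Qed.

Lemma clag_solvable n (A P : 'M[R]_n) : lyapunov A P ->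
  forall f b, exists x, is_response clag clag0 (cmx A) f b x.
Proof.
move=> hP f b.
have [x1 x10 d1] := ode_l2 (real_part f) (map_mx (@complex.Re R) b) hP.
have [x2 x20 d2] := ode_l2 (imag_part f) (map_mx (@complex.Im R) b) hP.
exists [ffun i => (x1 i, x2 i) : cl2].
have -> : b = \col_i (map_mx (@complex.Re R) b i 0 +i* map_mx (@complex.Im R) b i 0)%C.
  by apply/colP => i; rewrite !mxE; case: (b i 0).
have e1 i : x1 i 0 = map_mx (@complex.Re R) b i 0 by rewrite -x10 mxE.
have e2 i : x2 i 0 = map_mx (@complex.Im R) b i 0 by rewrite -x20 mxE.
apply: is_response_split => i; first by rewrite {1}(vprim_lag i d1) e1.
by rewrite {1}(vprim_lag i d2) e2.
Qed.

End complex_signals.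

(** * The pay-off of square integrable inputs *)

Section input_signals.
Variable R : realType.
Notation mu := (@lebesgue_measure R).

Lemma integ_iint_sum (I : Type) (r : seq I) (f : I -> R -> R) :
  (forall i, integ Rplus (f i)) -> integ Rplus (fun t => \sum_(i <- r) f i t) /\
  iint (fun t => \sum_(i <- r) f i t) = \sum_(i <- r) iint (f i).
Proof.
move=> If; have mR := @measurable_Rplus R.
have eN : iint (fun=> 0 : R) = 0 by rewrite /iint /Rintegral integral0.
elim: r => [|i r [IH1 IH2]].
  split; first by apply: integ_eq (integ0 _) => // t _; rewrite big_nil.
  by rewrite big_nil -[RHS]eN; apply: eq_Rintegral => t _; rewrite big_nil.
split; first by apply: integ_eq (integD _ (If i) IH1) => // t _; rewrite big_cons.
rewrite big_cons -IH2 /iint -RintegralD//.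
  by apply: eq_Rintegral => t _; rewrite big_cons.
exact: If.
Qed.

(** Links the inputs of the theorem, functions on the whole line, to tuples of normalized signals,
    which vanish before time 0. *)
Definition agrees m (x : 'I_m -> l2fun R) (v : R -> 'cV[R]_m) :=
  forall t, 0 <= t -> l2col x t = v t.

Lemma l2col_L2 m (x : 'I_m -> l2fun R) : L2 m (l2col x).
Proof.
split=> [i|].
  apply: eq_measurable_fun (l2_meas (x i)) => t _; by rewrite mxE.
by rewrite (integ_fineK (@measurable_Rplus R) (l2col_sqnorm x)) ltry.
Qed.

Lemma L2_agrees m (v : R -> 'cV[R]_m) : L2 m v ->
  exists x : {ffun 'I_m -> l2fun R}, agrees x v.
Proof.
case=> mv Iv.
have msq : measurable_fun Rplus (fun t => sqnorm (v t)).
  by apply: measurable_sum => i; apply: measurable_funX.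
have Isq : integ Rplus (fun t => sqnorm (v t)).
  apply/integrableP; split; first exact/measurable_EFinP.
  apply: le_lt_trans Iv; rewrite le_eqVlt; apply/orP; left; apply/eqP.
  by apply: eq_integral => t _; rewrite /= ger0_norm ?sqnorm_ge0.
have xl2 i : is_l2 (fun t => if t < 0 then 0 else v t i 0).
  have mx : measurable_fun Rplus (fun t => if t < 0 then 0 else v t i 0).
    by apply: eq_measurable_fun (mv i) => t; rewrite inE => /RplusP t0; rewrite ltNge t0.
  split=> [t ->//||]; first exact: mx.
  apply: (integ_dom (@measurable_Rplus R) _ Isq); first exact: measurable_funX.
  move=> t /RplusP t0; rewrite ltNge t0 /= ger0_norm ?sqr_ge0//; exact: sqnorm_entry.
exists [ffun i => L2Fun (xl2 i)] => t t0; apply/colP => i.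
by rewrite mxE ffunE /= ltNge t0.
Qed.

Lemma L2norm_agrees m (x : 'I_m -> l2fun R) v : agrees x v ->
  L2norm v ^+ 2 = \sum_i ip (x i) (x i).
Proof.
move=> xv; rewrite /L2norm sqr_sqrtr; last first.
  by apply: fine_ge0; apply: integral_ge0 => t _; rewrite lee_fin sqnorm_ge0.
have -> : (\int[mu]_(t in Rplus) (sqnorm (v t))%:E =
    \int[mu]_(t in Rplus) (\sum_i x i t * x i t)%:E)%E.
  apply: eq_integral => t; rewrite inE => /RplusP t0; congr EFin.
  by rewrite -xv//; apply: eq_bigr => i _; rewrite mxE expr2.
by rewrite -/(Rintegral _ _ _) -/(iint _) (integ_iint_sum _ (fun i => l2_prod (x i) (x i))).2.
Qed.

Lemma L2norm_small m (x x0 : {ffun 'I_m -> l2fun R}) v v0 (K d : R) : 0 <= K -> 0 < d ->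
  agrees x v -> agrees x0 v0 -> L2norm (fun t => v t - v0 t) < Num.sqrt (d / (K + 1)) ->
  K * \sum_i ip ((x - x0) i) ((x - x0) i) <= d.
Proof.
move=> K0 d0 xv xv0 H.
have K1 : 0 < K + 1 by rewrite ltr_wpDl.
rewrite -(@L2norm_agrees _ (x - x0) (fun t => v t - v0 t)); last first.
  by move=> t t0; rewrite -xv// -xv0//; apply/colP => i; rewrite !mxE !ffunE l2D l2N.
have {}H : L2norm (fun t => v t - v0 t) ^+ 2 <= d / (K + 1).
  have dK : 0 <= d / (K + 1) by rewrite divr_ge0 1?ltW.
  rewrite -[leRHS](sqr_sqrtr dK) ler_pXn2r ?nnegrE ?sqrtr_ge0//.
  exact: ltW.
have := ler_wpM2l (ltW K1) H; rewrite [X in _ <= X -> _]mulrC divfK ?gt_eqF//.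
by have := sqr_ge0 (L2norm (fun t => v t - v0 t)); lra.
Qed.

Definition glue (T : Type) m p (x : 'I_m -> T) (y : 'I_p -> T) (i : 'I_(m + p)) : T :=
  match fintype.split i with inl j => x j | inr j => y j end.

Lemma l2col_glue m p (x : 'I_m -> l2fun R) (y : 'I_p -> l2fun R) t :
  l2col (glue x y) t = col_mx (l2col x t) (l2col y t).
Proof.
by apply/colP => i; rewrite !mxE /glue; case: fintype.split => j; rewrite mxE.
Qed.

Lemma l2col_mulmx m p (M : 'M[R]_(p, m)) (x : 'I_m -> l2fun R) t :
  l2col (fun i => \sum_j M i j *: x j) t = M *m l2col x t.
Proof.
apply/colP => i; rewrite !mxE l2_sum; apply: eq_bigr => j _.
by rewrite l2Z mxE.
Qed.

Lemma is_solution_vprim n k q (A : 'M[R]_n) (B1 : 'M[R]_(n, k)) (B2 : 'M[R]_(n, q)) a v w x :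
  is_solution A B1 B2 a v w x <->
  x 0 = a /\ vprim x (fun t => A *m x t + B1 *m v t + B2 *m w t).
Proof.
split=> [h|[x0 h] t t0].
  have x0 : x 0 = a.
    have [_ ->] := h 0 (lexx 0); apply/colP => i; rewrite !mxE.
    by rewrite -[RHS]addr0; congr (_ + _); exact: pint0.
  split=> // i; split=> [t|t t0].
    have [t0|t0] := leP 0 t; first by have [/(_ i) Ii _] := h t t0.
    by rewrite set_itv_ge ?bnd_simp -?ltNge//; exact: integrable_set0.
  by have [_ ->] := h t t0; rewrite x0 !mxE.
split=> [i|]; first by have [/(_ t)] := h i.
by apply/colP => i; have [_ ->//] := h i; rewrite x0 !mxE.
Qed.

Lemma gfun_agrees n k q (A P : 'M[R]_n) (B1 : 'M[R]_(n, k)) (B2 : 'M[R]_(n, q)) Q a v w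
    (y1 : 'I_k -> l2fun R) (y2 : 'I_q -> l2fun R) :
  lyapunov A P -> agrees y1 v -> agrees y2 w ->
  exists x : 'I_n -> l2fun R, let u := glue y1 y2 in let s := glue x u in
  [/\ l2col x 0 = a,
      vprim (l2col x) (fun t => A *m l2col x t +
        l2col (fun i => \sum_j row_mx B1 B2 i j *: u j) t) &
      gfun A B1 B2 Q a v w = (\sum_i ip (s i) (\sum_j Q i j *: s j))%:E].
Proof.
move=> hP y1v y2w; set u := glue y1 y2.
have [x x0 dx] := ode_l2 (fun i => \sum_j row_mx B1 B2 i j *: u j) a hP.
exists x => /=; split=> //.
have uE t : 0 <= t -> l2col (fun i => \sum_j row_mx B1 B2 i j *: u j) t =
    B1 *m v t + B2 *m w t.
  by move=> t0; rewrite l2col_mulmx l2col_glue mul_row_col y1v// y2w.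
have xsol : is_solution A B1 B2 a v w (l2col x).
  apply/is_solution_vprim; split=> // i.
  by apply: prim_eq (dx i) => t t0 //; rewrite uE// addrA.
(* [traj] is a choice among all solutions; uniqueness on the half-line identifies it there with the
   square integrable one. *)
have trajE t : 0 <= t -> traj A B1 B2 a v w t = l2col x t.
  have /is_solution_vprim[y0 dy] : is_solution A B1 B2 a v w (traj A B1 B2 a v w).
    exact: (xgetI _ xsol).
  move=> t0; apply: (@ode_unique _ _ A _ _ (fun t => B1 *m v t + B2 *m w t)) => //.
  - by rewrite y0 x0.
  - by move=> i; apply: prim_eq (dy i) => s s0 //; rewrite addrA.
  - by move=> i; apply: prim_eq (dx i) => s s0 //; rewrite uE.
pose s := glue x u; pose r i := \sum_j Q i j *: s j.
have [I1 I2] := integ_iint_sum (index_enum _) (fun i => l2_prod (s i) (r i)).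
rewrite /gfun -[X in _ = X%:E]I2 -(integ_fineK (@measurable_Rplus R) I1).
apply: eq_integral => t; rewrite inE => /RplusP t0; congr EFin.
rewrite trajE// -y1v// -y2w// /sigma -!l2col_glue -mulmxA -l2col_mulmx mxE.
by apply: eq_bigr => i _; rewrite !mxE.
Qed.

End input_signals.

(** * Real signals inside complex ones *)

Section plant_signals.
Variable R : realType.
Local Notation C := (R[i]).
Local Notation toC r := ((r%:C)%C : R[i]).

Definition real_vec m (x : 'I_m -> l2fun R) : vec (cl2 R) m := [ffun i => (x i, 0) : cl2 R].

Lemma real_vec_lin m (x y : {ffun 'I_m -> l2fun R}) t :
  real_vec (x + t *: y) = real_vec x + toC t *: real_vec y.
Proof.
apply/ffunP => i; rewrite vecD vecZ !ffunE cl2Z /= cl2D /=.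
by rewrite !scaler0 scale0r subr0 !addr0.
Qed.

Lemma act_real_vec m p (M : 'M[R]_(p, m)) (x : 'I_m -> l2fun R) :
  act (cmx M) (real_vec x) = real_vec (fun i => \sum_j M i j *: x j).
Proof.
apply/ffunP => i; rewrite act_cmx !ffunE; congr pair.
  by apply: eq_bigr => j _; rewrite ffunE.
by rewrite big1// => j _; rewrite ffunE scaler0.
Qed.

Lemma crp_real_vec m (x y : 'I_m -> l2fun R) :
  vrp (@crp R) (real_vec x) (real_vec y) = \sum_i ip (x i) (y i).
Proof.
by apply: eq_bigr => i _; rewrite !ffunE /crp /= ip0r addr0.
Qed.

Lemma act_glue m p (x : 'I_m -> l2fun R) (y : 'I_p -> l2fun R) :
  act (col_mx 1%:M 0) (real_vec x) + act (col_mx 0 1%:M) (real_vec y) =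
  real_vec (glue x y).
Proof.
apply/ffunP => i; rewrite vecD !actE [RHS]ffunE /glue.
case: (fintype.splitP i) => j ij.
  have -> : i = lshift p j by exact: val_inj.
  rewrite [X in _ + X]big1 ?addr0 => [|l _]; last by rewrite col_mxEu mxE scale0r.
  under eq_bigr do rewrite col_mxEu.
  by rewrite -actE act1 ffunE.
have -> : i = rshift m j by exact: val_inj.
rewrite big1 ?add0r => [|l _]; last by rewrite col_mxEd mxE scale0r.
under eq_bigr do rewrite col_mxEd.
by rewrite -actE act1 ffunE.
Qed.

Lemma is_response_real n (A : 'M[R]_n) (f x : 'I_n -> l2fun R) :
  vprim (l2col x) (fun t => A *m l2col x t + l2col f t) ->
  is_response (@clag R) (clag0 R) (cmx A) (real_vec f) (cmx (l2col x 0)) (real_vec x).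
Proof.
move=> dx.
have -> : cmx (l2col x 0) = \col_i (l2col x 0 i 0 +i* (0 : 'cV[R]_n) i 0)%C.
  by apply/colP => i; rewrite !mxE.
apply: (is_response_split (x2 := fun=> 0)) => i; rewrite /real_part /imag_part ffunE /=.
  by rewrite {1}(vprim_lag i dx) !mxE.
rewrite mxE scale0r addr0 big1 ?addr0 => [|j _]; last by rewrite scaler0.
rewrite lag_null// ip0r//.
Qed.

Section plant.
Variables (n k q : nat) (A P : 'M[R]_n) (B1 : 'M[R]_(n, k)) (B2 : 'M[R]_(n, q)).
Variables (Q : 'M[R]_(n + (k + q))) (Pc : 'M[C]_n).
Hypothesis hP : lyapunov A P.
Hypothesis hPc : complex_lyapunov (cmx A) Pc.
Let B : 'M[C]_(n, k + q) := cmx (row_mx B1 B2).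
Let solvable := clag_solvable hP.
Let hL := clag_lagged R.

(** Superposition: by uniqueness the trajectory is the free response of [a] plus the responses from
    rest to the two inputs. *)
Lemma gfun_real_vec a v w (y1 : 'I_k -> l2fun R) (y2 : 'I_q -> l2fun R) :
  agrees y1 v -> agrees y2 w ->
  gfun A B1 B2 Q a v w = (let s := free_output solvable (k + q) (cmx a) +
    output solvable B (act (col_mx 1%:M 0) (real_vec y1)) +
    output solvable B (act (col_mx 0 1%:M) (real_vec y2)) in
    vrp (@crp R) (act (cmx Q) s) s)%:E.
Proof.
move=> y1v y2w; have [x [x0 dx ->]] := gfun_agrees B1 B2 Q a hP y1v y2w.
set u := glue y1 y2 in dx *; congr EFin.
have rx := is_response_real dx; rewrite x0 -act_real_vec -/B in rx.
rewrite -addrA -(outputD hL hPc) act_glue -/u.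
rewrite /free_output /output addrA -actD.
have -> : response solvable 0 (cmx a) + response solvable (act B (real_vec u)) 0 = real_vec x.
  rewrite -(responseD hL hPc) add0r addr0.
  exact: (response_unique hL hPc (responseP _ _ _)).
rewrite act_glue act_real_vec crp_real_vec.
by apply: eq_bigr => i _; rewrite ipC.
Qed.

End plant.
End plant_signals.

Section game_of_plant.
Variable R : realType.
Local Notation C := (R[i]).
Local Notation toC r := ((r%:C)%C : R[i]).

(** The two bounds by [K] compare the seminorms of the game with the norms of the inputs, turning
    continuity in the seminorms into continuity in the norm topologies. *)
Lemma plant_game (n k q : nat) (A : 'M[R]_n) (B1 : 'M[R]_(n, k)) (B2 : 'M[R]_(n, q))
    (Q : 'M[R]_(n + (k + q))) (eps : R) (s0 : C) a :
  hurwitz A -> Q^T = Q -> 0 < eps -> complex.Re s0 = 0 ->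
  (forall s : C, complex.Re s = 0 -> let P := Defs.Pi A B1 B2 Q s in
     psd (block_mx (ulsubmx P) (toC eps *: ursubmx P)
                   (toC eps *: dlsubmx P) (- drsubmx P))) ->
  posdef (ulsubmx (Defs.Pi A B1 B2 Q s0)) -> negdef (drsubmx (Defs.Pi A B1 B2 Q s0)) ->
  exists (G : quadratic_game {ffun 'I_k -> l2fun R} {ffun 'I_q -> l2fun R}) (K : R),
    [/\ 0 <= K,
    forall v w (x : {ffun 'I_k -> l2fun R}) (y : {ffun 'I_q -> l2fun R}),
      agrees x v -> agrees y w -> gfun A B1 B2 Q a v w = (payoff G x y)%:E,
    forall x : {ffun 'I_k -> l2fun R}, qg_q1 G x x <= K * \sum_i ip (x i) (x i) &
    forall y : {ffun 'I_q -> l2fun R}, qg_q2 G y y <= K * \sum_i ip (y i) (y i)].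
Proof.
move=> hA Qsym eps0 s00 Ppsd Ppos Pneg.
have [P hP] := hurwitz_lyapunov hA.
have [Pc hPc] : exists Pc, complex_lyapunov (cmx A) Pc := hurwitz_complex_lyapunov hA.
have hQ : ctr (cmx Q) = cmx Q by rewrite ctr_cmx Qsym.
have [hz0 sE] := cayley_inv s00; set z0 := _ / _ in hz0 sE.
pose D := density (cmx A) (cmx (row_mx B1 B2)) (cmx Q).
have DE z : D z = Defs.Pi A B1 B2 Q (cayley z) by [].
have Dpsd z : circle z -> psd (block_mx (ulsubmx (D z)) (toC eps *: ursubmx (D z))
    (toC eps *: dlsubmx (D z)) (- drsubmx (D z))).
  by move=> hz; rewrite DE; apply: Ppsd; exact: Re_cayley.
have Dpos : posdef (ulsubmx (D z0)) by rewrite DE sE.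
have Dneg : negdef (drsubmx (D z0)) by rewrite DE sE.
have hL := clag_lagged R.
have [G [GE [q1E q2E]]] := plant_quadratic_game hL (@clag0_rp R) hPc hA
  (clag_solvable hP) hQ eps0 hz0 Dpsd Dpos Dneg (@real_vec_lin R k) (@real_vec_lin R q) (cmx a).
have [K1 K10 HK1] := cost_bounded hL hPc hA (clag_solvable hP) (cmx (row_mx B1 B2)) (cmx Q)
  (col_mx 1%:M 0 : 'M[C]_(k + q, k)).
have [K2 K20 HK2] := cost_bounded hL hPc hA (clag_solvable hP) (cmx (row_mx B1 B2)) (cmx Q)
  (col_mx 0 1%:M : 'M[C]_(k + q, q)).
have S0 m (x : 'I_m -> l2fun R) : 0 <= \sum_i ip (x i) (x i).
  by apply: sumr_ge0 => i _; exact: ip_ge0.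
exists G, (K1 + K2); split; first exact: addr_ge0.
- by move=> v w x y xv yw; rewrite (gfun_real_vec _ _ _ hP hPc _ xv yw) GE.
- move=> x; rewrite q1E -crp_real_vec; apply: le_trans (ler_norm _) _.
  apply: le_trans (HK1 _) _; rewrite crp_real_vec; apply: ler_wpM2r; first exact: S0.
  by rewrite lerDl.
- move=> y; rewrite q2E -crp_real_vec; apply: le_trans (ler_norm _) _; rewrite normrN.
  apply: le_trans (HK2 _) _; rewrite crp_real_vec; apply: ler_wpM2r; first exact: S0.
  by rewrite lerDr.
Qed.

End game_of_plant.

Theorem theorem2p3 (R : realType) (n k q : nat) (A : 'M[R]_n)
  (B1 : 'M[R]_(n, k)) (B2 : 'M[R]_(n, q)) (Q : 'M[R]_(n + (k + q))) :
  hurwitz A ->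
  Q^T = Q ->
  (exists (eps : R) (s0 : R[i]), 0 < eps /\ complex.Re s0 = 0 /\
    (forall s : R[i], complex.Re s = 0 ->
       let P := Pi A B1 B2 Q s in
       psd (block_mx (ulsubmx P) ((eps%:C)%C *: ursubmx P)
                     ((eps%:C)%C *: dlsubmx P) (- drsubmx P))) /\
    posdef (ulsubmx (Pi A B1 B2 Q s0)) /\ negdef (drsubmx (Pi A B1 B2 Q s0))) ->
  forall a : 'cV[R]_n,
    let g := gfun A B1 B2 Q a in
    let gv := fun w => ereal_inf [set g v w | v in L2 k] in
    let gw := fun v => ereal_sup [set g v w | w in L2 q] in
    (* (a) finiteness and continuity of g_v on L^2_q and g_w on L^2_k *)
    ((forall w, L2 q w -> gv w \is a fin_num) /\
     (forall w0, L2 q w0 -> forall e : R, 0 < e -> exists2 d : R, 0 < d &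
        forall w, L2 q w -> L2norm (fun t => w t - w0 t) < d ->
          `|fine (gv w) - fine (gv w0)| < e) /\
     (forall v, L2 k v -> gw v \is a fin_num) /\
     (forall v0, L2 k v0 -> forall e : R, 0 < e -> exists2 d : R, 0 < d &
        forall v, L2 k v -> L2norm (fun t => v t - v0 t) < d ->
          `|fine (gw v) - fine (gw v0)| < e)) /\
    (* (b) inf sup = sup inf *)
    ereal_inf [set gw v | v in L2 k] = ereal_sup [set gv w | w in L2 q].
Proof.
move=> hA Qsym [eps [s0 [eps0 [s00 [Ppsd [Ppos Pneg]]]]]] a g gv gw.
have [G [K [K0 gE q1K q2K]]] := plant_game a hA Qsym eps0 s00 Ppsd Ppos Pneg.
(* Every input agrees with a tuple of signals and conversely, so the infimum may be taken over the
   vector space on which the abstract game lives. *)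
have gvE w (y : {ffun 'I_q -> l2fun R}) : L2 q w -> agrees y w -> gv w = (lower G y)%:E.
  move=> hw yw; rewrite /gv -ereal_inf_lower; congr ereal_inf.
  apply/seteqP; split=> [_ [v hv <-]|_ [x _ <-]].
    by have [x xv] := L2_agrees hv; exists x => //; rewrite -(gE v w x y).
  by exists (l2col x); [exact: l2col_L2|rewrite /g (gE _ _ x y)].
have gwE v (x : {ffun 'I_k -> l2fun R}) : L2 k v -> agrees x v -> gw v = (upper G x)%:E.
  move=> hv xv; rewrite /gw -ereal_sup_upper; congr ereal_sup.
  apply/seteqP; split=> [_ [w hw <-]|_ [y _ <-]].
    by have [y yw] := L2_agrees hw; exists y => //; rewrite -(gE v w x y).
  by exists (l2col y); [exact: l2col_L2|rewrite /g (gE _ _ x y)].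
split; last first.
  transitivity (ereal_inf (range (fun x => (upper G x)%:E))).
    congr ereal_inf.
    apply/seteqP; split=> [_ [v hv <-]|_ [x _ <-]].
      by have [x xv] := L2_agrees hv; exists x => //; rewrite (gwE v x).
    by exists (l2col x); [exact: l2col_L2|rewrite (gwE _ x)//; exact: l2col_L2].
  rewrite minimax_value; congr ereal_sup.
  apply/seteqP; split=> [_ [y _ <-]|_ [w hw <-]].
    by exists (l2col y); [exact: l2col_L2|rewrite (gvE _ y)//; exact: l2col_L2].
  by have [y yw] := L2_agrees hw; exists y => //; rewrite (gvE w y).
split; first by move=> w hw; have [y yw] := L2_agrees hw; rewrite (gvE w y).
split; last split.
- move=> w0 hw0 e e0; have [y0 yw0] := L2_agrees hw0.
  have [d d0 Hd] := lower_continuous G y0 e0; exists (Num.sqrt (d / (K + 1))).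
    by rewrite sqrtr_gt0 divr_gt0// ltr_wpDl.
  move=> w hw dw; have [y yw] := L2_agrees hw.
  rewrite (gvE w y)// (gvE w0 y0)//= -[X in lower G X](subrK y0) (addrC (y - y0)); apply: Hd.
  apply: le_trans (q2K _) _; exact: (L2norm_small K0 d0 yw yw0 dw).
- by move=> v hv; have [x xv] := L2_agrees hv; rewrite (gwE v x).
move=> v0 hv0 e e0; have [x0 xv0] := L2_agrees hv0.
have [d d0 Hd] := upper_continuous G x0 e0; exists (Num.sqrt (d / (K + 1))).
  by rewrite sqrtr_gt0 divr_gt0// ltr_wpDl.
move=> v hv dv; have [x xv] := L2_agrees hv.
rewrite (gwE v x)// (gwE v0 x0)//= -[X in upper G X](subrK x0) (addrC (x - x0)); apply: Hd.
apply: le_trans (q1K _) _; exact: (L2norm_small K0 d0 xv xv0 dv).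
Qed.
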